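(* For Einstein warped $\mathrm{Spin}(7)$-structures the following hold (admissibility of a strict type is relative to the sign of the scalar curvature). (i) For every strict type admissible for zero scalar curvature there exists a warped $\mathrm{Spin}(7)$-structure of that strict type whose induced metric is Ricci flat. (ii) For every strict type admissible for positive scalar curvature there exists a warped $\mathrm{Spin}(7)$-structure of that strict type whose induced metric is Einstein with positive scalar curvature. (iii) For every strict type admissible for negative scalar curvature, except for $\mathcal{Y}_2$ (for which no Einstein warped $\mathrm{Spin}(7)$-structure of negative scalar curvature exists), there exists a warped $\mathrm{Spin}(7)$-structure of that strict type whose induced metric is Einstein with negative scalar curvature.
   Context: A $\mathrm{G}_2$-structure on a 7-manifold $M$ is a 3-form $\varphi$ for which there are local coframes with $\varphi=e^{127}+e^{347}+e^{567}+e^{135}-e^{146}-e^{236}-e^{245}$; these are declared orthonormal and oriented, defining the metric $g_\varphi$ and Hodge star $\ast_7$. A $\mathrm{Spin}(7)$-structure on an 8-manifold $N$ is a 4-form $\phi$ for which there are local coframes $\{e^1,\dots,e^8\}$ with $\phi=e^{1278}+e^{3478}+e^{5678}+e^{1358}-e^{1468}-e^{2368}-e^{2458}+e^{1234}+e^{1256}+e^{3456}+e^{1367}+e^{1457}+e^{2357}-e^{2467}$; these are declared orthonormal and oriented, defining the metric $g_\phi$ and Hodge star $\ast_8$. Its torsion forms are the unique $\lambda_1\in\Omega^1(N)$ and $\lambda_5\in\Omega^5_{48}(N)=\{\gamma\in\Omega^5(N):\phi\wedge\ast_8\gamma=0\}$ with $d\phi=\lambda_1\wedge\phi+\lambda_5$.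 Classes: $\mathcal{P}$ (parallel): $\lambda_1=\lambda_5=0$; $\mathcal{Y}_1$ (locally conformal parallel): $\lambda_5=0$; $\mathcal{Y}_2$ (balanced): $\lambda_1=0$; $\mathcal{Y}=\mathcal{Y}_1\oplus\mathcal{Y}_2$: no condition. A structure is of a given strict type if it belongs to that class and to no proper subclass. A warped $\mathrm{Spin}(7)$-structure is one of the form $\phi=f^3(t)\,\varphi\wedge dt+f^4(t)\ast_7\varphi$ on $N=I_f\times M$, where $(M,\varphi)$ is a $\mathrm{G}_2$ manifold, $I_f\subset\mathbb{R}$ is an open interval with coordinate $t$, and $f$ is a smooth nonconstant nowhere vanishing function on $I_f$. Then $g_\phi=f^2g_\varphi+dt^2$. Admissible: a class is admissible for a given sign (zero, positive, negative) of the scalar curvature if the formula $Scal(g_\phi)=\frac{21}{8}|\lambda_1|^2-\frac12|\lambda_5|^2+\frac72 d^{\ast_8}\lambda_1$ does not obstruct the existence of an Einstein structure of that strict type with scalar curvature of that sign. Thus the non-admissible types are: $\mathcal{Y}_2$ for zero scalar curvature; $\mathcal{P}$ and $\mathcal{Y}_2$ for positive scalar curvature; $\mathcal{P}$ for negative scalar curvature. *)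

(* Defs.v *)
From mathcomp Require Import all_boot all_order all_algebra.
From mathcomp Require Import all_classical all_reals all_analysis.

Set Implicit Arguments.
Unset Strict Implicit.
Unset Printing Implicit Defensive.

Import Order.TTheory GRing.Theory Num.Theory.
Import numFieldNormedType.Exports.

Local Open Scope ring_scope.

Section Euclidean.
Variables (R : realType) (n : nat).
Implicit Types (U : set 'rV[R]_n) (x : 'rV[R]_n).

Definition partial (i : 'I_n) (h : 'rV[R]_n -> R) : 'rV[R]_n -> R :=
  fun x => 'D_(delta_mx 0 i) h x.

Definition partials (s : seq 'I_n) (h : 'rV[R]_n -> R) : 'rV[R]_n -> R :=
  foldr partial h s.

(* C^oo on an open set: all iterated partial derivatives exist and are
   continuous there. *)
Definition smooth_on U (h : 'rV[R]_n -> R) : Prop :=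
  forall (s : seq 'I_n) x, U x ->
    {for x, continuous (partials s h)} /\
    forall i, derivable (partials s h) x (delta_mx 0 i).

Definition jacobian (m : nat) (F : 'rV[R]_n -> 'rV[R]_m) x : 'M[R]_(m, n) :=
  \matrix_(i, j) partial j (fun y => F y 0 i) x.

End Euclidean.

(* An element of the exterior algebra of (R^n)^*: the value at S is the
   coefficient of dx^{i_1} /\ ... /\ dx^{i_k}, where S = {i_1 < ... < i_k}. *)
Definition ext (R : realType) (n : nat) := {ffun {set 'I_n} -> R}.

Section Exterior.
Variables (R : realType) (n : nat).

(* dx^A /\ dx^B = shuffle_sign A B dx^{A u B} for disjoint A and B. *)
Definition shuffle_sign (A B : {set 'I_n}) : R :=
  (-1) ^+ #|[pred p : 'I_n * 'I_n | [&& p.1 \in A, p.2 \in B & (p.2 < p.1)%N]]|.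

Definition wedge (a b : ext R n) : ext R n :=
  [ffun S : {set 'I_n} => \sum_(A : {set 'I_n} | A \subset S)
     shuffle_sign A (S :\: A) * a A * b (S :\: A)].

Definition ext1 : ext R n := [ffun S : {set 'I_n} => (S == finset.set0)%:R].

Definition covector (u : 'rV[R]_n) : ext R n :=
  [ffun S : {set 'I_n} => \sum_i (S == [set i])%:R * u 0 i].

(* The wedge product of the rows of E with indices s, in the order of s. *)
Definition row_wedge (m : nat) (E : 'M[R]_(m, n)) (s : seq 'I_m) : ext R n :=
  foldr (fun i w => wedge (covector (row i E)) w) ext1 s.

(* Pullback by the linear map with matrix L, i.e. by v |-> L v. *)
Definition pull (m : nat) (L : 'M[R]_(m, n)) (w : ext R m) : ext R n :=
  \sum_(T : {set 'I_m}) w T *: row_wedge L (enum T).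

Definition homogeneous (k : nat) (w : ext R n) : Prop :=
  forall S : {set 'I_n}, #|S| != k -> w S = 0.

(* Hodge star for the metric matrix g and the volume form v, characterised by
   a /\ hodge g v b = <a, b>_g v.  The coefficients of
   row_wedge (invmx g) (enum A) are the minors of g^-1 with row set A, so the
   inner sum is <dx^A, b>_g for A = ~: S. *)
Definition hodge (g : 'M[R]_n) (v b : ext R n) : ext R n :=
  [ffun S : {set 'I_n} => shuffle_sign (~: S) S * v [set: 'I_n] *
     \sum_(B : {set 'I_n}) row_wedge (invmx g) (enum (~: S)) B * b B].

Definition extd (w : 'rV[R]_n -> ext R n) (x : 'rV[R]_n) : ext R n :=
  \sum_i wedge (covector (delta_mx 0 i))
               [ffun S : {set 'I_n} => partial i (fun y => w y S) x].

End Exterior.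

Section Curvature.
Variables (R : realType) (n : nat) (g : 'rV[R]_n -> 'M[R]_n).
Implicit Types (x : 'rV[R]_n) (i j k l : 'I_n).

(* christoffel k i j = Gamma^k_{ij} *)
Definition christoffel k i j x : R :=
  2^-1 * \sum_l invmx (g x) k l *
    (partial i (fun y => g y j l) x + partial j (fun y => g y i l) x
     - partial l (fun y => g y i j) x).

Definition ricci x : 'M[R]_n := \matrix_(i, j)
  \sum_k (partial k (christoffel k i j) x - partial j (christoffel k i k) x
    + \sum_l (christoffel k k l x * christoffel l i j x
              - christoffel k j l x * christoffel l i k x)).

Definition scal x : R := \sum_i \sum_j invmx (g x) i j * ricci x i j.

End Curvature.

(* A space with a family of R^n-valued coordinate systems; coord a is only
   meaningful on chart_dom a. *)
Record atlas (R : realType) (n : nat) := Atlas {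
  space :> topologicalType;
  chart_index : Type;
  chart_dom : chart_index -> set space;
  coord : chart_index -> space -> 'rV[R]_n }.

Local Open Scope classical_set_scope.

Section Manifold.
Variables (R : realType) (n : nat) (M : atlas R n).

Definition cdom (a : chart_index M) : set 'rV[R]_n := coord a @` chart_dom a.

(* F expresses the change of coordinates from a to b; its values outside the
   overlap are irrelevant. *)
Definition transition (a b : chart_index M)
    (F : 'rV[R]_n -> 'rV[R]_n) : Prop :=
  forall p : M, chart_dom a p -> chart_dom b p -> F (coord a p) = coord b p.

Definition is_chart (a : chart_index M) : Prop :=
  [/\ open (chart_dom a),
      {within chart_dom a, continuous (coord a)},
      (forall p q : M, chart_dom a p -> chart_dom a q ->
         coord a p = coord a q -> p = q)
    & forall O : set M, open O -> O `<=` chart_dom a -> open (coord a @` O)].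

Definition is_manifold : Prop :=
  [/\ hausdorff_space M /\ @second_countable M,
      (exists p : M, True),
      (forall p : M, exists a, chart_dom a p),
      (forall a, is_chart a)
    & forall a b, exists2 F, transition a b F &
        forall i, smooth_on (coord a @` (chart_dom a `&` chart_dom b))
                            (fun x => F x 0 i)].

(* Fields on M are given by their coordinate expressions in the charts; the
   values of w a matter only on cdom a. *)
Definition chart_field (V : Type) := chart_index M -> 'rV[R]_n -> V.

Definition is_form (k : nat) (w : chart_field (ext R n)) : Prop :=
  [/\ (forall a x, cdom a x -> homogeneous k (w a x)),
      (forall a S, smooth_on (cdom a) (fun x => w a x S))
    & forall a b F, transition a b F ->
        forall p : M, chart_dom a p -> chart_dom b p ->
        w a (coord a p) = pull (jacobian F (coord a p)) (w b (coord b p))].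

Definition is_metric (g : chart_field 'M[R]_n) : Prop :=
  [/\ (forall a x, cdom a x -> (g a x)^T = g a x /\
         forall u : 'rV[R]_n, u != 0 -> 0 < (u *m g a x *m u^T) 0 0),
      (forall a i j, smooth_on (cdom a) (fun x => g a x i j))
    & forall a b F, transition a b F ->
        forall p : M, chart_dom a p -> chart_dom b p ->
        let J := jacobian F (coord a p) in
        g a (coord a p) = J^T *m g b (coord b p) *m J].

Definition vanishes (w : chart_field (ext R n)) : Prop :=
  forall a x, cdom a x -> w a x = 0.

Definition einstein (g : chart_field 'M[R]_n) : Prop :=
  exists c : R, forall a x, cdom a x -> ricci (g a) x = c *: g a x.

Definition ricci_flat (g : chart_field 'M[R]_n) : Prop :=
  forall a x, cdom a x -> ricci (g a) x = 0.

Definition positive_scal (g : chart_field 'M[R]_n) : Prop :=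
  forall a x, cdom a x -> 0 < scal (g a) x.

Definition negative_scal (g : chart_field 'M[R]_n) : Prop :=
  forall a x, cdom a x -> scal (g a) x < 0.

(* A differential form together with the metric and the volume form that it
   induces; for G2- and Spin(7)-structures (see locally_modelled) the last two
   are determined by the form, as its stabiliser lies in SO(7), resp. SO(8). *)
Record structure := Structure {
  form : chart_field (ext R n);
  metric : chart_field 'M[R]_n;
  volume : chart_field (ext R n) }.

(* Local coframes E (the 1-forms e^i are the rows of E) exist around every
   point, in which the form is model E and which are orthonormal and oriented
   for the metric and the volume form. *)
Definition locally_modelled (k : nat) (model : 'M[R]_n -> ext R n)
    (s : structure) : Prop :=
  [/\ is_form k (form s), is_metric (metric s), is_form n (volume s)
    & forall a x, cdom a x ->
        exists (U : set 'rV[R]_n) (E : 'rV[R]_n -> 'M[R]_n),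
        [/\ open U, U x, U `<=` cdom a,
            (forall i j, smooth_on U (fun y => E y i j))
          & forall y, U y ->
            [/\ E y \in unitmx,
                form s a y = model (E y),
                metric s a y = (E y)^T *m E y
              & volume s a y = row_wedge (E y) (enum 'I_n)]]].

End Manifold.

(* monomial E [:: i; j; ...] = e^{ij...}, where e^1, e^2, ... are the rows
   of E, numbered from 1. *)
Definition monomial (R : realType) (n : nat) (E : 'M[R]_n.+1) (s : seq nat) :
    ext R n.+1 :=
  row_wedge E [seq inord i.-1 | i <- s].

Definition g2_model (R : realType) (E : 'M[R]_7) : ext R 7 :=
  let e := monomial E in
  e [:: 1; 2; 7] + e [:: 3; 4; 7] + e [:: 5; 6; 7] + e [:: 1; 3; 5]
  - e [:: 1; 4; 6] - e [:: 2; 3; 6] - e [:: 2; 4; 5].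

Definition spin7_model (R : realType) (E : 'M[R]_8) : ext R 8 :=
  let e := monomial E in
  e [:: 1; 2; 7; 8] + e [:: 3; 4; 7; 8] + e [:: 5; 6; 7; 8]
  + e [:: 1; 3; 5; 8] - e [:: 1; 4; 6; 8] - e [:: 2; 3; 6; 8]
  - e [:: 2; 4; 5; 8] + e [:: 1; 2; 3; 4] + e [:: 1; 2; 5; 6]
  + e [:: 3; 4; 5; 6] + e [:: 1; 3; 6; 7] + e [:: 1; 4; 5; 7]
  + e [:: 2; 3; 5; 7] - e [:: 2; 4; 6; 7].

Definition is_g2_structure (R : realType) (M : atlas R 7) (s : structure M) :=
  locally_modelled 3 (@g2_model R) s.

Definition is_spin7_structure (R : realType) (N : atlas R 8)
    (s : structure N) :=
  locally_modelled 4 (@spin7_model R) s.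

Definition star (R : realType) (n : nat) (M : atlas R n) (s : structure M)
    (w : chart_field M (ext R n)) : chart_field M (ext R n) :=
  fun a x => hodge (metric s a x) (volume s a x) (w a x).

Section Torsion.
Variables (R : realType) (N : atlas R 8) (s : structure N).

Definition torsion_forms (l1 l5 : chart_field N (ext R 8)) : Prop :=
  [/\ is_form 1 l1, is_form 5 l5,
      (forall a x, cdom a x -> wedge (form s a x) (star s l5 a x) = 0)
    & forall a x, cdom a x ->
        extd (form s a) x = wedge (l1 a x) (form s a x) + l5 a x].

End Torsion.

Inductive torsion_class := ClassP | ClassY1 | ClassY2 | ClassY.

Definition proper_subclass (c d : torsion_class) : bool :=
  match c, d with
  | ClassP, (ClassY1 | ClassY2 | ClassY) => true
  | (ClassY1 | ClassY2), ClassY => true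
  | _, _ => false
  end.

(* The torsion forms always exist and are unique. *)
Definition in_class (R : realType) (N : atlas R 8) (s : structure N)
    (c : torsion_class) : Prop :=
  exists l1 l5 : chart_field N (ext R 8), torsion_forms s l1 l5 /\
    match c with
    | ClassP => vanishes l1 /\ vanishes l5
    | ClassY1 => vanishes l5
    | ClassY2 => vanishes l1
    | ClassY => True
    end.

Definition strict_type (R : realType) (N : atlas R 8) (s : structure N)
    (c : torsion_class) : Prop :=
  in_class s c /\ forall d, proper_subclass d c -> ~ in_class s d.

Inductive curvature_sign := ScalZero | ScalPositive | ScalNegative.

(* The strict types for which
   Scal = 21/8 |l1|^2 - 1/2 |l5|^2 + 7/2 d^* l1 does not exclude an Einstein
   structure with scalar curvature of the given sign. *)
Definition admissible (sg : curvature_sign) (c : torsion_class) : bool :=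
  match sg, c with
  | ScalZero, ClassY2 => false
  | ScalPositive, (ClassP | ClassY2) => false
  | ScalNegative, ClassP => false
  | _, _ => true
  end.

Section Cylinder.
Variables (R : realType) (n : nat) (I : set R) (M : atlas R n).

(* Coordinates on I x M: those of M followed by t. *)
Definition cyl_coord (x : 'rV[R]_n) (t : R) : 'rV[R]_n.+1 :=
  \row_i (if unlift ord_max i is Some j then x 0 j else t).

Definition base_part (y : 'rV[R]_n.+1) : 'rV[R]_n :=
  \row_j y 0 (lift ord_max j).

Definition time_part (y : 'rV[R]_n.+1) : R := y 0 ord_max.

Definition cylinder : atlas R n.+1 :=
  @Atlas R n.+1 (set_type I * M)%type (chart_index M)
    (fun a => [set q | chart_dom a q.2])
    (fun a q => cyl_coord (coord a q.2) (set_val q.1)).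

(* Matrix of the differential of the projection I x M -> M. *)
Definition base_mx : 'M[R]_(n, n.+1) :=
  \matrix_(i, j) (j == lift ord_max i)%:R.

Definition dt : ext R n.+1 := covector (delta_mx 0 ord_max).

End Cylinder.

(* f^3(t) phi /\ dt + f^4(t) *phi *)
Definition warped_form (R : realType) (I : set R) (M : atlas R 7)
    (s : structure M) (f : R -> R) : chart_field (cylinder I M) (ext R 8) :=
  fun a y =>
    let x := base_part y in let t := time_part y in
    f t ^+ 3 *: wedge (pull (base_mx R 7) (form s a x)) (dt R 7)
    + f t ^+ 4 *: pull (base_mx R 7) (star s (form s) a x).

Record warped_spin7 (R : realType) := WarpedSpin7 {
  base : atlas R 7;
  base_manifold : is_manifold base;
  g2 : structure base;
  g2_structure : is_g2_structure g2;
  warp_interval : set R;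
  interval_open : open warp_interval /\ is_interval warp_interval;
  warp : R -> R;
  warp_smooth : forall k t, warp_interval t ->
    derivable (derive1n k warp : R -> R) t 1;
  warp_neq0 : forall t, warp_interval t -> warp t != 0;
  warp_nonconstant : exists t u,
    [/\ warp_interval t, warp_interval u & warp t != warp u];
  spin7 :> structure (cylinder warp_interval base);
  spin7_structure : is_spin7_structure spin7;
  spin7_form : forall a y, cdom a y ->
    form spin7 a y = warped_form g2 warp a y }.

(* Main.v *)
(** A warped structure is Einstein, with constant 7 lam, as soon as the base metric
    has Ric = 6 g and the warping function satisfies f'^2 + lam f^2 = 1.  The base
    is a chart of the regular Sasaki-Einstein metric on the circle bundle over
    CP^1 x CP^1 x CP^1, with its nearly parallel G2-form (d phi = 4 *phi); it gives
    d Phi = (4 f' + 4)/f dt /\ Phi, hence type P for f = -t and type Y1 for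
    f = t, sin, sinh.  Exchanging e^3 and e^4 in the coframe keeps the metric but
    makes the torsion generic, which is type Y.

    In type Y2, d Phi = lambda_5 is orthogonal to dt /\ Phi, which says that
    28 f' + <*phi, d phi> = 0; so f is affine in t, Ric(dt, dt) = -7 f''/f = 0, and
    an Einstein metric of this type is Ricci flat. *)
Require Import Defs.
From mathcomp Require Import all_boot all_order all_algebra.
From mathcomp Require Import all_classical all_reals all_analysis.
From mathcomp Require Import ring lra zify.

Set Implicit Arguments.
Unset Strict Implicit.
Unset Printing Implicit Defensive.

Import Order.TTheory GRing.Theory Num.Theory.
Import numFieldNormedType.Exports.

Local Open Scope ring_scope.

(** * Exterior algebra *)

(** A structure carries its metric and volume form as separate data, tied to the 4-form only through
    unspecified local coframes. Nonexistence concerns an arbitrary such structure, of which only the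
    4-form is known to be warped; hence the stabiliser computation, which recovers metric and volume
    from the 4-form. The examples come with a global coframe, where this question does not arise. In
    the chart of the circle bundle all coefficients are polynomials in the coordinates and in the
    functions 1 / (1 + 2 |z_k|^2). The connection forms are not constant combinations of the seven
    coframe elements; adjoining the potentials a_2 and a_3 as two further 1-forms gives a system
    with integer structure constants, so that torsion and curvature are found by integer arithmetic.
    Strictness is tested at one point. With f' > 0 the sum 28 f' + <*phi, d phi> cannot vanish, as
    its second term is 28 for the nearly parallel form and 20 at the origin for the swapped one. For
    type P the two terms must cancel instead, which is why f decreases there. *)

Section ExteriorAlgebra.
Import mathcomp.boot.finset mathcomp.boot.fintype.
Variables (R : realType) (n : nat).
Implicit Types (A B C D S T : {set 'I_n}) (a b c w : ext R n) (u v : 'rV[R]_n).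

Local Notation sg := (@shuffle_sign R n).

(** As a double sum, the count of inversions is additive over disjoint unions in either argument,
    which gives the multiplicativity of the sign. *)
Definition inversions A B : nat :=
  (\sum_(i in A) \sum_(j in B) (j < i)%N)%N.

Lemma shuffle_signE A B : sg A B = (-1) ^+ inversions A B.
Proof.
rewrite /shuffle_sign -sum1_card /inversions pair_big_dep /=.
congr (_ ^+ _); rewrite [RHS]big_mkcond [LHS]big_mkcond /=.
apply: eq_bigr => -[i j] _ /=; rewrite !inE /=.
by case: (i \in A); case: (j \in B); case: (j < i)%N.
Qed.

Lemma sum_disjointU A B (F : 'I_n -> nat) : [disjoint A & B] ->
  (\sum_(i in A :|: B) F i = \sum_(i in A) F i + \sum_(i in B) F i)%N.
Proof.
move=> dAB; rewrite (big_setID A) /= setIUl setIid (setIC B A).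
rewrite (eqP (_ : A :&: B == set0)); last by rewrite setI_eq0.
by rewrite setU0 setDUl setDv set0U (setDidPl _)// disjoint_sym.
Qed.

Lemma shuffle_signUl A B C : [disjoint A & B] ->
  sg (A :|: B) C = sg A C * sg B C.
Proof.
by move=> dAB; rewrite !shuffle_signE -exprD /inversions sum_disjointU.
Qed.

Lemma shuffle_signUr A B C : [disjoint B & C] ->
  sg A (B :|: C) = sg A B * sg A C.
Proof.
move=> dBC; rewrite !shuffle_signE -exprD /inversions -big_split /=.
by congr (_ ^+ _); apply: eq_bigr => i _; rewrite sum_disjointU.
Qed.

Lemma shuffle_sign_sqr A B : sg A B * sg A B = 1.
Proof. by rewrite shuffle_signE -exprD addnn -mul2n exprM sqrrN !expr1n. Qed.

Lemma shuffle_sign_neq0 A B : sg A B != 0.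
Proof. by rewrite shuffle_signE signr_eq0. Qed.

Lemma shuffle_sign0l B : sg set0 B = 1.
Proof. by rewrite shuffle_signE /inversions big_set0. Qed.

Lemma shuffle_sign0r A : sg A set0 = 1.
Proof.
by rewrite shuffle_signE /inversions big1 ?expr0// => i _; rewrite big_set0.
Qed.

Lemma shuffle_sign_swap (i j : 'I_n) : i != j ->
  sg [set i] [set j] = - sg [set j] [set i].
Proof.
move=> ij; rewrite !shuffle_signE /inversions !big_set1.
have := ij; rewrite -val_eqE /= neq_ltn => /orP[] lt_ij; rewrite lt_ij.
  by rewrite ltnNge (ltnW lt_ij) expr0 expr1 opprK.
by rewrite ltnNge (ltnW lt_ij) expr0 expr1.
Qed.

Definition ebasis A : ext R n := [ffun S => (S == A)%:R].

Lemma ext_basis w : w = \sum_A w A *: ebasis A.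
Proof.
apply/ffunP => S; rewrite sum_ffunE (bigD1 S) //= !ffunE eqxx big1 ?addr0.
  by rewrite /GRing.scale /= mulr1.
by move=> A; rewrite !ffunE eq_sym => /negbTE ->; rewrite scaler0.
Qed.

Lemma ext_scaleE (k : R) w S : (k *: w) S = k * w S.
Proof. by rewrite ffunE. Qed.

Lemma wedgeDl a b c : wedge (a + b) c = wedge a c + wedge b c.
Proof.
apply/ffunP => S; rewrite !ffunE -big_split /=.
by apply: eq_bigr => A _; rewrite ffunE mulrDr mulrDl.
Qed.

Lemma wedgeDr a b c : wedge a (b + c) = wedge a b + wedge a c.
Proof.
apply/ffunP => S; rewrite !ffunE -big_split /=.
by apply: eq_bigr => A _; rewrite ffunE mulrDr.
Qed.

Lemma wedgeZl k a b : wedge (k *: a) b = k *: wedge a b.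
Proof.
apply/ffunP => S; rewrite !ffunE /GRing.scale /= mulr_sumr.
by apply: eq_bigr => A _; rewrite ffunE /GRing.scale /=; ring.
Qed.

Lemma wedgeZr k a b : wedge a (k *: b) = k *: wedge a b.
Proof.
apply/ffunP => S; rewrite !ffunE /GRing.scale /= mulr_sumr.
by apply: eq_bigr => A _; rewrite ffunE /GRing.scale /=; ring.
Qed.

Lemma wedge0l a : wedge 0 a = 0.
Proof. by rewrite -[X in wedge X](scale0r 0) wedgeZl scale0r. Qed.

Lemma wedge0r a : wedge a 0 = 0.
Proof. by rewrite -[X in wedge _ X](scale0r 0) wedgeZr scale0r. Qed.

Lemma wedgeNl a b : wedge (- a) b = - wedge a b.
Proof. by rewrite -scaleN1r wedgeZl scaleN1r. Qed.

Lemma wedgeNr a b : wedge a (- b) = - wedge a b.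
Proof. by rewrite -scaleN1r wedgeZr scaleN1r. Qed.

Lemma wedge_suml (I : Type) (r : seq I) (P : pred I) (F : I -> ext R n) b :
  wedge (\sum_(i <- r | P i) F i) b = \sum_(i <- r | P i) wedge (F i) b.
Proof.
by apply: (big_morph (fun a => wedge a b)) => [x y|]; rewrite ?wedgeDl ?wedge0l.
Qed.

Lemma wedge_sumr (I : Type) (r : seq I) (P : pred I) (F : I -> ext R n) a :
  wedge a (\sum_(i <- r | P i) F i) = \sum_(i <- r | P i) wedge a (F i).
Proof.
by apply: (big_morph (wedge a)) => [x y|]; rewrite ?wedgeDr ?wedge0r.
Qed.

(** Both sides are sums over ordered partitions of S into three blocks. On the right the sum over A
    is moved outside and D is written as A u B; the signs then agree by multiplicativity over
    disjoint unions. *)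
Lemma wedgeA a b c : wedge a (wedge b c) = wedge (wedge a b) c.
Proof.
apply/ffunP => S; rewrite !ffunE.
under eq_bigr => A _ do rewrite ffunE mulr_sumr.
under [RHS]eq_bigr => D _ do rewrite ffunE mulr_sumr mulr_suml.
rewrite [RHS](exchange_big_dep (fun A => A \subset S)) /=; last first.
  by move=> D A DS AD; exact: subset_trans DS.
apply: eq_bigr => A AS; rewrite [RHS](reindex_onto (fun B => A :|: B) (fun D => D :\: A)) /=.
  rewrite [LHS]big_mkcond [RHS]big_mkcond; apply: eq_bigr => B _.
  have -> : (((A :|: B \subset S) && (A \subset A :|: B)) &&
      ((A :|: B) :\: A == B)) = (B \subset S :\: A).
    rewrite subsetUl andbT subUset AS /= subsetD setDUl setDv set0U.
    congr (_ && _); apply/eqP/idP => [/setDidPl//|dBA].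
    exact/setDidPl.
  case: ifPn => // BSA; have /andP[BS dBA] : (B \subset S) && [disjoint B & A].
    by rewrite -subsetD.
  have dAB : [disjoint A & B] by rewrite disjoint_sym.
  have -> : (A :|: B) :\: A = B.
    by rewrite setDUl setDv set0U; apply/setDidPl.
  have -> : S :\: (A :|: B) = (S :\: A) :\: B.
    by rewrite setDDl.
  have {1}-> : S :\: A = B :|: ((S :\: A) :\: B).
    by rewrite -{1}(setID (S :\: A) B) (setIidPr BSA).
  rewrite shuffle_signUr ?shuffle_signUl //; first by ring.
  by rewrite disjoint_sym -setI_eq0 setIDAC setDIl setDv setI0.
by move=> D /andP[DS AD]; rewrite -{2}(setID D A) (setIidPr AD).
Qed.

Lemma wedge1l a : wedge (ext1 R n) a = a.
Proof.
apply/ffunP => S; rewrite ffunE (bigD1 set0) ?sub0set //= big1.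
  by rewrite shuffle_sign0l ffunE eqxx !mul1r addr0 setD0.
by move=> A /andP[_ /negbTE A0]; rewrite ffunE A0 mulr0 mul0r.
Qed.

Lemma wedge1r a : wedge a (ext1 R n) = a.
Proof.
apply/ffunP => S; rewrite ffunE (bigD1 S) //= big1.
  by rewrite setDv shuffle_sign0r ffunE eqxx mulr1 mul1r addr0.
move=> A /andP[AS AnS]; rewrite ffunE [_ == set0]negbTE ?mulr0//.
by apply: contra AnS; rewrite setD_eq0 eqEsubset AS.
Qed.

Lemma wedge_basis A B : wedge (ebasis A) (ebasis B) =
  if [disjoint A & B] then sg A B *: ebasis (A :|: B) else 0.
Proof.
apply/ffunP => S; rewrite ffunE.
have E : \sum_(A0 : {set 'I_n} | A0 \subset S)
    sg A0 (S :\: A0) * ebasis A A0 * ebasis B (S :\: A0) =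
  if (A \subset S) && (S :\: A == B) then sg A B else 0.
  rewrite big_mkcond (bigD1 A) //= big1; last first.
    by move=> A0 /negbTE A0A; rewrite !ffunE A0A mulr0 mul0r if_same.
  rewrite !ffunE eqxx mulr1 addr0; case: ifP => //= _; rewrite mulrC.
  by case: eqP => [->|]; rewrite ?mul1r ?mul0r.
rewrite E; case: ifPn => [/andP[AS /eqP <-]|].
  have -> : [disjoint A & S :\: A].
    by rewrite -setI_eq0 setIDA setIC -setIDA setDv setI0.
  have -> : A :|: S :\: A = S by rewrite -{2}(setID S A) (setIidPr AS).
  by rewrite !ffunE eqxx /GRing.scale /= mulr1.
case: ifPn => [dAB|]; rewrite !ffunE // => H.
case: eqP => [SE|]; last by rewrite scaler0.
case/negP: H; rewrite SE subsetUl setDUl setDv set0U /=.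
by apply/eqP/setDidPl; rewrite disjoint_sym.
Qed.

Lemma covectorE u : covector u = \sum_i u 0 i *: ebasis [set i].
Proof.
apply/ffunP => S; rewrite ffunE sum_ffunE; apply: eq_bigr => i _.
by rewrite !ffunE /GRing.scale /= mulrC.
Qed.

Lemma covector_delta i : covector (delta_mx 0 i) = ebasis [set i].
Proof.
rewrite covectorE (bigD1 i) //= big1 ?addr0 ?mxE ?eqxx ?scale1r// => j ji.
by rewrite mxE (negbTE ji) andbF scale0r.
Qed.

Lemma covectorD u v : covector (u + v) = covector u + covector v.
Proof.
by rewrite !covectorE -big_split; apply: eq_bigr => i _; rewrite mxE scalerDl.
Qed.

Lemma covectorZ k u : covector (k *: u) = k *: covector u.
Proof.
by rewrite !covectorE scaler_sumr; apply: eq_bigr => i _; rewrite mxE scalerA.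
Qed.

Lemma covector0 : covector (0 : 'rV[R]_n) = 0.
Proof. by rewrite -(scale0r (0 : 'rV[R]_n)) covectorZ scale0r. Qed.

Lemma covector_sum (I : Type) (r : seq I) (P : pred I) (F : I -> 'rV[R]_n) :
  covector (\sum_(i <- r | P i) F i) = \sum_(i <- r | P i) covector (F i).
Proof.
by apply: (big_morph (fun u => covector u)); [exact: covectorD | exact: covector0].
Qed.

Lemma wedge_basis1C i j :
  wedge (ebasis [set i]) (ebasis [set j]) = - wedge (ebasis [set j]) (ebasis [set i]).
Proof.
rewrite !wedge_basis !disjoints1 !inE [j == i]eq_sym; case: eqP => /= [_|/eqP ij].
  by rewrite oppr0.
by rewrite shuffle_sign_swap // setUC scaleNr.
Qed.

Lemma wedge_covectorC u v :
  wedge (covector u) (covector v) = - wedge (covector v) (covector u).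
Proof.
rewrite !covectorE !wedge_suml -sumrN.
under eq_bigr => i _ do rewrite wedge_sumr.
under [RHS]eq_bigr => i _ do rewrite wedge_sumr -sumrN.
rewrite exchange_big; apply: eq_bigr => i _; apply: eq_bigr => j _.
by rewrite !(wedgeZl, wedgeZr) wedge_basis1C !scalerN !scalerA mulrC.
Qed.

Lemma wedge_covectorCA u v a : wedge (covector u) (wedge (covector v) a) =
  - wedge (covector v) (wedge (covector u) a).
Proof. by rewrite !wedgeA wedge_covectorC wedgeNl. Qed.

Lemma wedge_covector_sqr u : wedge (covector u) (covector u) = 0.
Proof.
have /eqP := wedge_covectorC u u; rewrite -subr_eq0 opprK -mulr2n -scaler_nat.
by rewrite scaler_eq0 pnatr_eq0 => /eqP.
Qed.

Lemma ffun_scaleE (T : finType) (V : lmodType R) (k : R) (f : {ffun T -> V}) x :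
  (k *: f) x = k *: f x.
Proof. by rewrite ffunE. Qed.

Lemma eq_ext_basis a b : (forall S, a S = b S) -> a = b.
Proof. by move=> ab; apply/ffunP. Qed.

Section Pairing.

(** The inner product of the Euclidean metric: the dx^S are orthonormal. *)
Definition pairing a b : R := \sum_S a S * b S.

Lemma pairingC a b : pairing a b = pairing b a.
Proof. by apply: eq_bigr => S _; rewrite mulrC. Qed.

Lemma pairingDl a b c : pairing (a + b) c = pairing a c + pairing b c.
Proof. by rewrite /pairing -big_split; apply: eq_bigr => S _; rewrite ffunE mulrDl. Qed.

Lemma pairingZl k a c : pairing (k *: a) c = k * pairing a c.
Proof. by rewrite /pairing mulr_sumr; apply: eq_bigr => S _; rewrite ffunE mulrA. Qed.

Lemma pairing0l c : pairing 0 c = 0.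
Proof. by rewrite -(scale0r (0 : ext R n)) pairingZl mul0r. Qed.

Lemma pairing_suml (I : Type) (r : seq I) (P : pred I) (F : I -> ext R n) b :
  pairing (\sum_(i <- r | P i) F i) b = \sum_(i <- r | P i) pairing (F i) b.
Proof.
by apply: (big_morph (fun a => pairing a b)) => [x y|]; rewrite ?pairingDl ?pairing0l.
Qed.

Lemma pairingDr a b c : pairing a (b + c) = pairing a b + pairing a c.
Proof. by rewrite !(pairingC a) pairingDl. Qed.

Lemma pairingZr k a c : pairing a (k *: c) = k * pairing a c.
Proof. by rewrite !(pairingC a) pairingZl. Qed.

Lemma pairing0r c : pairing c 0 = 0.
Proof. by rewrite pairingC pairing0l. Qed.

Lemma pairing_sumr (I : Type) (r : seq I) (P : pred I) (F : I -> ext R n) b :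
  pairing b (\sum_(i <- r | P i) F i) = \sum_(i <- r | P i) pairing b (F i).
Proof. by rewrite pairingC pairing_suml; apply: eq_bigr => i _; rewrite pairingC. Qed.

Lemma pairing_basis A b : pairing (ebasis A) b = b A.
Proof.
rewrite /pairing (bigD1 A) //= big1 ?ffunE ?eqxx ?mul1r ?addr0// => S.
by rewrite ffunE => /negbTE ->; rewrite mul0r.
Qed.

Lemma pairing_basis2 A B : pairing (ebasis A) (ebasis B) = (A == B)%:R.
Proof. by rewrite pairing_basis ffunE. Qed.

End Pairing.

Section Contraction.

(** Adjoint of exterior multiplication by u: contraction with the vector that the Euclidean metric
    identifies with u. *)
Definition intprod u b : ext R n :=
  [ffun S => pairing (wedge (covector u) (ebasis S)) b].

Lemma pairing_wedge_covector u a b :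
  pairing (wedge (covector u) a) b = pairing a (intprod u b).
Proof.
rewrite (ext_basis a) wedge_sumr !pairing_suml; apply: eq_bigr => A _.
by rewrite wedgeZr !pairingZl pairing_basis ffunE.
Qed.

Lemma intprodD u a b : intprod u (a + b) = intprod u a + intprod u b.
Proof. by apply/ffunP => S; rewrite !ffunE pairingDr. Qed.

Lemma intprodZ k u b : intprod u (k *: b) = k *: intprod u b.
Proof. by apply/ffunP => S; rewrite !ffunE pairingZr. Qed.

Lemma intprod_sum (I : Type) (r : seq I) (P : pred I) (F : I -> ext R n) u :
  intprod u (\sum_(i <- r | P i) F i) = \sum_(i <- r | P i) intprod u (F i).
Proof.
apply: (big_morph (intprod u)) => [x y|]; first exact: intprodD.
by rewrite -(scale0r (0 : ext R n)) intprodZ !scale0r.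
Qed.

Lemma intprod_lcomb u b : intprod u b = \sum_i u 0 i *: intprod (delta_mx 0 i) b.
Proof.
apply/ffunP => S; rewrite ffunE sum_ffunE covectorE wedge_suml pairing_suml.
by apply: eq_bigr => i _; rewrite !ffunE covector_delta wedgeZl pairingZl.
Qed.

Lemma intprod_basis i B : intprod (delta_mx 0 i) (ebasis B) =
  if i \in B then sg [set i] (B :\ i) *: ebasis (B :\ i) else 0.
Proof.
apply/ffunP => S; rewrite ffunE covector_delta wedge_basis disjoints1.
case: ifPn => [iS|]; last first.
  rewrite negbK pairing0l => iS; case: ifP => iB; rewrite !ffunE //.
  by case: eqP => [SE|]; [rewrite SE !inE eqxx in iS | rewrite scaler0].
rewrite pairingZl pairing_basis2; case: ifPn => iB; rewrite !ffunE; last first.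
  by case: eqP => [E|]; [rewrite -E !inE eqxx in iB | rewrite mulr0].
have -> : (i |: S == B) = (S == B :\ i).
  by apply/eqP/eqP => [<-|->]; rewrite ?setU1K ?setD1K.
by rewrite /GRing.scale /=; case: eqP => [->//|]; rewrite !mulr0.
Qed.

(** The antiderivation rule on basis elements, by membership of i and j in B. The sign is delicate
    only for i in B and j outside, where i has to be carried past j. *)
Lemma intprod_wedge_basis i j B :
  intprod (delta_mx 0 i) (wedge (ebasis [set j]) (ebasis B)) =
    (i == j)%:R *: ebasis B
    - wedge (ebasis [set j]) (intprod (delta_mx 0 i) (ebasis B)).
Proof.
rewrite wedge_basis disjoints1 intprod_basis.
case: (boolP (i \in B)) => iB; case: (boolP (j \in B)) => jB /=; last 1 first.
- rewrite intprodZ intprod_basis inE in_set1 (negbTE iB) orbF wedge0r subr0.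
  case: eqP => [->|]; last by rewrite scaler0 scale0r.
  by rewrite setU1K // scalerA shuffle_sign_sqr.
- rewrite wedgeZr wedge_basis disjoints1 !inE jB andbT negbK.
  rewrite -[X in intprod _ X](scale0r (0 : ext R n)) intprodZ scale0r.
  case: eqP => [<-|/eqP ij]; last by rewrite eq_sym (negbTE ij) scaler0 scale0r subr0.
  rewrite eqxx scale1r scalerA shuffle_sign_sqr scale1r.
  by rewrite setD1K // subrr.
- have ij : i != j by apply: contraNneq jB => <-.
  have dj : [disjoint [set j] & B] by rewrite disjoints1.
  rewrite intprodZ intprod_basis inE iB orbT wedgeZr wedge_basis disjoints1.
  rewrite !inE (negbTE jB) andbF (negbTE ij) scale0r sub0r !scalerA -scaleNr.
  have -> : (j |: B) :\ i = j |: (B :\ i).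
    by rewrite setDUl (_ : [set j] :\ i = [set j])//; apply/setDidPl; rewrite disjoints1 inE eq_sym.
  congr (_ *: _); rewrite -{1}(setD1K iB) !shuffle_signUr ?disjoints1 ?inE ?eqxx //; last first.
    by rewrite negb_and jB orbT.
  rewrite (shuffle_sign_swap ij).
  have := shuffle_sign_sqr [set j] [set i].
  by move=> H; rewrite -[RHS]mulr1 -H; ring.
- by rewrite wedge0r subr0 -[X in intprod _ X](scale0r (0 : ext R n)) intprodZ scale0r
    (_ : i == j = false) ?scale0r//; apply: contraNF iB => /eqP ->.
Qed.

Lemma intprod_wedge u v b :
  intprod u (wedge (covector v) b) =
    (u *m v^T) 0 0 *: b - wedge (covector v) (intprod u b).
Proof.
rewrite (ext_basis b) wedge_sumr !intprod_sum wedge_sumr scaler_sumr -sumrB.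
apply: eq_bigr => B _; rewrite wedgeZr !intprodZ wedgeZr !scalerA mulrC -scalerA -scalerBr.
congr (_ *: _); rewrite intprod_lcomb [intprod u _]intprod_lcomb wedge_sumr.
rewrite mxE scaler_suml -sumrB; apply: eq_bigr => i _; rewrite mxE -scalerA wedgeZr -scalerBr.
congr (_ *: _); rewrite covectorE wedge_suml intprod_sum wedge_suml.
under eq_bigr => j _ do rewrite wedgeZl intprodZ intprod_wedge_basis scalerBr.
rewrite sumrB; congr (_ - _); last by apply: eq_bigr => j _; rewrite wedgeZl.
rewrite (bigD1 i) //= eqxx scale1r big1 ?addr0// => j /negbTE ji.
by rewrite eq_sym ji scale0r scaler0.
Qed.

End Contraction.

End ExteriorAlgebra.

(** * Products of covectors, pullback by a linear map, and degrees *)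

Section RowWedge.
Import mathcomp.boot.finset mathcomp.boot.fintype.
Variable R : realType.

Section Rows.
Variables (m n : nat).
Implicit Types (E : 'M[R]_(m, n)) (s t : seq 'I_m) (T : {set 'I_m}).

Lemma row_wedge_cons E i s :
  row_wedge E (i :: s) = wedge (covector (row i E)) (row_wedge E s).
Proof. by []. Qed.

Lemma row_wedge_cat E s t :
  row_wedge E (s ++ t) = wedge (row_wedge E s) (row_wedge E t).
Proof.
elim: s => [|i s IH]; first by rewrite wedge1l.
by rewrite cat_cons !row_wedge_cons IH wedgeA.
Qed.

Lemma row_wedge_swap E i j s :
  row_wedge E (i :: j :: s) = - row_wedge E (j :: i :: s).
Proof. by rewrite !row_wedge_cons wedge_covectorCA. Qed.

Lemma row_wedge_dup E i s : row_wedge E (i :: i :: s) = 0.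
Proof. by rewrite !row_wedge_cons wedgeA wedge_covector_sqr wedge0l. Qed.

Lemma row_wedge_move E i s t :
  row_wedge E (i :: s ++ t) = (-1) ^+ size s *: row_wedge E (s ++ i :: t).
Proof.
elim: s => [|j s IH]; first by rewrite scale1r.
by rewrite cat_cons row_wedge_swap row_wedge_cons IH wedgeZr -scaleN1r scalerA -exprS.
Qed.

Lemma row_wedge_mem E i s : i \in s -> row_wedge E (i :: s) = 0.
Proof.
move=> /path.splitPr[s1 s2]; rewrite row_wedge_move row_wedge_cat.
by rewrite row_wedge_dup wedge0r scaler0.
Qed.

(** Both lists are strictly increasing and have the same elements. *)
Lemma enum_setU1 i T : i \notin T ->
  enum (i |: T) = [seq j : 'I_m <- enum T | (j < i)%N] ++ i :: [seq j : 'I_m <- enum T | (i < j)%N].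
Proof.
pose ltO : rel 'I_m := relpre val ltn.
move=> iT; have tr : ssrbool.transitive ltO.
  by move=> a b c; exact: ltn_trans.
have srt (U : {set 'I_m}) : sorted ltO (enum U).
  rewrite {1}/enum_mem; apply: (sorted_filter tr).
  rewrite -enumT; have := iota_ltn_sorted 0 m.
  by rewrite -val_enum_ord sorted_map.
apply: (irr_sorted_eq tr) => [a|||a].
- by rewrite /ltO /= ltnn.
- exact: srt.
- have sortedP := sorted_filter tr _ (srt T).
  set s1 := [seq j : 'I_m <- enum T | (j < i)%N].
  set s2 := [seq j : 'I_m <- enum T | (i < j)%N].
  have s1s : sorted ltO s1 by exact: sortedP.
  have s2s : sorted ltO s2 by exact: sortedP.
  rewrite (sorted_pairwise tr) in s1s; rewrite (sorted_pairwise tr) in s2s.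
  rewrite (sorted_pairwise tr).
  rewrite pairwise_cat s1s /= s2s andbT; apply/andP; split.
    apply/allrelP => x y; rewrite mem_filter inE => /andP[xi _].
    rewrite mem_filter => /orP[/eqP ->//|/andP[iy _]].
    exact: ltn_trans xi iy.
  by apply/allP => x; rewrite mem_filter => /andP[].
- transitivity (a \in i |: T); first exact: mem_enum.
  have mem_en : (a \in enum T) = (a \in T) by exact: mem_enum.
  rewrite mem_cat [RHS](_ : _ = (a \in T) && (a < i)%N || ((a == i) || (a \in T) && (i < a)%N)); last first.
    by rewrite inE (mem_filter _ a (enum T)) (mem_filter _ a (enum T)) mem_en /=; case: (a \in T); rewrite ?andbT ?andbF.
  rewrite !inE.
  case: eqP => [->|/eqP ai]; first by rewrite ltnn (negbTE iT).
  rewrite -andb_orr /=; case: ltngtP => [_|_|H]; rewrite ?andbT //.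
  by case/eqP: ai; exact: val_inj.
Qed.

(** The sign counts the elements of T below i, which are the transpositions that carry i from the
    head of the list to its place in the enumeration. *)
Lemma row_wedge_setU1 E i T : i \notin T ->
  row_wedge E (i :: enum T) = shuffle_sign R [set i] T *: row_wedge E (enum (i |: T)).
Proof.
move=> iT; rewrite enum_setU1 //.
have {1}-> : enum T = [seq j : 'I_m <- enum T | (j < i)%N] ++ [seq j : 'I_m <- enum T | (i < j)%N].
  have := enum_setU1 iT => /(congr1 (seq.filter (predC1 i))).
  rewrite filter_cat /= eqxx /=.
  have e1 (s : seq 'I_m) : i \notin s -> [seq x <- s | predC1 i x] = s.
    move=> nis; apply/all_filterP/allP => x xs /=.
    by apply: contraNneq nis => <-.
  rewrite (e1 [seq j : 'I_m <- enum T | (j < i)%N]) ?(mem_filter _ i) ?ltnn//.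
  rewrite (e1 [seq j : 'I_m <- enum T | (i < j)%N]) ?(mem_filter _ i) ?ltnn// => <-.
  rewrite /enum_mem -filter_predI; apply: eq_filter => x /=.
  by rewrite !inE; case: eqP => [->|]//=; rewrite (negbTE iT).
rewrite row_wedge_move shuffle_signE /inversions big_set1; congr (_ ^+ _ *: _).
rewrite size_filter -sum1_count big_mkcond -[RHS]big_enum /=.
by apply: eq_bigr => j _; case: (j < i)%N.
Qed.

End Rows.

Lemma row_wedge_mulmx_eq m m' n (E : 'M[R]_(m, n)) (E' : 'M[R]_(m', n)) s s' :
  [seq row i E | i <- s] = [seq row i E' | i <- s'] ->
  row_wedge E s = row_wedge E' s'.
Proof.
elim: s s' => [|i s IH] [|j s'] //= [e1 e2]; congr (wedge (covector _) _) => //.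
exact: IH.
Qed.

Lemma row_wedge1 n (T : {set 'I_n}) : row_wedge (1%:M : 'M[R]_n) (enum T) = ebasis R T.
Proof.
move: {2}#|T| (erefl #|T|) => k; elim: k T => [|k IH] T cT.
  by rewrite (cards0_eq cT) enum_set0; apply/ffunP => S; rewrite !ffunE.
have [i iT] : exists i, i \in T by apply/card_gt0P; rewrite cT.
have := @row_wedge_setU1 _ _ (1%:M : 'M[R]_n) i (T :\ i).
rewrite setD1K // => /(_ _)/wrap[]; first by rewrite !inE eqxx.
rewrite row_wedge_cons IH; last by rewrite (cardsD1 i T) iT in cT; case: cT.
rewrite row1 covector_delta wedge_basis disjoints1 !inE eqxx /= setD1K // => H.
have := shuffle_sign_neq0 R [set i] (T :\ i) => /scalerI; apply.
by rewrite -H.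
Qed.

Section Pull.
Variables (m n : nat).
Implicit Types (L : 'M[R]_(m, n)) (a b : ext R m).

Lemma pullD L a b : pull L (a + b) = pull L a + pull L b.
Proof. by rewrite /pull -big_split; apply: eq_bigr => T _; rewrite ffunE scalerDl. Qed.

Lemma pullZ L k a : pull L (k *: a) = k *: pull L a.
Proof. by rewrite /pull scaler_sumr; apply: eq_bigr => T _; rewrite ffunE scalerA. Qed.

Lemma pull0 L : pull L 0 = 0.
Proof. by rewrite -(scale0r (0 : ext R m)) pullZ scale0r. Qed.

Lemma pullN L a : pull L (- a) = - pull L a.
Proof. by rewrite -scaleN1r pullZ scaleN1r. Qed.

Lemma pull_sum L (I : Type) (r : seq I) (P : pred I) (F : I -> ext R m) :
  pull L (\sum_(i <- r | P i) F i) = \sum_(i <- r | P i) pull L (F i).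
Proof. by apply: (big_morph (pull L)) => [x y|]; rewrite ?pullD ?pull0. Qed.

Lemma pull_basis L T : pull L (ebasis R T) = row_wedge L (enum T).
Proof.
rewrite /pull (bigD1 T) //= big1 ?addr0 ?ffunE ?eqxx ?scale1r// => S /negbTE ST.
by rewrite ffunE ST scale0r.
Qed.

Lemma pull_covector_wedge L u a :
  pull L (wedge (covector u) a) = wedge (covector (u *m L)) (pull L a).
Proof.
rewrite covectorE wedge_suml pull_sum mulmx_sum_row covector_sum wedge_suml.
apply: eq_bigr => i _; rewrite wedgeZl pullZ covectorZ wedgeZl; congr (_ *: _).
rewrite (ext_basis a) wedge_sumr !pull_sum wedge_sumr; apply: eq_bigr => T _.
rewrite wedgeZr !pullZ wedgeZr; congr (_ *: _); rewrite wedge_basis disjoints1.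
rewrite pull_basis -row_wedge_cons; case: ifPn => [iT|].
  by rewrite pullZ pull_basis row_wedge_setU1.
by rewrite negbK pull0 => iT; rewrite row_wedge_mem ?mem_enum.
Qed.

Lemma pull_ext1 L : pull L (ext1 R m) = ext1 R n.
Proof.
have -> : ext1 R m = ebasis R set0 by apply/ffunP => S; rewrite !ffunE.
by rewrite pull_basis enum_set0.
Qed.

Lemma pull_covector L u : pull L (covector u) = covector (u *m L).
Proof. by rewrite -[covector u]wedge1r pull_covector_wedge pull_ext1 wedge1r. Qed.

Lemma pull_row_wedge L k (F : 'M[R]_(k, m)) s :
  pull L (row_wedge F s) = row_wedge (F *m L) s.
Proof.
elim: s => [|i s IH]; first exact: pull_ext1.
by rewrite !row_wedge_cons pull_covector_wedge IH row_mul.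
Qed.

Lemma pull_wedge L a b : pull L (wedge a b) = wedge (pull L a) (pull L b).
Proof.
rewrite (ext_basis a) wedge_suml !pull_sum wedge_suml; apply: eq_bigr => T _.
rewrite wedgeZl !pullZ wedgeZl; congr (_ *: _); rewrite -row_wedge1.
elim: (enum T) => [|i s IH]; first by rewrite wedge1l pull_ext1 wedge1l.
by rewrite !row_wedge_cons -wedgeA !pull_covector_wedge IH wedgeA.
Qed.

End Pull.

Lemma pull_mulmx m n k (L : 'M[R]_(m, n)) (F : 'M[R]_(k, m)) w :
  pull L (pull F w) = pull (F *m L) w.
Proof.
rewrite [pull F w]/pull pull_sum; apply: eq_bigr => T _.
by rewrite pullZ pull_row_wedge.
Qed.

Lemma pull1 n (w : ext R n) : pull 1%:M w = w.
Proof.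
by rewrite [RHS]ext_basis; apply: eq_bigr => T _; rewrite row_wedge1.
Qed.

(** An identity linear in a form need only be checked on products of covectors, adding one factor at
    a time. *)
Lemma ext_row_wedge_ind n (P : ext R n -> Prop) :
  (forall a b, P a -> P b -> P (a + b)) -> (forall k a, P a -> P (k *: a)) ->
  P 0 -> P (ext1 R n) -> (forall u a, P a -> P (wedge (covector u) a)) ->
  forall a, P a.
Proof.
move=> PD PZ P0 P1 PW a; rewrite (ext_basis a); elim/big_ind: _ => // T _.
apply: PZ; rewrite -row_wedge1; elim: (enum T) => [//|i s IH].
by rewrite row_wedge_cons; exact: PW.
Qed.

Lemma intprod_pull m n (L : 'M[R]_(m, n)) u b :
  intprod u (pull L b) = pull L (intprod (u *m L^T) b).
Proof.
elim/ext_row_wedge_ind: b.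
- by move=> a b Ha Hb; rewrite pullD !intprodD pullD Ha Hb.
- by move=> k a Ha; rewrite pullZ !intprodZ pullZ Ha.
- by rewrite pull0 -(scale0r (0 : ext R n)) -(scale0r (0 : ext R m)) !intprodZ pullZ !scale0r.
- have c1 k (v : 'rV[R]_k) : intprod v (ext1 R k) = 0.
    apply/ffunP => S; rewrite !ffunE covectorE wedge_suml pairing_suml big1 // => i _.
    have -> : ext1 R k = ebasis R set0 by apply/ffunP => S'; rewrite !ffunE.
    rewrite wedgeZl pairingZl wedge_basis; case: ifP => _; last by rewrite pairing0l mulr0.
    rewrite pairingZl pairing_basis2 (_ : _ == _ = false) ?mulr0 //.
    by apply/negbTE/set0Pn; exists i; rewrite !inE eqxx.
  by rewrite pull_ext1 !c1 pull0.
- move=> v a Ha; rewrite pull_covector_wedge !intprod_wedge Ha.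
  rewrite pullD pullN pullZ pull_covector_wedge; congr (_ *: _ - _).
  by rewrite trmx_mul mulmxA.
Qed.

(** Covectors are peeled off [a] and moved across as contractions until degree 0 is left. In
    coefficients: the minors of a transpose are the transposed minors. *)
Lemma pairing_pull m n (L : 'M[R]_(m, n)) a b :
  pairing (pull L a) b = pairing a (pull L^T b).
Proof.
elim/ext_row_wedge_ind: a b.
- by move=> a a' Ha Ha' b; rewrite pullD !pairingDl Ha Ha'.
- by move=> k a Ha b; rewrite pullZ !pairingZl Ha.
- by move=> b; rewrite pull0 !pairing0l.
- move=> b; rewrite pull_ext1.
  have e1 k : ext1 R k = ebasis R set0 by apply/ffunP => S; rewrite !ffunE.
  rewrite !e1 !pairing_basis (ext_basis b) pull_sum !sum_ffunE; apply: eq_bigr => T _.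
  rewrite pullZ pull_basis !ffunE; congr (_ *: _).
  have [->|T0] := eqVneq T set0; first by rewrite enum_set0 ffunE eqxx.
  have [i iT] := set0Pn _ T0.
  have : i \in enum T by rewrite mem_enum.
  case: (enum T) => // j s _; rewrite row_wedge_cons !ffunE.
  rewrite big1 // => S; rewrite subset0 => /eqP ->.
  rewrite ffunE big1 ?mulr0 ?mul0r// => k _.
  rewrite [_ == _](_ : _ = false) ?mul0r//.
  by apply/negbTE; rewrite eq_sym; apply/set0Pn; exists k; rewrite inE.
- move=> u a Ha b; rewrite pull_covector_wedge !pairing_wedge_covector.
  by rewrite Ha intprod_pull trmxK.
Qed.

Section Homogeneous.
Variable n : nat.
Implicit Types a b : ext R n.

Lemma homogeneous0 k : homogeneous k (0 : ext R n).
Proof. by move=> S _; rewrite ffunE. Qed.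

Lemma homogeneousD k a b : homogeneous k a -> homogeneous k b -> homogeneous k (a + b).
Proof. by move=> Ha Hb S Sk; rewrite ffunE Ha// Hb// addr0. Qed.

Lemma homogeneousZ k c a : homogeneous k a -> homogeneous k (c *: a).
Proof. by move=> Ha S Sk; rewrite ffunE Ha// scaler0. Qed.

Lemma homogeneousB k a b : homogeneous k a -> homogeneous k b -> homogeneous k (a - b).
Proof.
move=> Ha Hb; apply: homogeneousD => //; rewrite -scaleN1r; exact: homogeneousZ.
Qed.

Lemma homogeneous_sum k (I : Type) (r : seq I) (P : pred I) (F : I -> ext R n) :
  (forall i, P i -> homogeneous k (F i)) ->
  homogeneous k (\sum_(i <- r | P i) F i).
Proof.
move=> HF; elim/big_ind: _ => //; [exact: homogeneous0 | move=> a b].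
exact: homogeneousD.
Qed.

Lemma homogeneous_covector (u : 'rV[R]_n) : homogeneous 1 (covector u).
Proof.
move=> S S1; rewrite ffunE big1 // => i _; case: eqP => [SE|]; last by rewrite mul0r.
by rewrite SE cards1 in S1.
Qed.

Lemma homogeneous_wedge k l a b :
  homogeneous k a -> homogeneous l b -> homogeneous (k + l) (wedge a b).
Proof.
move=> Ha Hb S Skl; rewrite ffunE big1 // => A AS.
have [cA|/Ha ->] := eqVneq #|A| k; last by rewrite mulr0 mul0r.
rewrite Hb ?mulr0//; apply: contraNneq Skl => cB.
by rewrite -(cardsID A S) (setIidPr AS) cA cB.
Qed.

Lemma homogeneous_ext1 : homogeneous 0 (ext1 R n).
Proof. by move=> S S0; rewrite ffunE; case: eqP => // SE; rewrite SE cards0 in S0. Qed.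

Lemma homogeneous_row_wedge m (E : 'M[R]_(m, n)) s :
  homogeneous (size s) (row_wedge E s).
Proof.
elim: s => [|i s IH]; first exact: homogeneous_ext1.
rewrite row_wedge_cons /= -add1n; apply: homogeneous_wedge => //.
exact: homogeneous_covector.
Qed.

End Homogeneous.

Lemma homogeneous_pull m n k (L : 'M[R]_(m, n)) a :
  homogeneous k a -> homogeneous k (pull L a).
Proof.
move=> Ha; apply: homogeneous_sum => T _.
have [<-|/Ha ->] := eqVneq #|T| k; last by rewrite scale0r; exact: homogeneous0.
by rewrite cardE; exact/homogeneousZ/homogeneous_row_wedge.
Qed.

(** The factor [row_wedge E (enum [set: 'I_n]) setT] is the determinant of E. *)
Lemma pull_top n (E : 'M[R]_n) w :
  pull E w setT = row_wedge E (enum [set: 'I_n]) setT * w setT.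
Proof.
rewrite /pull sum_ffunE (bigD1 setT) //= big1 => [|T TnT].
  by rewrite addr0 ffunE /GRing.scale /= mulrC.
rewrite ffunE homogeneous_row_wedge ?scaler0 // -cardE cardsT card_ord.
have := proper_card (_ : T \proper [set: 'I_n]); rewrite properT cardsT card_ord.
by move=> /(_ TnT) lt_Tn; rewrite neq_ltn lt_Tn orbT.
Qed.

End RowWedge.

(** * The Hodge star in an orthonormal coframe *)

Section HodgeStar.
Import mathcomp.boot.finset mathcomp.boot.fintype.
Variables (R : realType) (n : nat).
Implicit Types (a b c w : ext R n) (E : 'M[R]_n).

(** The Hodge star of the standard metric and orientation of R^n. *)
Definition flat_star b : ext R n :=
  [ffun S : {set 'I_n} => shuffle_sign R (~: S) S * b (~: S)].

Lemma flat_starD a b : flat_star (a + b) = flat_star a + flat_star b.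
Proof. by apply/ffunP => S; rewrite !ffunE mulrDr. Qed.

Lemma flat_starZ k b : flat_star (k *: b) = k *: flat_star b.
Proof. by apply/ffunP => S; rewrite !ffunE /GRing.scale /= mulrCA. Qed.

Lemma flat_star0 : flat_star 0 = 0.
Proof. by rewrite -(scale0r (0 : ext R n)) flat_starZ !scale0r. Qed.

Lemma homogeneous_flat_star k b : homogeneous k b -> homogeneous (n - k) (flat_star b).
Proof.
move=> Hb S Sk; rewrite ffunE Hb ?mulr0//; apply: contraNneq Sk => <-.
by have := cardsC (~: S); rewrite card_ord setCK => E; rewrite -(addKn #|~: S| #|S|) E.
Qed.

Lemma wedge_top a b :
  wedge a b setT = \sum_A shuffle_sign R A (~: A) * a A * b (~: A).
Proof. by rewrite ffunE; apply: eq_big => A; rewrite ?subsetT// setTD. Qed.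

Lemma wedge_flat_star_top a b : wedge a (flat_star b) setT = pairing a b.
Proof.
rewrite wedge_top; apply: eq_bigr => A _; rewrite ffunE setCK.
by rewrite -[RHS]mul1r -(shuffle_sign_sqr R A (~: A)); ring.
Qed.

Lemma wedge_top_inj a b : (forall c, wedge c a setT = wedge c b setT) -> a = b.
Proof.
move=> H; apply/ffunP => S; have := H (ebasis R (~: S)); rewrite !wedge_top.
have E c : \sum_A shuffle_sign R A (~: A) * ebasis R (~: S) A * c (~: A) =
    shuffle_sign R (~: S) S * c S :> R.
  rewrite (bigD1 (~: S)) //= big1 ?addr0 ?setCK ?ffunE ?eqxx ?mulr1// => A.
  by rewrite ffunE => /negbTE ->; rewrite mulr0 mul0r.
by rewrite !E => /(mulfI (shuffle_sign_neq0 _ _ _)).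
Qed.

Lemma enum_setT_ord : enum [set: 'I_n] = enum 'I_n.
Proof. by rewrite enum_setT enumT. Qed.

Lemma volume_pull E : row_wedge E (enum 'I_n) = pull E (ebasis R setT).
Proof. by rewrite pull_basis enum_setT_ord. Qed.

(** Wedged with any c, both sides have top coefficient det E <(E^-1)^* c, b>, and top coefficients
    determine a form. *)
Lemma hodge_pull E b : E \in unitmx ->
  hodge (E^T *m E) (row_wedge E (enum 'I_n)) (pull E b) = pull E (flat_star b).
Proof.
move=> uE; apply: wedge_top_inj => c.
rewrite -{2}(pull1 c) -(mulVmx uE) -pull_mulmx -pull_wedge pull_top.
rewrite wedge_flat_star_top enum_setT_ord.
have -> : hodge (E^T *m E) (row_wedge E (enum 'I_n)) (pull E b) =
    row_wedge E (enum 'I_n) setT *: flat_star (pull (invmx E)^T b).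
  apply/ffunP => S; rewrite !ffunE /GRing.scale /= mulrCA mulrA; congr (_ * _).
  set G := invmx _; transitivity (pairing (row_wedge G (enum (~: S))) (pull E b)); first by [].
  rewrite pairingC pairing_pull pull_row_wedge pairingC.
  (* Here G is the inverse of E^T E, that is E^-1 E^-T. *)
  have -> : G *m E^T = invmx E.
    rewrite -[LHS]mulmx1 -(mulmxV uE) mulmxA -(mulmxA G) mulVmx ?mul1mx //.
    by rewrite unitmx_mul unitmx_tr uE.
  by rewrite -pull_basis pairing_pull pairing_basis.
rewrite wedgeZr ffun_scaleE wedge_flat_star_top -(pairing_pull (invmx E)); congr (_ * _).
Qed.

End HodgeStar.

(** * Forms with integer coefficients in a coframe *)

Arguments row_wedge : simpl never.

(** A pair (c, [:: i; j; ...]) stands for c e^{ij...} with indices counted from 0, in any order and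
    possibly repeated. The same type later encodes polynomials, with lists of variables. *)
Definition lform := seq (int * seq nat).

(** A step of insertion sort that records the parity of the permutation; [None] means a repeated
    index, that is a vanishing product. *)
Fixpoint insert_sign (i : nat) (s : seq nat) : option (bool * seq nat) :=
  if s isn't j :: t then Some (false, [:: i])
  else if (i < j)%N then Some (false, i :: s)
  else if i == j then None
  else omap (fun r => (~~ r.1, j :: r.2)) (insert_sign i t).

Fixpoint sort_sign (s : seq nat) : option (bool * seq nat) :=
  if s isn't i :: t then Some (false, [::])
  else obind (fun r => omap (fun r' => (r.1 (+) r'.1, r'.2)) (insert_sign i r.2))
         (sort_sign t).

Fixpoint add_term (c : int) (s : seq nat) (p : lform) : lform :=
  if p isn't t :: p' then [:: (c, s)]
  else if s == t.2 then (c + t.1, s) :: p' else t :: add_term c s p'.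

Definition lnorm (p : lform) : lform :=
  foldr (fun t q => if sort_sign t.2 is Some r
                    then add_term ((-1) ^+ r.1 * t.1) r.2 q else q) [::] p.

Definition lscale (c : int) (p : lform) : lform := [seq (c * t.1, t.2) | t <- p].

Definition lmul (p q : lform) : lform :=
  [seq (t.1 * u.1, t.2 ++ u.2) | t <- p, u <- q].

Definition lzero (p : lform) : bool := all (fun t => t.1 == 0) (lnorm p).

Definition leqf (p q : lform) : bool := lzero (p ++ lscale (-1) q).

(** The graded Leibniz rule, where [d i] lists the terms of d e^i. *)
Fixpoint ldiff_mono (d : nat -> lform) (s : seq nat) : lform :=
  if s isn't i :: t then [::]
  else lmul (d i) [:: (1, t)] ++ lscale (-1) (lmul [:: (1, [:: i])] (ldiff_mono d t)).

Definition ldiff (d : nat -> lform) (p : lform) : lform :=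
  flatten [seq lscale t.1 (ldiff_mono d t.2) | t <- p].

Definition sumZ (n : nat) (F : nat -> int) : int :=
  foldr (fun e x => F e + x) 0 (iota 0 n).

Definition lvalid (n : nat) (p : lform) : bool :=
  all (fun t => sorted ltn t.2 && all (fun i => i < n)%N t.2) p.

(** Computes the inner product when all index lists are strictly increasing, as [lvalid] demands. *)
Definition lpair (p q : lform) : int :=
  foldr (fun t x => foldr (fun u y => (if t.2 == u.2 then t.1 * u.1 else 0) + y) x q) 0 p.

Definition lstar (n : nat) (p : lform) : lform :=
  [seq let s' := [seq i <- iota 0 n | i \notin t.2] in
       (if sort_sign (t.2 ++ s') is Some r then (-1) ^+ r.1 * t.1 else 0, s') | t <- p].

Definition lcomplemented (n : nat) (p : lform) : bool :=
  all (fun t => if sort_sign (t.2 ++ [seq i <- iota 0 n | i \notin t.2]) is Some r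
                then r.2 == iota 0 n else false) p.

Definition alln (n : nat) (P : pred nat) : bool := all P (iota 0 n).

Lemma allnP n (P : pred nat) (i : 'I_n) : alln n P -> P i.
Proof. by move=> /allP; apply; rewrite mem_iota ltn_ord. Qed.

Section Evaluation.
Import mathcomp.boot.finset mathcomp.boot.fintype.
Variable R : realType.

Definition mono_wedge m n (E : 'M[R]_(m.+1, n)) (s : seq nat) : ext R n :=
  row_wedge E [seq inord i | i <- s].

Definition leval m n (E : 'M[R]_(m.+1, n)) (p : lform) : ext R n :=
  \sum_(t <- p) t.1%:~R *: mono_wedge E t.2.

Lemma sumZE n (F : nat -> int) : \sum_(e < n) (F e)%:~R = (sumZ n F)%:~R :> R.
Proof.
rewrite -(big_mkord xpredT (fun e => (F e)%:~R)) /index_iota subn0 /sumZ.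
elim: (iota 0 n) => [|e s IH]; first by rewrite big_nil.
by rewrite big_cons IH intrD.
Qed.

Section Rows.
Variables (m n : nat) (E : 'M[R]_(m.+1, n)).
Implicit Types (p q : lform) (s : seq nat).

Lemma leval_nil : leval E [::] = 0.
Proof. exact: big_nil. Qed.

Lemma leval_cons c s p :
  leval E ((c, s) :: p) = c%:~R *: mono_wedge E s + leval E p.
Proof. exact: big_cons. Qed.

Lemma leval_cat p q : leval E (p ++ q) = leval E p + leval E q.
Proof. exact: big_cat. Qed.

Lemma leval1 c s : leval E [:: (c, s)] = c%:~R *: mono_wedge E s.
Proof. by rewrite leval_cons leval_nil addr0. Qed.

Lemma leval_scale c p : leval E (lscale c p) = c%:~R *: leval E p.
Proof.
rewrite /leval big_map scaler_sumr; apply: eq_bigr => t _ /=.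
by rewrite scalerA intrM.
Qed.

Lemma mono_wedge_cat s t :
  mono_wedge E (s ++ t) = wedge (mono_wedge E s) (mono_wedge E t).
Proof. by rewrite /mono_wedge map_cat row_wedge_cat. Qed.

Lemma leval_mul p q : leval E (lmul p q) = wedge (leval E p) (leval E q).
Proof.
rewrite /leval big_allpairs_dep wedge_suml; apply: eq_bigr => t _.
rewrite wedge_sumr; apply: eq_bigr => u _ /=.
by rewrite wedgeZl wedgeZr scalerA intrM mono_wedge_cat.
Qed.

Lemma insert_signP i s : mono_wedge E (i :: s) =
  if insert_sign i s is Some r then (-1) ^+ r.1 *: mono_wedge E r.2 else 0.
Proof.
elim: s => [|j s IH] /=; first by rewrite scale1r.
case: ifP => _; first by rewrite scale1r.
case: eqP => [->|_]; first exact: row_wedge_dup.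
rewrite /mono_wedge /= row_wedge_swap; move: IH; rewrite /mono_wedge /= => IH.
rewrite [X in - X]row_wedge_cons IH.
case: (insert_sign i s) => [[b t]|] /=; last by rewrite wedge0r oppr0.
by rewrite wedgeZr -scaleNr -signrN.
Qed.

Lemma sort_signP s : mono_wedge E s =
  if sort_sign s is Some r then (-1) ^+ r.1 *: mono_wedge E r.2 else 0.
Proof.
elim: s => [|i s IH] /=; first by rewrite scale1r.
have -> : mono_wedge E (i :: s) = wedge (covector (row (inord i) E)) (mono_wedge E s) by [].
rewrite IH; case: (sort_sign s) => [[b t]|] /=; last exact: wedge0r.
rewrite wedgeZr; have := insert_signP i t; rewrite /mono_wedge /= row_wedge_cons => ->.
case: (insert_sign i t) => [[b' t']|] /=; last by rewrite scaler0.
by rewrite scalerA -signr_addb.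
Qed.

Lemma leval_add_term c s p :
  leval E (add_term c s p) = c%:~R *: mono_wedge E s + leval E p.
Proof.
elim: p => [|[c' s'] p IH] /=; first exact: leval_cons.
case: eqP => [->|_]; rewrite !leval_cons ?intrD ?scalerDl ?addrA //.
by rewrite IH addrCA addrA.
Qed.

Lemma leval_norm p : leval E (lnorm p) = leval E p.
Proof.
elim: p => [//|[c s] p IH] /=; rewrite [RHS]leval_cons sort_signP.
case: (sort_sign s) => [[b t]|] /=; last by rewrite scaler0 add0r.
by rewrite leval_add_term IH intrM rmorphXn /= rmorphN1 scalerA mulrC.
Qed.

Lemma leval_zero p : lzero p -> leval E p = 0.
Proof.
rewrite -leval_norm /lzero; elim: (lnorm p) => [_|[c s] q IH]; first exact: leval_nil.
by rewrite leval_cons => /= /andP[/eqP -> /IH ->]; rewrite scale0r addr0.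
Qed.

Lemma leval_eq p q : leqf p q -> leval E p = leval E q.
Proof.
move=> /leval_zero; rewrite leval_cat leval_scale scaleN1r => /eqP.
by rewrite subr_eq0 => /eqP.
Qed.

Lemma pull_leval k (L : 'M[R]_(n, k)) p : pull L (leval E p) = leval (E *m L) p.
Proof.
rewrite /leval pull_sum; apply: eq_bigr => t _.
by rewrite pullZ /mono_wedge pull_row_wedge.
Qed.

Lemma homogeneous_leval k p : all (fun t => size t.2 == k) p -> homogeneous k (leval E p).
Proof.
move=> /allP Hp; rewrite /leval big_seq; apply: homogeneous_sum => t /Hp /eqP <-.
apply: homogeneousZ; rewrite -(size_map (@inord m)); exact: homogeneous_row_wedge.
Qed.

End Rows.

Lemma leval_pull m n (E : 'M[R]_(m.+1, n)) p : leval E p = pull E (leval 1%:M p).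
Proof. by rewrite pull_leval mul1mx. Qed.

Section Standard.
Variable n : nat.
Local Notation ev := (leval (1%:M : 'M[R]_n.+1)).
Implicit Types (p q : lform) (s : seq nat).

Definition support_set s : {set 'I_n.+1} := [set i : 'I_n.+1 | val i \in s].

Lemma enum_support_set s : sorted ltn s -> all (fun i => i < n.+1)%N s ->
  enum (support_set s) = [seq inord i | i <- s].
Proof.
pose ltO : rel 'I_n.+1 := relpre val ltn.
move=> ss sn; have tr : ssrbool.transitive ltO.
  by move=> a b c; exact: ltn_trans.
have vs : [seq val i | i <- [seq inord i : 'I_n.+1 | i <- s]] = s.
  rewrite -map_comp map_id_in // => i /(allP sn) /= ?; exact: inordK.
apply: (irr_sorted_eq tr) => [a|||a].
- by rewrite /ltO /= ltnn.
- rewrite {1}/enum_mem; apply: (sorted_filter tr).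
  rewrite -enumT; have := iota_ltn_sorted 0 n.+1.
  by rewrite -val_enum_ord sorted_map.
- by have := ss; rewrite -{1}vs sorted_map.
- transitivity (a \in support_set s); first exact: mem_enum.
  rewrite inE; apply/idP/mapP => [as_|[i si ->]]; last by rewrite /= inordK// (allP sn _ si).
  by exists (val a) => //; apply: val_inj; rewrite /= inordK.
Qed.

Lemma mono_wedge1 s : sorted ltn s -> all (fun i => i < n.+1)%N s ->
  mono_wedge (1%:M : 'M[R]_n.+1) s = ebasis R (support_set s).
Proof. by move=> ss sn; rewrite -row_wedge1 enum_support_set. Qed.

Lemma support_set_inj s t : sorted ltn s -> all (fun i => i < n.+1)%N s ->
  sorted ltn t -> all (fun i => i < n.+1)%N t ->
  (support_set s == support_set t) = (s == t).
Proof.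
move=> ss sn st tn; apply/eqP/eqP => [E|->//].
have vs u : all (fun i => i < n.+1)%N u ->
    [seq val i | i <- [seq inord i : 'I_n.+1 | i <- u]] = u.
  by move=> un; rewrite -map_comp map_id_in // => i /(allP un) /= ?; exact: inordK.
by rewrite -(vs s)// -(vs t)// -!enum_support_set// E.
Qed.

Lemma pairing_leval p q : lvalid n.+1 p -> lvalid n.+1 q ->
  pairing (ev p) (ev q) = (lpair p q)%:~R.
Proof.
move=> vp vq; elim: p vp => [|[c s] p IH] /=; first by rewrite leval_nil pairing0l.
move=> /andP[/andP[ss sn] vp]; rewrite leval_cons pairingDl IH //.
have foldr_add (F : int * seq nat -> int) x :
  foldr (fun u y => F u + y) x q = foldr (fun u y => F u + y) 0 q + x.
  by elim: (q) => /= [|u r ->]; rewrite ?add0r// addrA.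
rewrite -/(lpair p q) [in RHS]foldr_add intrD; congr (_ + _).
elim: q vq {IH foldr_add} => [|[d t] q IHq] /=; first by rewrite leval_nil pairing0r.
move=> /andP[/andP[st tn] vq]; rewrite leval_cons pairingDr IHq // intrD.
congr (_ + _); rewrite pairingZl pairingZr !mono_wedge1 // pairing_basis2.
rewrite support_set_inj //; case: eqP => _; first by rewrite mulr1 intrM.
by rewrite !mulr0.
Qed.

(** Sorting s followed by its complement s' yields the shuffle sign, as both express e^s /\ e^s' as
    a multiple of the volume form; [lcomplemented] certifies that the sorted list is the full
    one. *)
Lemma flat_star_leval p : lvalid n.+1 p -> lcomplemented n.+1 p ->
  flat_star (ev p) = ev (lstar n.+1 p).
Proof.
elim: p => [_|[c s] p IH]; first by rewrite leval_nil flat_star0.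
move=> /= /andP[/andP[ss sn] vp] /andP[]; set s' := [seq i <- iota 0 n.+1 | i \notin s].
move=> cps cpp; rewrite !leval_cons flat_starD IH //; congr (_ + _).
have ss' : sorted ltn s' by apply: sorted_filter (iota_ltn_sorted 0 n.+1); exact: ltn_trans.
have sn' : all (fun i => i < n.+1)%N s'.
  by apply/allP => i; rewrite mem_filter mem_iota => /andP[_].
have cs : support_set s' = ~: support_set s.
  by apply/setP => i; rewrite !inE mem_filter mem_iota ltn_ord /= andbT.
rewrite flat_starZ mono_wedge1 // mono_wedge1 // cs.
have sE : flat_star (ebasis R (support_set s)) =
    shuffle_sign R (support_set s) (~: support_set s) *: ebasis R (~: support_set s).
  apply/ffunP => S; rewrite !ffunE /GRing.scale /=.
  rewrite (_ : (~: S == support_set s) = (S == ~: support_set s)); last first.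
    by apply/eqP/eqP => [<-|->]; rewrite setCK.
  by case: eqP => [->|_]; rewrite ?mulr0 // setCK.
have wE : wedge (ebasis R (support_set s)) (ebasis R (~: support_set s)) =
    shuffle_sign R (support_set s) (~: support_set s) *: ebasis R setT.
  by rewrite wedge_basis setUCr -setI_eq0 setICr eqxx.
have := sort_signP (1%:M : 'M[R]_n.+1) (s ++ s').
have iota_lt : all (fun i => i < n.+1)%N (iota 0 n.+1).
  by apply/allP => i; rewrite mem_iota.
move: cps; case: (sort_sign _) => [[b t]|] // cps.
have -> : t = iota 0 n.+1 by exact/eqP/cps.
rewrite mono_wedge_cat !mono_wedge1 ?iota_ltn_sorted //.
have -> : support_set (iota 0 n.+1) = setT.
  by apply/setP => i; rewrite in_set mem_iota ltn_ord in_setT.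
rewrite cs wE => /ffunP/(_ setT) sgE.
rewrite !ffunE eqxx /GRing.scale /= !mulr1 in sgE.
by rewrite sE sgE scalerA intrM rmorphXn /= rmorphN1 mulrC.
Qed.

End Standard.
End Evaluation.

(** * The stabiliser of the Spin(7)-form *)

Definition g2_terms : lform :=
  [:: (1, [:: 0; 1; 6]%N); (1, [:: 2; 3; 6]%N); (1, [:: 4; 5; 6]%N);
      (1, [:: 0; 2; 4]%N); (-1, [:: 0; 3; 5]%N); (-1, [:: 1; 2; 5]%N);
      (-1, [:: 1; 3; 4]%N)].

Definition g2_dual_terms : lform :=
  [:: (1, [:: 0; 1; 2; 3]%N); (1, [:: 0; 1; 4; 5]%N); (1, [:: 2; 3; 4; 5]%N);
      (1, [:: 0; 2; 5; 6]%N); (1, [:: 0; 3; 4; 6]%N); (1, [:: 1; 2; 4; 6]%N);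
      (-1, [:: 1; 3; 5; 6]%N)].

Definition spin7_terms : lform :=
  [seq (t.1, rcons t.2 7%N) | t <- g2_terms] ++ g2_dual_terms.

(** The tensor component Phi_abcd for arbitrary indices; sorting supplies the antisymmetry. *)
Definition phiZ (a b c d : nat) : int :=
  lpair (lnorm [:: (1, [:: a; b; c; d])]) spin7_terms.

Definition deltaZ (a b c d : nat) : int :=
  ((a == c) && (b == d))%:R - ((a == d) && (b == c))%:R.

(* With Q = (Phi_abcd) regarded as a symmetric form on pairs of indices and J
   the projection (up to a factor 2) onto bivectors, this is QQ = 4Q + 6J. *)
Lemma spin7_square : alln 8 (fun a => alln 8 (fun b => alln 8 (fun c => alln 8 (fun d =>
  sumZ 8 (fun e => sumZ 8 (fun f => phiZ a b e f * phiZ e f c d))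
    == 4 * phiZ a b c d + 6 * deltaZ a b c d)))).
Proof. vm_cast_no_check (erefl true). Qed.

Lemma spin7_index_valid : alln 8 (fun a => alln 8 (fun b => alln 8 (fun c => alln 8 (fun d =>
  lvalid 8 (lnorm [:: (1, [:: a; b; c; d])]))))).
Proof. vm_cast_no_check (erefl true). Qed.

Section Models.
Import mathcomp.boot.finset mathcomp.boot.fintype.
Variable R : realType.

Lemma monomialE n (E : 'M[R]_n.+1) s : monomial E s = mono_wedge E (map predn s).
Proof. by rewrite /monomial /mono_wedge -map_comp. Qed.

Lemma g2_model_leval (E : 'M[R]_7) : g2_model E = leval E g2_terms.
Proof.
rewrite /g2_model !monomialE /leval; move: (mono_wedge E) => e.
by rewrite !big_cons big_nil /= !scale1r !scaleN1r addr0 !addrA.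
Qed.

Lemma spin7_model_leval (E : 'M[R]_8) : spin7_model E = leval E spin7_terms.
Proof.
rewrite /spin7_model !monomialE /leval; move: (mono_wedge E) => e.
by rewrite big_cat big_map !big_cons !big_nil /= !scale1r !scaleN1r !addr0 !addrA.
Qed.

Lemma flat_star_g2 : flat_star (leval (1%:M : 'M[R]_7) g2_terms) = leval 1%:M g2_dual_terms.
Proof. by rewrite flat_star_leval //; apply: leval_eq; vm_compute. Qed.

Lemma flat_star_spin7 : flat_star (leval (1%:M : 'M[R]_8) spin7_terms) = leval 1%:M spin7_terms.
Proof. by rewrite flat_star_leval //; apply: leval_eq; vm_compute. Qed.

Local Notation Phi := (leval (1%:M : 'M[R]_8) spin7_terms).

Lemma homogeneous_spin7 : homogeneous 4 Phi.
Proof. exact: homogeneous_leval. Qed.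

Lemma pairing_spin7 : pairing Phi Phi = 14%:R.
Proof.
by rewrite pairing_leval // -[14%:R]/(14%:Z%:~R); congr (_%:~R); vm_compute.
Qed.

(* Phi is self-dual, so Phi /\ Phi = 14 vol determines det L and then the
   invariance of Phi under L, tested against wedge products with 4-forms, turns
   into invariance under the transpose. *)
Lemma spin7_stabiliser_tr (L : 'M[R]_8) : pull L Phi = Phi ->
  row_wedge L (enum 'I_8) setT = 1 /\ pull L^T Phi = Phi.
Proof.
move=> LPhi; set dL := row_wedge L _ _.
have key a : pairing (pull L a) Phi = dL * pairing a Phi.
  rewrite -!wedge_flat_star_top flat_star_spin7 -{1}LPhi -pull_wedge pull_top.
  by rewrite enum_setT_ord.
have dL1 : dL = 1.
  have := key Phi; rewrite LPhi pairing_spin7 => /eqP.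
  by rewrite -subr_eq0 -{1}[14%:R]mul1r -mulrBl mulf_eq0 pnatr_eq0 orbF subr_eq0 => /eqP ->.
split=> //; apply/ffunP => S.
by rewrite -[LHS]pairing_basis -pairing_pull key dL1 mul1r pairing_basis.
Qed.

Notation pairs := ('I_8 * 'I_8)%type.

(** The components w_abcd as a matrix in the pairs (a, b) and (c, d). As an endomorphism of R^8 (x)
    R^8, the form Phi can be multiplied by itself. *)
Definition tensor4 (w : ext R 8) (p q : pairs) : R :=
  pairing (row_wedge 1%:M [:: p.1; p.2; q.1; q.2]) w.

Definition pairs_mx (F : pairs -> pairs -> R) : 'M[R]_#|{: pairs}| :=
  \matrix_(i, j) F (enum_val i) (enum_val j).

Lemma pairs_mxM (F G : pairs -> pairs -> R) :
  pairs_mx F *m pairs_mx G = pairs_mx (fun p q => \sum_r F p r * G r q).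
Proof.
apply/matrixP => i j; rewrite !mxE; under eq_bigr do rewrite !mxE.
rewrite [RHS](reindex (fun k : 'I_#|{: pairs}| => enum_val k)) //=.
exact/onW_bij/enum_val_bij.
Qed.

Lemma pairs_mx_inj F G : pairs_mx F = pairs_mx G -> F =2 G.
Proof.
by move=> /matrixP FG p q; have := FG (enum_rank p) (enum_rank q); rewrite !mxE !enum_rankK.
Qed.

Lemma tr_pairs_mx F : (pairs_mx F)^T = pairs_mx (fun p q => F q p).
Proof. by apply/matrixP => i j; rewrite !mxE. Qed.

Lemma eq_pairs_mx F G : F =2 G -> pairs_mx F = pairs_mx G.
Proof. by move=> FG; apply/matrixP => i j; rewrite !mxE FG. Qed.

(** The matrix of L (x) L. *)
Definition tensor_square (L : 'M[R]_8) (p q : pairs) : R := L p.1 q.1 * L p.2 q.2.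

Lemma row_wedge_lcomb (L : 'M[R]_8) i s : row_wedge L (i :: s) =
  \sum_j L i j *: wedge (covector (row j 1%:M)) (row_wedge L s).
Proof.
rewrite row_wedge_cons {1}(row_sum_delta (row i L)) covector_sum wedge_suml.
by apply: eq_bigr => j _; rewrite covectorZ wedgeZl mxE row1.
Qed.

(** A 4-tensor transforms with one factor L for each index; grouping the indices in pairs turns this
    into a congruence by L (x) L. *)
Lemma tensor4_pull (L : 'M[R]_8) w :
  pairs_mx (tensor4 (pull L w)) =
  (pairs_mx (tensor_square L))^T *m pairs_mx (tensor4 w) *m pairs_mx (tensor_square L).
Proof.
rewrite tr_pairs_mx !pairs_mxM; apply: eq_pairs_mx => p q.
rewrite /tensor4 -{1}[L]trmxK -pairing_pull pull_row_wedge mul1mx.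
have rw2 (i j : 'I_8) s : row_wedge L^T [:: i, j & s] =
    \sum_(r : pairs) tensor_square L r (i, j) *:
      wedge (row_wedge 1%:M [:: r.1; r.2]) (row_wedge L^T s).
  rewrite row_wedge_lcomb; under eq_bigr do rewrite row_wedge_lcomb.
  under eq_bigr do rewrite wedge_sumr scaler_sumr.
  rewrite pair_big; apply: eq_bigr => -[a b] _ /=.
  by rewrite !row_wedge_cons wedge1r wedgeZr scalerA !mxE -wedgeA.
rewrite rw2 pairing_suml (eq_bigr (fun r : pairs => \sum_(r' : pairs)
    tensor_square L r p * tensor_square L r' q *
      pairing (row_wedge 1%:M [:: r.1; r.2; r'.1; r'.2]) w)); last first.
  move=> r _; rewrite rw2 wedge_sumr pairingZl pairing_suml mulr_sumr.
  apply: eq_bigr => r' _; rewrite wedgeZr pairingZl mulrA; congr (_ * pairing _ _).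
  by rewrite -[row_wedge L^T [::]]/(ext1 R 8) wedge1r -row_wedge_cat.
rewrite exchange_big; apply: eq_bigr => r' _; rewrite mulr_suml.
by apply: eq_bigr => r _; ring.
Qed.

Lemma tensor4_spin7 (p q : pairs) : tensor4 Phi p q = (phiZ p.1 p.2 q.1 q.2)%:~R.
Proof.
case: p q => a b [c d]; rewrite /tensor4 /phiZ -(@pairing_leval R 7) //; last first.
  by have := allnP d (allnP c (allnP b (allnP a spin7_index_valid))).
congr (pairing _ _); rewrite leval_norm leval1 scale1r /mono_wedge /=.
by rewrite !inord_val.
Qed.

Lemma tensor4_square : pairs_mx (tensor4 Phi) *m pairs_mx (tensor4 Phi) =
  4%:R *: pairs_mx (tensor4 Phi) +
  6%:R *: pairs_mx (fun p q => (p == q)%:R - (p == (q.2, q.1))%:R).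
Proof.
rewrite pairs_mxM; apply/matrixP => i j; rewrite !mxE.
move: (enum_val i) (enum_val j) => [a b] [c d].
under eq_bigr do rewrite !tensor4_spin7 /= -intrM.
rewrite -(pair_big xpredT xpredT (fun e f : 'I_8 => (phiZ a b e f * phiZ e f c d)%:~R)) /=.
under eq_bigr do rewrite (sumZE R 8 (fun f => phiZ a b _ f * phiZ _ f c d)).
rewrite (sumZE R 8 (fun e => sumZ 8 (fun f => phiZ a b e f * phiZ e f c d))).
have /eqP -> := allnP d (allnP c (allnP b (allnP a spin7_square))).
rewrite tensor4_spin7 intrD !intrM /=; congr (_ + _ * _).
rewrite /deltaZ intrB !xpair_eqE -!val_eqE.
by case: (val a == val c); case: (val b == val d); case: (val a == val d); case: (val b == val c).
Qed.

Notation K L := (pairs_mx (tensor_square L)).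
Notation J := (pairs_mx (fun p q => (p == q)%:R - (p == (q.2, q.1))%:R)).

Lemma tensor_square_mul (L M : 'M[R]_8) : K L *m K M = K (L *m M).
Proof.
rewrite pairs_mxM; apply: eq_pairs_mx => p q; rewrite /tensor_square !mxE.
rewrite mulr_suml -(pair_big xpredT xpredT (fun e f : 'I_8 =>
  L p.1 e * L p.2 f * (M e q.1 * M f q.2))) /=.
apply: eq_bigr => e _; rewrite mulr_sumr; apply: eq_bigr => f _; ring.
Qed.

Lemma tensor_square_alt (L : 'M[R]_8) : K L *m J =
  pairs_mx (fun p q => tensor_square L p q - tensor_square L p (q.2, q.1)).
Proof.
rewrite pairs_mxM; apply: eq_pairs_mx => p q.
under eq_bigr do rewrite mulrBr.
rewrite sumrB; congr (_ - _).
  by rewrite (bigD1 q) //= eqxx mulr1 big1 ?addr0// => r /negbTE ->; rewrite mulr0.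
by rewrite (bigD1 (q.2, q.1)) //= eqxx mulr1 big1 ?addr0// => r /negbTE ->; rewrite mulr0.
Qed.

Lemma alt_tensor_square (L : 'M[R]_8) : J *m K L =
  pairs_mx (fun p q => tensor_square L p q - tensor_square L p (q.2, q.1)).
Proof.
rewrite pairs_mxM; apply: eq_pairs_mx => p q.
under eq_bigr do rewrite mulrBl.
rewrite sumrB; congr (_ - _).
  rewrite (bigD1 p) //= eqxx mul1r big1 ?addr0// => r.
  by rewrite eq_sym => /negbTE ->; rewrite mul0r.
rewrite (bigD1 (p.2, p.1)) //= -surjective_pairing eqxx mul1r big1 ?addr0.
  by rewrite /tensor_square /= mulrC.
move=> r /eqP rp; rewrite (_ : (p == _) = false) ?mul0r//.
by apply/eqP => pr; apply: rp; rewrite pr -surjective_pairing.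
Qed.

Lemma exists_ord8 (a b : 'I_8) : exists c, (c != a) && (c != b).
Proof.
have : (0 < #|~: [set a; b]|)%N.
  have := cardsC [set a; b]; rewrite card_ord cards2 => E.
  by rewrite lt0n; apply: contra_eqN E => /eqP ->; case: (a != b).
by case/card_gt0P => c; rewrite !inE negb_or => ?; exists c.
Qed.

(* Phi determines a symmetric matrix A = L^T L only through its 2x2 minors, so
   A = 1 or A = -1; the sign is fixed by positivity. *)
Lemma minors_eq1 (A : 'M[R]_8) : A^T = A -> (forall a, 0 <= A a a) ->
  (forall a b c d, A a c * A b d - A a d * A b c =
     ((a == c) && (b == d))%:R - ((a == d) && (b == c))%:R) -> A = 1%:M.
Proof.
move=> symA posA minA; have sA a b : A a b = A b a by rewrite -{1}symA mxE.
have off a b : a != b -> A a b = 0.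
  move=> ab; have [c /andP[ca cb]] := exists_ord8 a b.
  have m1 := minA b c b c; have m2 := minA a b b c; have m3 := minA a c b c.
  rewrite !eqxx (eq_sym b c) (negbTE cb) /= in m1.
  rewrite (negbTE ab) (eq_sym a c) (negbTE ca) /= in m2.
  rewrite (negbTE ab) (eq_sym a c) (negbTE ca) /= in m3.
  have := sA c b; move: m1 m2 m3; move: (A a b) (A b b) (A c c) (A a c) (A b c) (A c b).
  move=> p y z q r r' m1 m2 m3 rr; subst r'.
  have -> : p = p * (y * z - r * r) by rewrite m1; ring.
  have e2 : p * r = q * y by move/eqP: m2; rewrite subr0 subr_eq0 => /eqP.
  have e3 : p * z = q * r by move/eqP: m3; rewrite subr0 subr_eq0 => /eqP.
  have -> : p * (y * z - r * r) = y * (p * z) - r * (p * r) by ring.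
  by rewrite e2 e3; ring.
apply/matrixP => a b; rewrite mxE; have [<-|ab] := eqVneq a b; last exact: off.
have [b' /andP[b'a _]] := exists_ord8 a a; have [c /andP[ca cb]] := exists_ord8 a b'.
have m1 := minA a b' a b'; have m2 := minA a c a c; have m3 := minA b' c b' c.
have [ab' ac b'c] : [/\ a != b', a != c & b' != c] by rewrite eq_sym b'a eq_sym ca eq_sym cb.
rewrite !eqxx (negbTE ab') (off _ _ ab') mul0r !subr0 /= in m1.
rewrite !eqxx (negbTE ac) (off _ _ ac) mul0r !subr0 /= in m2.
rewrite !eqxx (negbTE b'c) (off _ _ b'c) mul0r !subr0 /= in m3.
have {}m3 : A b' b' * A c c = 1 by exact: m3.
apply/eqP; rewrite -(@eqrXn2 _ 2) ?ler01 // expr1n; apply/eqP.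
transitivity ((A a a * A b' b') * (A a a * A c c) / (A b' b' * A c c)).
  rewrite m3 divr1 -[LHS]mulr1 -m3; ring.
by rewrite m1 m2 m3 divr1 mulr1.
Qed.

(** With k = L (x) L, invariance under L and under its transpose reads Q = k^T Q k = k Q k^T, so k
    commutes with Q^2. It commutes with J as well, hence with Q by Q^2 = 4 Q + 6 J. Then Q = k^T k
    Q, so Q^2 = k^T k Q^2, and the same relation gives J = k^T k J: the matrix L^T L has the 2x2
    minors of the identity. *)
Lemma spin7_stabiliser_orthogonal (L : 'M[R]_8) : pull L Phi = Phi -> L^T *m L = 1%:M.
Proof.
move=> LPhi; have [_ LtPhi] := spin7_stabiliser_tr LPhi.
have trK (M : 'M[R]_8) : (K M)^T = K M^T.
  by rewrite tr_pairs_mx; apply: eq_pairs_mx => p q; rewrite /tensor_square !mxE.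
have H1 := tensor4_pull L Phi; have H2 := tensor4_pull L^T Phi.
rewrite LPhi in H1; rewrite LtPhi in H2; rewrite -!trK trmxK in H1 H2.
have QQ := tensor4_square; move: H1 H2 QQ.
set Q := pairs_mx (tensor4 _); set k := K L => H1 H2 QQ.
have QQk : Q *m Q *m k = k *m (Q *m Q).
  by rewrite {1}H2 -!mulmxA (mulmxA k^T) -H1.
have Jk : J *m k = k *m J by rewrite tensor_square_alt alt_tensor_square.
have Qk : Q *m k = k *m Q.
  move: QQk; rewrite QQ mulmxDl mulmxDr -!scalemxAl -!scalemxAr Jk => /addIr.
  by apply: scalerI; rewrite pnatr_eq0.
have QE : Q = k^T *m k *m Q by rewrite {1}H1 -mulmxA Qk mulmxA.
have JE : J = k^T *m k *m J.
  have : Q *m Q = k^T *m k *m (Q *m Q) by rewrite mulmxA -QE.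
  rewrite QQ mulmxDr -!scalemxAr -QE => /addrI.
  by apply: scalerI; rewrite pnatr_eq0.
rewrite trK tensor_square_mul tensor_square_alt in JE.
apply: minors_eq1 => [|a|a b c d].
- by rewrite trmx_mul trmxK.
- by rewrite mxE; apply: sumr_ge0 => i _; rewrite mxE -expr2 sqr_ge0.
- by have := pairs_mx_inj JE (a, b) (c, d); rewrite /tensor_square /= !xpair_eqE => <-.
Qed.

Lemma pull_volume n (L : 'M[R]_n) :
  pull L (ebasis R setT) = row_wedge L (enum 'I_n) setT *: ebasis R setT.
Proof.
apply/ffunP => S; rewrite ffunE; have [->|ST] := eqVneq S setT.
  by rewrite pull_top enum_setT_ord !ffunE eqxx.
rewrite !ffunE (negbTE ST) scaler0 pull_basis homogeneous_row_wedge //.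
have := proper_card (_ : S \proper [set: 'I_n]); rewrite properT cardsT card_ord.
by move=> /(_ ST) lt_Sn; rewrite -cardE cardsT card_ord neq_ltn lt_Sn.
Qed.

(** The matrix E F^-1 stabilises Phi, hence is orthogonal of determinant 1. So the 4-form alone
    determines the metric and the volume form. *)
Lemma spin7_frame_unique (E F : 'M[R]_8) : F \in unitmx ->
  spin7_model E = spin7_model F ->
  E^T *m E = F^T *m F /\ row_wedge E (enum 'I_8) = row_wedge F (enum 'I_8).
Proof.
rewrite !spin7_model_leval leval_pull [in X in _ = X]leval_pull => uF EF.
set L := E *m invmx F; have LF : L *m F = E by rewrite mulmxKV.
have LPhi : pull L Phi = Phi.
  by rewrite -pull_mulmx EF pull_mulmx mulmxV // pull1.
have LL := spin7_stabiliser_orthogonal LPhi; have [dL _] := spin7_stabiliser_tr LPhi.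
split; first by rewrite -LF trmx_mul mulmxA -(mulmxA F^T) LL mulmx1.
by rewrite -LF !volume_pull -pull_mulmx pull_volume dL scale1r.
Qed.

End Models.

(** * The linear algebra of warped Spin(7)-structures *)

Section WarpedFrame.
Import mathcomp.boot.finset mathcomp.boot.fintype.
Variable R : realType.

Lemma sum_lift_max (V : nmodType) n (F : 'I_n.+1 -> V) :
  \sum_i F i = \sum_(a < n) F (lift ord_max a) + F ord_max.
Proof.
rewrite big_ord_recr /=; congr (_ + _); apply: eq_bigr => a _; congr (F _).
by apply: val_inj; rewrite /= /bump leqNgt ltn_ord.
Qed.

Lemma lift_max_inord n (i : nat) : (i < n.+1)%N ->
  lift ord_max (inord i : 'I_n.+1) = inord i :> 'I_n.+2.
Proof.
move=> lt_in; apply: val_inj; rewrite /= /bump !inordK //; last exact: ltnW.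
by rewrite leqNgt lt_in.
Qed.

Section AnyDim.
Variable n : nat.
Implicit Types (E F : 'M[R]_n) (k : R).
Local Notation B := (base_mx R n).

(** The block matrix diag(k E, 1), with rows k e^1, ..., k e^n, dt. With k = f^2 and a metric in
    place of E it is the matrix of the warped metric. *)
Definition warp_frame k E : 'M[R]_n.+1 :=
  \matrix_(i, j) match unlift ord_max i, unlift ord_max j with
                 | Some a, Some b => k * E a b
                 | None, None => 1
                 | _, _ => 0
                 end.

Lemma warp_frame_mul k E l F : warp_frame k E *m warp_frame l F = warp_frame (k * l) (E *m F).
Proof.
apply/matrixP => i j; rewrite !mxE sum_lift_max !mxE unlift_none.
under eq_bigr do rewrite !mxE liftK.
case: (unliftP ord_max i) => [a|] _; case: (unliftP ord_max j) => [b|] _.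
- rewrite mulr0 addr0 mxE mulr_sumr; apply: eq_bigr => c _; ring.
- by rewrite big1 ?mul0r ?addr0// => c _; rewrite mulr0.
- by rewrite big1 ?mulr0 ?addr0// => c _; rewrite mul0r.
- by rewrite big1 ?mulr1 ?add0r// => c _; rewrite mul0r.
Qed.

Lemma warp_frame1 : warp_frame 1 1%:M = 1%:M.
Proof.
apply/matrixP => i j; rewrite !mxE.
case: (unliftP ord_max i) => [a|] ->; case: (unliftP ord_max j) => [b|] ->.
- by rewrite mxE mul1r (inj_eq (@lift_inj _ _)).
- by rewrite eq_sym (negbTE (neq_lift _ _)).
- by rewrite (negbTE (neq_lift _ _)).
- by rewrite eqxx.
Qed.

Lemma warp_frame_unit k E : k != 0 -> E \in unitmx -> warp_frame k E \in unitmx.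
Proof.
move=> k0 uE; have := mulmx1_unit (_ : warp_frame k E *m warp_frame k^-1 (invmx E) = 1%:M).
by rewrite warp_frame_mul mulfV // mulmxV // warp_frame1 => /(_ erefl)[].
Qed.

Lemma invmx_warp_frame k E : k != 0 -> E \in unitmx ->
  invmx (warp_frame k E) = warp_frame k^-1 (invmx E).
Proof.
move=> k0 uE; apply: (can_inj (mulKmx (warp_frame_unit k0 uE))).
by rewrite mulmxV ?warp_frame_unit// warp_frame_mul mulfV // mulmxV // warp_frame1.
Qed.

Lemma tr_warp_frame k E : (warp_frame k E)^T = warp_frame k E^T.
Proof.
apply/matrixP => i j; rewrite !mxE.
by case: (unliftP ord_max i) => [a|] _; case: (unliftP ord_max j) => [b|] _; rewrite ?mxE.
Qed.

Lemma warp_frame_metric k E : (warp_frame k E)^T *m warp_frame k E =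
  warp_frame (k ^+ 2) (E^T *m E).
Proof. by rewrite tr_warp_frame warp_frame_mul -expr2. Qed.

Lemma base_mxK : B *m B^T = 1%:M.
Proof.
apply/matrixP => i j; rewrite !mxE (bigD1 (lift ord_max i)) //= !mxE eqxx mul1r.
rewrite (inj_eq (@lift_inj _ _)) big1 ?addr0 // => c /negbTE ci.
by rewrite !mxE ci mul0r.
Qed.

Lemma row_base_mx a : row a B = delta_mx 0 (lift ord_max a).
Proof. by apply/rowP => j; rewrite !mxE. Qed.

Lemma delta_max_base : delta_mx 0 ord_max *m B^T = 0 :> 'rV[R]_n.
Proof.
by apply/rowP => j; rewrite -rowE !mxE (negbTE (neq_lift _ _)).
Qed.

Lemma base_mx_warp_frame k E : B *m warp_frame k E = k *: (E *m B).
Proof.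
apply/matrixP => a j; rewrite !mxE (bigD1 (lift ord_max a)) //= !mxE eqxx mul1r liftK.
rewrite big1 ?addr0; last by move=> c /negbTE ca; rewrite !mxE ca mul0r.
case: (unliftP ord_max j) => [b|] ->.
  rewrite (bigD1 b) //= mxE eqxx mulr1 big1 ?addr0// => c /negbTE cb.
  by rewrite mxE (inj_eq (@lift_inj _ _)) eq_sym cb mulr0.
by rewrite big1 ?mulr0// => c _; rewrite mxE (negbTE (neq_lift _ _)) mulr0.
Qed.

Lemma row_warp_frame_max k E : row ord_max (warp_frame k E) = delta_mx 0 ord_max.
Proof.
apply/rowP => j; rewrite !mxE unlift_none.
case: (unliftP ord_max j) => [b|] ->; last by rewrite !eqxx.
by rewrite [_ == ord_max]eq_sym (negbTE (neq_lift _ _)) andbF.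
Qed.

Lemma pull_dt k E : pull (warp_frame k E) (dt R n) = dt R n.
Proof. by rewrite /dt pull_covector -rowE row_warp_frame_max. Qed.

End AnyDim.

Lemma pull_scale m n d k (L : 'M[R]_(m, n)) a : homogeneous d a ->
  pull (k *: L) a = k ^+ d *: pull L a.
Proof.
move=> Ha; rewrite /pull scaler_sumr; apply: eq_bigr => T _.
have [Td|/Ha ->] := eqVneq #|T| d; last by rewrite !scale0r scaler0.
rewrite scalerA mulrC -scalerA; congr (_ *: _); rewrite -Td cardE.
elim: (enum T) => [|i s IH]; first by rewrite expr0 scale1r.
by rewrite !row_wedge_cons IH linearZ covectorZ wedgeZl wedgeZr scalerA -exprS.
Qed.

Lemma pull_warp_frame n d k (E : 'M[R]_n) a : homogeneous d a ->
  pull (warp_frame k E) (pull (base_mx R n) a) = k ^+ d *: pull (base_mx R n) (pull E a).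
Proof. by move=> Ha; rewrite pull_mulmx base_mx_warp_frame (pull_scale _ _ Ha) pull_mulmx. Qed.

Lemma wedge_covector_sign n d (a : ext R n) u : homogeneous d a ->
  wedge a (covector u) = (-1) ^+ d *: wedge (covector u) a.
Proof.
move=> Ha; rewrite (ext_basis a) wedge_suml wedge_sumr scaler_sumr.
apply: eq_bigr => T _; rewrite wedgeZl wedgeZr.
have [Td|/Ha ->] := eqVneq #|T| d; last by rewrite !scale0r scaler0.
rewrite scalerA mulrC -scalerA; congr (_ *: _); rewrite -row_wedge1 -Td cardE.
elim: (enum T) => [|i s IH]; first by rewrite wedge1l wedge1r scale1r.
by rewrite row_wedge_cons -wedgeA IH wedgeZr wedge_covectorCA
  exprS mulN1r scaleNr scalerN.
Qed.

Local Notation B := (base_mx R 7).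
Local Notation e8 := (dt R 7).
Local Notation phi0 := (leval (1%:M : 'M[R]_7) g2_terms).
Local Notation psi0 := (leval (1%:M : 'M[R]_7) g2_dual_terms).
Local Notation Phi := (leval (1%:M : 'M[R]_8) spin7_terms).

Lemma homogeneous_phi0 : homogeneous 3 phi0.
Proof. exact: homogeneous_leval. Qed.

Lemma homogeneous_psi0 : homogeneous 4 psi0.
Proof. exact: homogeneous_leval. Qed.

Lemma leval_base p : all (fun t => all (fun i => i < 7)%N t.2) p ->
  leval (1%:M : 'M[R]_8) p = pull B (leval 1%:M p).
Proof.
move=> /allP Hp; rewrite /leval pull_sum big_seq [RHS]big_seq; apply: eq_bigr => t /Hp.
rewrite pullZ /mono_wedge pull_row_wedge mul1mx => Ht; congr (_ *: _).
apply: row_wedge_mulmx_eq; rewrite -!map_comp; apply/eq_in_map => i /(allP Ht) i7 /=.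
by rewrite row_base_mx row1 lift_max_inord.
Qed.

Lemma dt_leval : leval (1%:M : 'M[R]_8) [:: (1, [:: 7%N])] = e8.
Proof.
rewrite leval1 scale1r /mono_wedge /= row_wedge_cons wedge1r row1 /dt.
by congr (covector (delta_mx _ _)); apply: val_inj; rewrite /= inordK.
Qed.

Lemma spin7_split : Phi = wedge (pull B phi0) e8 + pull B psi0.
Proof.
rewrite -!leval_base // -dt_leval -leval_mul -leval_cat.
by apply: leval_eq; vm_compute.
Qed.

(** The exponents 3 and 4 are the degrees of phi and of its dual: scaling the seven base covectors
    by k multiplies a form of degree d by k^d. *)
Lemma spin7_model_warp k (E : 'M[R]_7) :
  k ^+ 3 *: wedge (pull B (leval E g2_terms)) e8 + k ^+ 4 *: pull B (leval E g2_dual_terms) =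
  spin7_model (warp_frame k E).
Proof.
rewrite spin7_model_leval (leval_pull (warp_frame k E)) spin7_split pullD pull_wedge pull_dt.
rewrite (pull_warp_frame _ _ homogeneous_phi0) (pull_warp_frame _ _ homogeneous_psi0).
by rewrite wedgeZl -!leval_pull.
Qed.

Lemma hodge_g2_model (E : 'M[R]_7) : E \in unitmx ->
  hodge (E^T *m E) (row_wedge E (enum 'I_7)) (g2_model E) = leval E g2_dual_terms.
Proof.
by move=> uE; rewrite g2_model_leval leval_pull hodge_pull // flat_star_g2 -leval_pull.
Qed.

Lemma pairing_pull_base (a b : ext R 7) : pairing (pull B a) (pull B b) = pairing a b.
Proof. by rewrite pairing_pull pull_mulmx base_mxK pull1. Qed.

Lemma intprod_dt_base (b : ext R 7) : intprod (delta_mx 0 ord_max) (pull B b) = 0.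
Proof.
rewrite intprod_pull delta_max_base intprod_lcomb big1 ?pull0 // => i _.
by rewrite mxE scale0r.
Qed.

Lemma intprod_dt_wedge (x : ext R 8) : intprod (delta_mx 0 ord_max) (wedge e8 x) =
  x - wedge e8 (intprod (delta_mx 0 ord_max) x).
Proof.
rewrite intprod_wedge [X in X *: x](_ : _ = 1) ?scale1r //.
by rewrite -rowE !mxE !eqxx.
Qed.

(* d(f^3 phi /\ dt + f^4 *phi) at a point, in the coframe warp_frame k E, where
   k = f, k' = f', and al, be are dphi, d*phi in the coframe E. *)
Definition warp_torsion (k k' : R) (al be : ext R 7) : ext R 8 :=
  k^-1 *: (wedge e8 (pull B ((4%:R * k') *: psi0 + al)) + pull B be).

(** Forms of degree 4 and 5 on the base pull back with factors k^4 and k^5; the factor k^-1 of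
    [warp_torsion] brings these to k^3 and k^4. The 4-form commutes with dt. *)
Lemma pull_warp_torsion k k' (E : 'M[R]_7) al be : k != 0 ->
  homogeneous 4 al -> homogeneous 5 be ->
  pull (warp_frame k E) (warp_torsion k k' al be) =
  (4%:R * k ^+ 3 * k') *: wedge e8 (pull B (pull E psi0))
  + k ^+ 3 *: wedge (pull B (pull E al)) e8 + k ^+ 4 *: pull B (pull E be).
Proof.
move=> k0 Hal Hbe.
rewrite /dt (wedge_covector_sign _ (homogeneous_pull B (homogeneous_pull E Hal))).
rewrite pullZ pullD pull_wedge pull_dt (pull_warp_frame _ _ Hbe).
have H4 : homogeneous 4 ((4%:R * k') *: psi0 + al).
  by apply: homogeneousD => //; exact/homogeneousZ/homogeneous_psi0.
rewrite (pull_warp_frame _ _ H4) !pullD !pullZ !wedgeZr wedgeDr wedgeZr.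
rewrite !scalerDr !scalerA. congr (_ *: _ + _ *: _ + _ *: _).
- by field.
- by rewrite -signr_odd expr0 mulr1; field.
- by field.
Qed.

Lemma pairing_psi0 : pairing psi0 psi0 = 7%:R.
Proof. by rewrite pairing_leval // -[7%:R]/(7%:Z%:~R); congr (_%:~R); vm_compute. Qed.

Lemma pairing_dt_warp_torsion k k' (x al be : ext R 7) :
  pairing (wedge e8 (pull B x)) (warp_torsion k k' al be) =
  k^-1 * (4%:R * k' * pairing x psi0 + pairing x al).
Proof.
rewrite /warp_torsion pairingZr pairing_wedge_covector intprodD intprod_dt_wedge.
rewrite !intprod_dt_base wedge0r subr0 addr0 pairing_pull_base.
by rewrite pairingDr pairingZr.
Qed.

Lemma dt_wedge_spin7 : wedge e8 Phi = wedge e8 (pull B psi0).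
Proof.
rewrite spin7_split wedgeDr (wedge_covector_sign _ (homogeneous_pull B homogeneous_phi0)).
by rewrite wedgeZr wedgeA wedge_covector_sqr wedge0l scaler0 add0r.
Qed.

(** Wedging the hypothesis with dt on the left shows that the torsion is orthogonal to dt /\ Phi =
    dt /\ psi0. The coefficient 28 is 4 |psi0|^2. *)
Lemma balanced_warp_torsion k k' al be : k != 0 ->
  wedge Phi (flat_star (warp_torsion k k' al be)) = 0 ->
  28%:R * k' + pairing psi0 al = 0.
Proof.
move=> k0 H; have := wedge_flat_star_top (wedge e8 Phi) (warp_torsion k k' al be).
rewrite -wedgeA H wedge0r ffunE => /esym.
rewrite dt_wedge_spin7 pairing_dt_warp_torsion pairing_psi0 => /eqP.
rewrite mulf_eq0 invr_eq0 (negbTE k0) /= => /eqP <-.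
by congr (_ + _); ring.
Qed.

(** Contraction with dt turns u /\ Phi into u_8 Phi + u /\ phi0. The hypothesis on x removes the
    second part, so dt /\ x detects only the dt-component of u. *)
Lemma pairing_dt_wedge_spin7 (u : 'rV[R]_8) (x : ext R 7) :
  (forall i, pairing x (wedge (covector (row i 1%:M)) phi0) = 0) ->
  pairing (wedge e8 (pull B x)) (wedge (covector u) Phi) = u 0 ord_max * pairing x psi0.
Proof.
move=> Hx; rewrite pairing_wedge_covector intprod_wedge pairingDr pairingZr.
have -> : ((delta_mx 0 ord_max : 'rV[R]_8) *m u^T) 0 0 = u 0 ord_max by rewrite -rowE !mxE.
have -> : intprod (delta_mx 0 ord_max) Phi = - pull B phi0.
  rewrite spin7_split /dt (wedge_covector_sign _ (homogeneous_pull B homogeneous_phi0)).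
  rewrite intprodD intprod_dt_base addr0 intprodZ intprod_dt_wedge intprod_dt_base.
  by rewrite wedge0r subr0 -signr_odd expr1 scaleN1r.
rewrite wedgeNr opprK.
have -> : pairing (pull B x) (wedge (covector u) (pull B phi0)) = 0.
  rewrite pairing_pull pull_covector_wedge pull_mulmx base_mxK pull1.
  rewrite [u *m _]row_sum_delta covector_sum wedge_suml pairing_sumr big1 // => i _.
  by rewrite covectorZ wedgeZl pairingZr -row1 Hx mulr0.
rewrite addr0; congr (_ * _).
rewrite spin7_split /dt (wedge_covector_sign _ (homogeneous_pull B homogeneous_phi0)).
rewrite pairingDr pairing_pull_base pairingZr pairingC pairing_wedge_covector.
by rewrite intprod_dt_base pairing0r mulr0 add0r.
Qed.

(** Each index occurs in seven of the fourteen terms of Phi, so e^i /\ Phi keeps seven terms and has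
    square norm 7; for distinct i these forms are orthogonal, by computation. *)
Lemma pairing_covector_spin7 (u v : 'rV[R]_8) :
  pairing (wedge (covector u) Phi) (wedge (covector v) Phi) = 7%:R * (u *m v^T) 0 0.
Proof.
have key (i j : 'I_8) : pairing (wedge (covector (row i 1%:M)) Phi)
    (wedge (covector (row j 1%:M)) Phi) = 7%:R * (i == j)%:R.
  have E (k : 'I_8) : wedge (covector (row k 1%:M)) Phi =
      leval (1%:M : 'M[R]_8) (lnorm (lmul [:: (1, [:: val k])] spin7_terms)).
    rewrite leval_norm leval_mul leval1 scale1r /mono_wedge /= inord_val.
    by rewrite row_wedge_cons wedge1r.
  have check : alln 8 (fun k => lvalid 8 (lnorm (lmul [:: (1, [:: k])] spin7_terms))).
    by vm_compute.
  have check2 : alln 8 (fun k => alln 8 (fun l =>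
      lpair (lnorm (lmul [:: (1, [:: k])] spin7_terms))
            (lnorm (lmul [:: (1, [:: l])] spin7_terms)) == 7 * (k == l)%:R)).
    by vm_compute.
  rewrite !E pairing_leval ?(allnP _ check) //.
  have /eqP -> := allnP j (allnP i check2).
  by rewrite intrM; congr (_ * _); rewrite -val_eqE; case: eqP.
have cE (w : 'rV[R]_8) : covector w = \sum_i w 0 i *: covector (row i 1%:M).
  rewrite {1}[w]row_sum_delta covector_sum; apply: eq_bigr => i _.
  by rewrite covectorZ row1.
rewrite (cE u) (cE v) !wedge_suml pairing_suml mxE mulr_sumr.
apply: eq_bigr => i _; rewrite wedgeZl pairingZl pairing_sumr (bigD1 i) //= big1 => [|j ji].
  rewrite wedgeZl pairingZr key eqxx addr0 mxE mulr1. ring.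
by rewrite wedgeZl pairingZr key eq_sym (negbTE ji) !mulr0.
Qed.

(* lambda_1 of a 5-form: the projection onto the forms u /\ Phi. *)
Definition lee_form (g : ext R 8) : 'rV[R]_8 :=
  \row_i (7%:R^-1 * pairing (wedge (covector (delta_mx 0 i)) Phi) g).

(** The remainder x is orthogonal to every e^i /\ Phi, and <e^i /\ Phi, x> is, up to sign, the
    coefficient of the 7-form Phi /\ *x at the complement of i. *)
Lemma lee_form_orthogonal g : homogeneous 5 g ->
  wedge Phi (flat_star (g - wedge (covector (lee_form g)) Phi)) = 0.
Proof.
move=> Hg; set x := g - _.
have Hx : homogeneous 5 x.
  apply: homogeneousB => //; apply: (@homogeneous_wedge _ _ 1 4).
    exact: homogeneous_covector.
  exact: homogeneous_spin7.
have px (i : 'I_8) : pairing (wedge (covector (delta_mx 0 i)) Phi) x = 0.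
  rewrite /x -scaleN1r pairingDr pairingZr pairing_covector_spin7.
  by rewrite -rowE !mxE; field.
have Hr : homogeneous 7 (wedge Phi (flat_star x)).
  by apply: (@homogeneous_wedge _ _ 4 3); [exact: homogeneous_spin7 | exact: (homogeneous_flat_star Hx)].
apply: eq_ext_basis => S; rewrite [RHS]ffunE.
have [S7|/Hr -> //] := eqVneq #|S| 7.
have /cards1P[i iS] : #|~: S| == 1%N.
  by have := cardsC S; rewrite card_ord S7 => /eqP; rewrite -[8%N]/(7 + 1)%N eqn_add2l.
have := px i; rewrite -wedge_flat_star_top -wedgeA covector_delta wedge_top.
rewrite (bigD1 [set i]) //= big1 => [|A Ai].
  rewrite ffunE eqxx mulr1 addr0 -iS setCK => /eqP.
  by rewrite mulf_eq0 (negbTE (shuffle_sign_neq0 _ _ _)) => /eqP.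
by rewrite ffunE (negbTE Ai) mulr0 mul0r.
Qed.

End WarpedFrame.

(** * Smooth functions and the exterior derivative *)

Local Open Scope classical_set_scope.

Section SmoothFunctions.
Variables (R : realType) (n : nat).
Implicit Types (U : set 'rV[R]_n) (h g : 'rV[R]_n -> R) (x : 'rV[R]_n).

Lemma eq_near U h g x : open U -> U x -> (forall y, U y -> h y = g y) ->
  \forall y \near x, h y = g y.
Proof. by move=> oU Ux hg; near do apply: hg; exact: open_nbhs_nbhs. Unshelve. all: by end_near. Qed.

Lemma eq_partial U h g i x : open U -> U x -> (forall y, U y -> h y = g y) ->
  partial i h x = partial i g x.
Proof. by move=> oU Ux hg; exact/near_eq_derive/(eq_near oU Ux). Qed.

Lemma eq_derivable U h g v x : open U -> U x -> (forall y, U y -> h y = g y) ->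
  derivable h x v -> derivable g x v.
Proof. by move=> oU Ux hg; exact/near_eq_derivable/(eq_near oU Ux). Qed.

Lemma partial_cst i (c : R) x : partial i (fun=> c) x = 0.
Proof. exact: derive_cst. Qed.

Lemma partialD i h g x : derivable h x (delta_mx 0 i) -> derivable g x (delta_mx 0 i) ->
  partial i (fun y => h y + g y) x = partial i h x + partial i g x.
Proof. exact: deriveD. Qed.

Lemma partialM i h g x : derivable h x (delta_mx 0 i) -> derivable g x (delta_mx 0 i) ->
  partial i (fun y => h y * g y) x = h x * partial i g x + g x * partial i h x.
Proof. exact: deriveM. Qed.

Lemma partialZ i (c : R) h x : derivable h x (delta_mx 0 i) ->
  partial i (fun y => c * h y) x = c * partial i h x.
Proof.
move=> dh; have dc : derivable (fun=> c : R) x (delta_mx 0 i : 'rV[R]_n) := derivable_cst _ _ _.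
by rewrite (partialM dc dh) partial_cst mulr0 addr0.
Qed.

Lemma partialZr i h (c : R) x : derivable h x (delta_mx 0 i) ->
  partial i (fun y => h y * c) x = partial i h x * c.
Proof.
move=> dh; have dc : derivable (fun=> c : R) x (delta_mx 0 i : 'rV[R]_n) := derivable_cst _ _ _.
by rewrite (partialM dh dc) partial_cst mulr0 add0r mulrC.
Qed.

Lemma partialV i h x : h x != 0 -> derivable h x (delta_mx 0 i) ->
  partial i (fun y => (h y)^-1) x = - ((h x)^-1 * (h x)^-1 * partial i h x).
Proof. by move=> h0 dh; rewrite /partial deriveV // scaleNr -invfM -expr2. Qed.

Lemma partial_sum i (I : Type) (r : seq I) (F : I -> 'rV[R]_n -> R) x :
  (forall k, derivable (F k) x (delta_mx 0 i)) ->
  derivable (fun y => \sum_(k <- r) F k y) x (delta_mx 0 i) /\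
  partial i (fun y => \sum_(k <- r) F k y) x = \sum_(k <- r) partial i (F k) x.
Proof.
move=> dF; elim: r => [|k r [dS pS]].
  rewrite big_nil (_ : (fun y => _) = fun=> 0); last by apply/funext => y; rewrite big_nil.
  by split; [exact: derivable_cst | exact: partial_cst].
rewrite (_ : (fun y => _) = (fun y => F k y + \sum_(k <- r) F k y)); last first.
  by apply/funext => y; rewrite big_cons.
by split; [exact: (derivableD (dF k) dS) | rewrite (partialD (dF k) dS) pS big_cons].
Qed.

Lemma derivable_coord j x v : derivable (fun y : 'rV[R]_n => y 0 j) x v.
Proof. by have /derivable_mxP := @derivable_id R 'rV[R]_n x v; exact. Qed.

Lemma partial_coord i j x : partial i (fun y => y 0 j) x = (i == j)%:R.
Proof.
have := derive_mx (@derivable_id R 'rV[R]_n x (delta_mx 0 i)).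
by rewrite derive_id => /rowP/(_ j); rewrite !mxE eqxx eq_sym => ->.
Qed.

(** Recursion on first derivatives lets the function vary in an induction on the order; [smooth_on]
    ranges instead over lists of indices, of which the last is differentiated first. *)
Fixpoint Ck (k : nat) U h : Prop :=
  (forall x, U x -> {for x, continuous h} /\ forall i, derivable h x (delta_mx 0 i)) /\
  (if k is k'.+1 then forall i, Ck k' U (partial i h) else True).

Lemma Ck0 k U h x : Ck k U h -> U x ->
  {for x, continuous h} /\ forall i, derivable h x (delta_mx 0 i).
Proof. by case: k => [|k] [+ _]; exact. Qed.

Lemma smooth_onP U h : smooth_on U h <-> forall k, Ck k U h.
Proof.
split=> [sh k|Ch s x Ux].
  elim: k h sh => [|k IH] h sh; first by split=> // x Ux; exact: (sh [::]).
  split=> [x Ux|i]; first exact: (sh [::]).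
  apply: IH => s x Ux; have := sh (rcons s i) x Ux.
  by rewrite /partials foldr_rcons.
elim/last_ind: s h Ch => [|s i IH] h Ch; first exact: (Ck0 (Ch 0) Ux).
rewrite /partials foldr_rcons; apply: IH => k.
by have [_] := Ch k.+1; exact.
Qed.

Lemma CkW k U h : Ck k.+1 U h -> Ck k U h.
Proof.
elim: k h => [|k IH] h [h0 hS]; split=> // i; exact/IH/hS.
Qed.

Lemma eq_Ck k U h g : open U -> (forall y, U y -> h y = g y) -> Ck k U h -> Ck k U g.
Proof.
move=> oU; elim: k h g => [|k IH] h g hg [h0 hS].
all: split=> [x Ux|//].
1,2: have [ch dh] := h0 _ Ux; split=> [|i]; last exact: eq_derivable hg (dh i).
1,2: rewrite /prop_for/continuous_at -(hg _ Ux); apply: cvg_trans ch.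
1,2: exact: (@near_eq_cvg _ _ (nbhs x) _ h g (eq_near oU Ux hg)).
by move=> i; apply: IH (hS i) => y Uy; exact: eq_partial hg.
Qed.

Lemma Ck_intro k U h :
  (forall x, U x -> {for x, continuous h} /\ forall i, derivable h x (delta_mx 0 i)) ->
  (forall k' i, k = k'.+1 -> Ck k' U (partial i h)) -> Ck k U h.
Proof. by case: k => [|k] h0 hS; split=> // i; exact: hS. Qed.

Lemma Ck_cst k U (c : R) : Ck k U (fun=> c).
Proof.
elim: k c => [|k IH] c; apply: Ck_intro => [x Ux|k' i // [<-]].
1,2: by split=> [|i]; [exact: cst_continuous | exact: derivable_cst].
rewrite (_ : partial i _ = fun=> 0); first exact: IH.
by apply/funext => x; exact: partial_cst.
Qed.

Lemma CkD k U h g : open U -> Ck k U h -> Ck k U g -> Ck k U (fun x => h x + g x).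
Proof.
move=> oU; elim: k h g => [|k IH] h g Ch Cg; apply: Ck_intro => [x Ux|k' i // [<-]].
1,2: have [ch dh] := Ck0 Ch Ux; have [cg dg] := Ck0 Cg Ux.
1,2: by split=> [|i]; [exact: continuousD | exact: derivableD].
apply: (@eq_Ck _ _ (fun x => partial i h x + partial i g x)) => // [x Ux|].
  by rewrite partialD //; [have [_] := Ck0 Ch Ux | have [_] := Ck0 Cg Ux]; exact.
by apply: IH; [have [_] := Ch | have [_] := Cg]; exact.
Qed.

Lemma CkM k U h g : open U -> Ck k U h -> Ck k U g -> Ck k U (fun x => h x * g x).
Proof.
move=> oU; elim: k h g => [|k IH] h g Ch Cg; apply: Ck_intro => [x Ux|k' i // [<-]].
1,2: have [ch dh] := Ck0 Ch Ux; have [cg dg] := Ck0 Cg Ux.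
1,2: by split=> [|i]; [exact: continuousM | exact: derivableM].
apply: (@eq_Ck _ _ (fun x => h x * partial i g x + g x * partial i h x)) => // [x Ux|].
  by rewrite partialM //; [have [_] := Ck0 Ch Ux | have [_] := Cg; have [_] := Ck0 Cg Ux]; exact.
by apply: CkD => //; apply: IH; try exact: CkW; [have [_] := Cg | have [_] := Ch]; exact.
Qed.

Lemma CkV k U h : open U -> (forall x, U x -> h x != 0) -> Ck k U h ->
  Ck k U (fun x => (h x)^-1).
Proof.
move=> oU h0; elim: k h h0 => [|k IH] h h0 Ch; apply: Ck_intro => [x Ux|k' i // [<-]].
1,2: have [ch dh] := Ck0 Ch Ux; have hx := h0 _ Ux.
1,2: by split=> [|i]; [exact: continuousV | exact: derivableV].
apply: (@eq_Ck _ _ (fun x => -1 * ((h x)^-1 * (h x)^-1 * partial i h x))) => // [x Ux|].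
  by rewrite partialV ?mulN1r//; [exact: h0 | have [_] := Ck0 Ch Ux; exact].
apply: CkM => //; first exact: Ck_cst.
apply: CkM => //; last by have [_] := Ch; exact.
by apply: CkM => //; apply: IH => //; exact: CkW.
Qed.

Lemma smooth_cst U (c : R) : smooth_on U (fun=> c).
Proof. by apply/smooth_onP => k; exact: Ck_cst. Qed.

Lemma smoothD U h g : open U -> smooth_on U h -> smooth_on U g ->
  smooth_on U (fun x => h x + g x).
Proof. by move=> oU /smooth_onP Ch /smooth_onP Cg; apply/smooth_onP => k; exact: CkD. Qed.

Lemma smoothM U h g : open U -> smooth_on U h -> smooth_on U g ->
  smooth_on U (fun x => h x * g x).
Proof. by move=> oU /smooth_onP Ch /smooth_onP Cg; apply/smooth_onP => k; exact: CkM. Qed.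

Lemma smoothV U h : open U -> (forall x, U x -> h x != 0) -> smooth_on U h ->
  smooth_on U (fun x => (h x)^-1).
Proof. by move=> oU h0 /smooth_onP Ch; apply/smooth_onP => k; exact: CkV. Qed.

Lemma eq_smooth U h g : open U -> (forall y, U y -> h y = g y) ->
  smooth_on U h -> smooth_on U g.
Proof. by move=> oU hg /smooth_onP Ch; apply/smooth_onP => k; exact: eq_Ck hg (Ch k). Qed.

Lemma smoothX U h k : open U -> smooth_on U h -> smooth_on U (fun x => h x ^+ k).
Proof.
move=> oU sh; elim: k => [|k IH].
  rewrite (_ : (fun x => _) = fun=> 1); first exact: smooth_cst.
  by apply/funext => x; rewrite expr0.
rewrite (_ : (fun x => _) = (fun x => h x * h x ^+ k)); first exact: (smoothM oU sh IH).
by apply/funext => x; rewrite exprS.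
Qed.

Lemma smooth_sum U (I : Type) (r : seq I) (P : pred I) (F : I -> 'rV[R]_n -> R) :
  open U -> (forall k, P k -> smooth_on U (F k)) ->
  smooth_on U (fun x => \sum_(k <- r | P k) F k x).
Proof.
move=> oU sF; elim: r => [|k r IH].
  rewrite (_ : (fun x => _) = fun=> 0); first exact: smooth_cst.
  by apply/funext => x; rewrite big_nil.
rewrite (_ : (fun x => _) =
    (fun x => (if P k then F k x else 0) + \sum_(k <- r | P k) F k x)); last first.
  by apply/funext => x; rewrite big_cons; case: ifP => // _; rewrite add0r.
have sk : smooth_on U (fun x => if P k then F k x else 0).
  by case: (P k) (sF k) => [/(_ isT)//|_]; exact: smooth_cst.
exact: (smoothD oU sk IH).
Qed.

Lemma smooth_prod U (I : Type) (r : seq I) (P : pred I) (F : I -> 'rV[R]_n -> R) :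
  open U -> (forall k, P k -> smooth_on U (F k)) ->
  smooth_on U (fun x => \prod_(k <- r | P k) F k x).
Proof.
move=> oU sF; elim: r => [|k r IH].
  rewrite (_ : (fun x => _) = fun=> 1); first exact: smooth_cst.
  by apply/funext => x; rewrite big_nil.
rewrite (_ : (fun x => _) =
    (fun x => (if P k then F k x else 1) * \prod_(k <- r | P k) F k x)); last first.
  by apply/funext => x; rewrite big_cons; case: ifP => // _; rewrite mul1r.
have sk : smooth_on U (fun x => if P k then F k x else 1).
  by case: (P k) (sF k) => [/(_ isT)//|_]; exact: smooth_cst.
exact: (smoothM oU sk IH).
Qed.

Lemma smooth_partial U h i : smooth_on U h -> smooth_on U (partial i h).
Proof.
by move=> sh s x Ux; have := sh (rcons s i) x Ux; rewrite /partials foldr_rcons.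
Qed.

Lemma smooth_derivable U h x i : smooth_on U h -> U x -> derivable h x (delta_mx 0 i).
Proof. by move=> sh Ux; have [_] := sh [::] x Ux; exact. Qed.

Lemma smooth_coord U j : smooth_on U (fun x => x 0 j).
Proof.
apply/smooth_onP => k; apply: Ck_intro => [x Ux|k' i _].
  by split=> [|i]; [exact: coord_continuous | exact: derivable_coord].
rewrite (_ : partial i _ = fun=> (i == j)%:R); first exact: Ck_cst.
by apply/funext => x; exact: partial_coord.
Qed.

End SmoothFunctions.
Arguments smooth_derivable {R n U h x} i _ _.

(** * Smoothness of matrix-valued and form-valued functions *)

Section SmoothMatrices.
Variables (R : realType) (n : nat) (U : set 'rV[R]_n).
Hypothesis oU : open U.

Definition smooth_mx p q (A : 'rV[R]_n -> 'M[R]_(p, q)) : Prop :=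
  forall i j, smooth_on U (fun x => A x i j).

Lemma smooth_mx_tr p q (A : 'rV[R]_n -> 'M[R]_(p, q)) :
  smooth_mx A -> smooth_mx (fun x => (A x)^T).
Proof.
by move=> sA i j; rewrite (_ : (fun x => _) = (fun x => A x j i))//; apply/funext => x; rewrite mxE.
Qed.

Lemma smooth_mxM p q r (A : 'rV[R]_n -> 'M[R]_(p, q)) (B : 'rV[R]_n -> 'M[R]_(q, r)) :
  smooth_mx A -> smooth_mx B -> smooth_mx (fun x => A x *m B x).
Proof.
move=> sA sB i j.
rewrite (_ : (fun x => _) = (fun x => \sum_k A x i k * B x k j)); last first.
  by apply/funext => x; rewrite mxE.
by apply: smooth_sum => // k _; exact: smoothM.
Qed.

Lemma smooth_det p (A : 'rV[R]_n -> 'M[R]_p) : smooth_mx A -> smooth_on U (fun x => \det (A x)).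
Proof.
move=> sA; apply: smooth_sum => // s _; apply: smoothM => //; first exact: smooth_cst.
by apply: smooth_prod.
Qed.

Lemma smooth_invmx p (A : 'rV[R]_n -> 'M[R]_p) : (forall x, U x -> A x \in unitmx) ->
  smooth_mx A -> smooth_mx (fun x => invmx (A x)).
Proof.
move=> uA sA i j.
apply: (@eq_smooth _ _ _ (fun x => (\det (A x))^-1 * cofactor (A x) j i)) => //.
  by move=> x Ux; rewrite /invmx uA// !mxE.
apply: smoothM => //.
  apply: smoothV => //; last exact: smooth_det.
  by move=> x /uA; rewrite unitmxE unitfE.
apply: smoothM => //; first exact: smooth_cst.
apply: smooth_det => k l.
by rewrite (_ : (fun x => _) = (fun x => A x (lift j k) (lift i l)))//;
  apply/funext => x; rewrite !mxE.
Qed.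

Definition smooth_ext m (w : 'rV[R]_n -> ext R m) : Prop :=
  forall S, smooth_on U (fun x => w x S).

Lemma smooth_ext_cst m (w : ext R m) : smooth_ext (fun=> w).
Proof. by move=> S; exact: smooth_cst. Qed.

Lemma smooth_extD m (w v : 'rV[R]_n -> ext R m) :
  smooth_ext w -> smooth_ext v -> smooth_ext (fun x => w x + v x).
Proof.
move=> sw sv S; rewrite (_ : (fun x => _) = (fun x => w x S + v x S)); first exact: (smoothD oU (sw S) (sv S)).
by apply/funext => x; rewrite ffunE.
Qed.

Lemma smooth_extZ m k (w : 'rV[R]_n -> ext R m) :
  smooth_on U k -> smooth_ext w -> smooth_ext (fun x => k x *: w x).
Proof.
move=> sk sw S; rewrite (_ : (fun x => _) = (fun x => k x * w x S)); first exact: (smoothM oU sk (sw S)).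
by apply/funext => x; rewrite ffunE.
Qed.

Lemma smooth_ext_sum m (I : Type) (r : seq I) (P : pred I) (F : I -> 'rV[R]_n -> ext R m) :
  (forall k, P k -> smooth_ext (F k)) -> smooth_ext (fun x => \sum_(k <- r | P k) F k x).
Proof.
move=> sF S.
rewrite (_ : (fun x => _) = (fun x => \sum_(k <- r | P k) F k x S)); last first.
  by apply/funext => x; rewrite sum_ffunE.
by apply: smooth_sum => // k /sF; exact.
Qed.

Lemma smooth_wedge m (w v : 'rV[R]_n -> ext R m) :
  smooth_ext w -> smooth_ext v -> smooth_ext (fun x => wedge (w x) (v x)).
Proof.
move=> sw sv S.
rewrite (_ : (fun x => _) = (fun x => \sum_(A : {set 'I_m} | A \subset S)
   shuffle_sign R A (finset.setD S A) * w x A * v x (finset.setD S A))); last first.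
  by apply/funext => x; rewrite ffunE.
apply: smooth_sum => // A _; apply: smoothM => //; apply: smoothM => //; exact: smooth_cst.
Qed.

Lemma smooth_covector m (u : 'rV[R]_n -> 'rV[R]_m) :
  smooth_mx u -> smooth_ext (fun x => covector (u x)).
Proof.
move=> su S; rewrite (_ : (fun x => _) = (fun x => \sum_i (S == finset.set1 i)%:R * u x 0 i)); last first.
  by apply/funext => x; rewrite ffunE.
by apply: smooth_sum => // i _; apply: smoothM => //; exact: smooth_cst.
Qed.

Lemma smooth_row_wedge p m (E : 'rV[R]_n -> 'M[R]_(p, m)) s :
  smooth_mx E -> smooth_ext (fun x => row_wedge (E x) s).
Proof.
move=> sE; elim: s => [|i s IH]; first exact: smooth_ext_cst.
apply: smooth_wedge => //; apply: smooth_covector => k l.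
by rewrite (_ : (fun x => _) = (fun x => E x i l))//; apply/funext => x; rewrite mxE.
Qed.

Lemma smooth_pull p m (L : 'rV[R]_n -> 'M[R]_(p, m)) w :
  smooth_mx L -> smooth_ext w -> smooth_ext (fun x => pull (L x) (w x)).
Proof.
move=> sL sw; apply: smooth_ext_sum => T _; apply: smooth_extZ; first exact: sw.
exact: smooth_row_wedge.
Qed.

Lemma smooth_extd (w : 'rV[R]_n -> ext R n) : smooth_ext w -> smooth_ext (extd w).
Proof.
move=> sw; apply: smooth_ext_sum => i _; apply: smooth_wedge; first exact: (smooth_ext_cst (covector (delta_mx 0 i))).
move=> S; rewrite (_ : (fun x => _) = partial i (fun y => w y S)); first exact/smooth_partial/sw.
by apply/funext => x; rewrite ffunE.
Qed.

End SmoothMatrices.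

Section ExteriorDerivative.
Variables (R : realType) (n : nat) (U : set 'rV[R]_n) (x : 'rV[R]_n).
Hypotheses (oU : open U) (Ux : U x).

Definition partial_ext m (i : 'I_n) (w : 'rV[R]_n -> ext R m) (y : 'rV[R]_n) : ext R m :=
  [ffun S : {set 'I_m} => partial i (fun z => w z S) y].

Lemma partial_extD m i (a b : 'rV[R]_n -> ext R m) : smooth_ext U a -> smooth_ext U b ->
  partial_ext i (fun y => a y + b y) x = partial_ext i a x + partial_ext i b x.
Proof.
move=> sa sb; apply/ffunP => S; rewrite !ffunE.
rewrite -(partialD (smooth_derivable i (sa S) Ux) (smooth_derivable i (sb S) Ux)).
by congr (partial _ _ _); apply/funext => y; rewrite ffunE.
Qed.

Lemma partial_extZ m i c (a : 'rV[R]_n -> ext R m) : smooth_ext U a ->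
  partial_ext i (fun y => c *: a y) x = c *: partial_ext i a x.
Proof.
move=> sa; apply/ffunP => S; rewrite !ffunE /GRing.scale /=.
rewrite -(partialZ c (smooth_derivable i (sa S) Ux)).
by congr (partial _ _ _); apply/funext => y; rewrite ffunE.
Qed.

Lemma partial_ext_wedge m i (a b : 'rV[R]_n -> ext R m) : smooth_ext U a -> smooth_ext U b ->
  partial_ext i (fun y => wedge (a y) (b y)) x =
  wedge (partial_ext i a x) (b x) + wedge (a x) (partial_ext i b x).
Proof.
move=> sa sb; apply/ffunP => S; rewrite !ffunE.
(* A zero coefficient for A outside S turns the filtered sum into one over all A, to which
   [partial_sum] applies. *)
pose F (A : {set 'I_m}) (y : 'rV[R]_n) :=
  (if A \subset S then shuffle_sign R A (finset.setD S A) else 0) *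
  (a y A * b y (finset.setD S A)).
have dab A := derivableM (smooth_derivable i (sa A) Ux)
                         (smooth_derivable i (sb (finset.setD S A)) Ux).
have dF A : derivable (F A) x (delta_mx 0 i).
  exact: (derivableM (derivable_cst _ _ _) (dab A)).
have -> : (fun z => wedge (a z) (b z) S) = (fun z => \sum_A F A z).
  apply/funext => z; rewrite ffunE big_mkcond; apply: eq_bigr => A _; rewrite /F.
  by case: ifP => _; rewrite ?mul0r// mulrA.
rewrite (partial_sum _ dF).2 -big_split /= [RHS]big_mkcond; apply: eq_bigr => A _.
rewrite (partialZ _ (dab A)).
rewrite (partialM (smooth_derivable i (sa A) Ux) (smooth_derivable i (sb _) Ux)) !ffunE.
by case: ifP => _; rewrite ?mul0r//; ring.
Qed.

Lemma extdE w : extd w x = \sum_i wedge (covector (delta_mx 0 i)) (partial_ext i w x).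
Proof. by []. Qed.

Lemma extdD (a b : 'rV[R]_n -> ext R n) : smooth_ext U a -> smooth_ext U b ->
  extd (fun y => a y + b y) x = extd a x + extd b x.
Proof.
move=> sa sb; rewrite !extdE -big_split; apply: eq_bigr => i _.
by rewrite partial_extD // wedgeDr.
Qed.

Lemma extdZ c (a : 'rV[R]_n -> ext R n) : smooth_ext U a ->
  extd (fun y => c *: a y) x = c *: extd a x.
Proof.
move=> sa; rewrite !extdE scaler_sumr; apply: eq_bigr => i _.
by rewrite partial_extZ // wedgeZr.
Qed.

Lemma extd_cst (w : ext R n) : extd (fun=> w) x = 0.
Proof.
rewrite extdE big1 // => i _; rewrite (_ : partial_ext _ _ _ = 0) ?wedge0r//.
by apply/ffunP => S; rewrite !ffunE partial_cst.
Qed.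

Lemma extd_covector_wedge (u : 'rV[R]_n -> 'rV[R]_n) (w : 'rV[R]_n -> ext R n) :
  smooth_mx U u -> smooth_ext U w ->
  extd (fun y => wedge (covector (u y)) (w y)) x =
  wedge (extd (fun y => covector (u y)) x) (w x) - wedge (covector (u x)) (extd w x).
Proof.
move=> su sw; have scu := smooth_covector oU su.
rewrite !extdE wedge_suml wedge_sumr -sumrB; apply: eq_bigr => i _.
by rewrite partial_ext_wedge // wedgeDr wedgeA (wedge_covectorCA _ (u x)).
Qed.

Lemma eq_extd (a b : 'rV[R]_n -> ext R n) : (forall y, U y -> a y = b y) ->
  extd a x = extd b x.
Proof.
move=> ab; rewrite !extdE; apply: eq_bigr => i _; congr (wedge _ _).
by apply/ffunP => S; rewrite !ffunE; apply: eq_partial oU Ux _ => y /ab ->.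
Qed.

Lemma sum_symmetric_wedge (M : 'I_n -> 'I_n -> R) : (forall i j, M i j = M j i) ->
  \sum_i \sum_j M i j *: wedge (covector (delta_mx 0 i)) (covector (delta_mx 0 j)) = 0.
Proof.
move=> symM; set s := \sum_i _.
have /eqP : s = - s.
  rewrite {1}/s exchange_big /= -sumrN; apply: eq_bigr => i _; rewrite -sumrN.
  by apply: eq_bigr => j _; rewrite symM wedge_covectorC scalerN.
rewrite -subr_eq0 opprK -mulr2n -scaler_nat scaler_eq0 pnatr_eq0 => /eqP.
exact.
Qed.

Lemma covector_delta_sum (v : 'rV[R]_n) :
  covector v = \sum_j v 0 j *: covector (delta_mx 0 j).
Proof.
by rewrite {1}[v]row_sum_delta covector_sum; apply: eq_bigr => j _; rewrite covectorZ.
Qed.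

Lemma extd_covector (u : 'rV[R]_n -> 'rV[R]_n) : smooth_mx U u ->
  extd (fun y => covector (u y)) x =
  \sum_i \sum_j partial i (fun y => u y 0 j) x *:
     wedge (covector (delta_mx 0 i)) (covector (delta_mx 0 j)).
Proof.
move=> su; rewrite extdE; apply: eq_bigr => i _.
rewrite -[RHS](_ : wedge (covector (delta_mx 0 i)) (\sum_j partial i (fun y => u y 0 j) x *:
    covector (delta_mx 0 j)) = _); last first.
  by rewrite wedge_sumr; apply: eq_bigr => j _; rewrite wedgeZr.
congr (wedge _ _); apply/ffunP => S; rewrite ffunE sum_ffunE.
have d1 j : derivable (fun y => u y 0 j * covector (delta_mx 0 j : 'rV[R]_n) S) x (delta_mx 0 i).
  exact: (derivableM (smooth_derivable i (su 0 j) Ux) (derivable_cst _ _ _)).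
have -> : (fun z => covector (u z) S) =
    (fun z => \sum_j u z 0 j * covector (delta_mx 0 j : 'rV[R]_n) S).
  by apply/funext => z; rewrite {1}covector_delta_sum sum_ffunE; apply: eq_bigr => j _; rewrite ffunE.
rewrite (partial_sum _ d1).2; apply: eq_bigr => j _; rewrite ext_scaleE.
by rewrite (partialZr _ (smooth_derivable i (su 0 j) Ux)).
Qed.

Section StructureEquations.
Variables (m : nat) (G : 'rV[R]_n -> 'M[R]_(m.+1, n)) (d : nat -> seq (int * (nat * nat))).
Hypothesis sG : smooth_mx U G.

Definition se_terms (c : nat) : lform := [seq (t.1, [:: t.2.1; t.2.2]) | t <- d c].

(* d G_c = sum of the v G_a /\ G_b over the terms (v, (a, b)) of d c. *)
Definition structure_equation (c : nat) (y : 'rV[R]_n) : Prop := forall i j,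
  partial i (fun z => G z (inord c) j) y - partial j (fun z => G z (inord c) i) y =
  \sum_(t <- d c) t.1%:~R *
     (G y (inord t.2.1) i * G y (inord t.2.2) j - G y (inord t.2.1) j * G y (inord t.2.2) i).

Lemma smooth_row c : smooth_mx U (fun y => row (inord c) (G y)).
Proof.
move=> i j; rewrite (_ : (fun y => _) = (fun y => G y (inord c) j)); first exact: sG.
by apply/funext => y; rewrite mxE.
Qed.

(** A 2-form sum M_ij dx^i /\ dx^j depends only on the antisymmetric part of M. The structure
    equation says that the coefficient matrices of the two sides differ by a symmetric one. *)
Lemma extd_row c : structure_equation c x ->
  extd (fun y => covector (row (inord c) (G y))) x = leval (G x) (se_terms c).
Proof.
move=> se; rewrite (extd_covector (smooth_row c)).
pose N i j := \sum_(t <- d c) t.1%:~R * (G x (inord t.2.1) i * G x (inord t.2.2) j).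
have -> : leval (G x) (se_terms c) = \sum_i \sum_j N i j *:
    wedge (covector (delta_mx 0 i)) (covector (delta_mx 0 j)).
  rewrite /leval big_map; under [RHS]eq_bigr do under eq_bigr do rewrite scaler_suml.
  under [RHS]eq_bigr do rewrite exchange_big.
  rewrite [RHS]exchange_big; apply: eq_bigr => t _ /=.
  rewrite /mono_wedge /= !row_wedge_cons wedge1r.
  rewrite (covector_delta_sum (row (inord t.2.1) _)) wedge_suml scaler_sumr.
  apply: eq_bigr => i _; rewrite (covector_delta_sum (row (inord t.2.2) _)).
  rewrite wedge_sumr scaler_sumr; apply: eq_bigr => j _.
  by rewrite wedgeZl wedgeZr !scalerA !mxE !mulrA.
apply/eqP; rewrite -subr_eq0 -sumrB; apply/eqP.
rewrite -[RHS](@sum_symmetric_wedge (fun i j =>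
  partial i (fun y => row (inord c) (G y) 0 j) x - N i j)).
  by apply: eq_bigr => i _; rewrite -sumrB; apply: eq_bigr => j _; rewrite scalerBl.
have pE i j : partial i (fun y => row (inord c) (G y) 0 j) x =
    partial i (fun y => G y (inord c) j) x.
  by congr (partial _ _ _); apply/funext => y; rewrite mxE.
move=> i j; rewrite !pE; have := se i j.
have -> : \sum_(t <- d c) t.1%:~R * (G x (inord t.2.1) i * G x (inord t.2.2) j
    - G x (inord t.2.1) j * G x (inord t.2.2) i) = N i j - N j i.
  by rewrite -sumrB; apply: eq_bigr => t _; rewrite mulrBr.
lra.
Qed.

(** The rows of G may outnumber the dimension, so auxiliary 1-forms can be carried along with a
    coframe. *)
Lemma extd_leval p : all (fun t => all (fun c => c < m.+1)%N t.2) p ->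
  (forall c, (c < m.+1)%N -> structure_equation c x) ->
  extd (fun y => leval (G y) p) x = leval (G x) (ldiff se_terms p).
Proof.
move=> Hp se; have sm s : smooth_ext U (fun y => mono_wedge (G y) s).
  exact: smooth_row_wedge.
have key s : all (fun c => c < m.+1)%N s ->
    extd (fun y => mono_wedge (G y) s) x = leval (G x) (ldiff_mono se_terms s).
  elim: s => [_|c s IH /= /andP[cm sm']]; first by rewrite leval_nil; exact: extd_cst.
  have -> : (fun y => mono_wedge (G y) (c :: s)) =
      (fun y => wedge (covector (row (inord c) (G y))) (mono_wedge (G y) s)) by [].
  rewrite extd_covector_wedge //; last exact: smooth_row.
  rewrite IH // extd_row; last exact: se.
  rewrite leval_cat leval_scale !leval_mul !leval1 !scale1r scaleN1r.
  by rewrite /mono_wedge /= row_wedge_cons wedge1r.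
elim: p Hp => [_|[v s] p IH /= /andP[Hs Hp]].
  by rewrite (_ : (fun y => _) = fun=> 0) ?extd_cst ?leval_nil//; apply/funext => y; exact: leval_nil.
have sp : smooth_ext U (fun y => leval (G y) p).
  by apply: smooth_ext_sum => // t _; apply: smooth_extZ => //; exact: smooth_cst.
have -> : (fun y => leval (G y) ((v, s) :: p)) =
    (fun y => v%:~R *: mono_wedge (G y) s + leval (G y) p).
  by apply/funext => y; exact: leval_cons.
have sv : smooth_ext U (fun y => v%:~R *: mono_wedge (G y) s).
  exact: (smooth_extZ oU (smooth_cst v%:~R) (sm s)).
by rewrite (extdD sv sp) (extdZ _ (sm s)) key // IH // /ldiff /= leval_cat leval_scale.
Qed.

End StructureEquations.
End ExteriorDerivative.

(** * Calculus on the cylinder *)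

Section Lines.
Variables (R : numFieldType) (V W X : normedModType R).
Variables (f : V -> X) (g : W -> X) (a v : V) (b w : W).
Hypothesis fg : forall h : R, f (h *: v + a) = g (h *: w + b).

(** Both difference quotients are the same function of h. On coordinate lines of the cylinder this
    reduces partial derivatives to those of the base and of the interval. *)
Lemma eq_line_growth : (fun h : R => h^-1 *: ((f \o shift a) (h *: v) - f a)) =
  (fun h : R => h^-1 *: ((g \o shift b) (h *: w) - g b)).
Proof. by apply/funext => h /=; have := fg 0; rewrite !scale0r !add0r fg => ->. Qed.

Lemma eq_line_derive : 'D_v f a = 'D_w g b.
Proof. by rewrite /derive eq_line_growth. Qed.

Lemma eq_line_derivable : derivable g b w -> derivable f a v.
Proof. by rewrite /derivable eq_line_growth. Qed.

End Lines.

Section CylinderCalculus.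
Variables (R : realType) (n : nat).
Implicit Types (y : 'rV[R]_n.+1) (x : 'rV[R]_n) (t s : R) (F : 'rV[R]_n -> R -> R).

Lemma base_part_cyl x t : base_part (cyl_coord x t) = x.
Proof. by apply/rowP => j; rewrite !mxE liftK. Qed.

Lemma time_part_cyl x t : time_part (cyl_coord x t) = t.
Proof. by rewrite /time_part mxE unlift_none. Qed.

Lemma cyl_coordK y : cyl_coord (base_part y) (time_part y) = y.
Proof.
by apply/rowP => j; rewrite !mxE; case: (unliftP ord_max j) => [a|] ->; rewrite ?mxE.
Qed.

Lemma base_part_line a (h : R) y :
  base_part (h *: delta_mx 0 (lift ord_max a) + y) = h *: delta_mx 0 a + base_part y.
Proof. by apply/rowP => j; rewrite !mxE (inj_eq (@lift_inj _ _)). Qed.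

Lemma time_part_line a (h : R) y :
  time_part (h *: delta_mx 0 (lift ord_max a) + y) = time_part y.
Proof. by rewrite /time_part !mxE (negbTE (neq_lift _ _)) andbF mulr0 add0r. Qed.

Lemma base_part_vertical (h : R) y :
  base_part (h *: delta_mx 0 ord_max + y) = base_part y.
Proof.
by apply/rowP => j; rewrite !mxE [_ == ord_max]eq_sym (negbTE (neq_lift _ _)) andbF mulr0 add0r.
Qed.

Lemma time_part_vertical (h : R) y :
  time_part (h *: delta_mx 0 ord_max + y) = h + time_part y.
Proof. by rewrite /time_part !mxE !eqxx mulr1. Qed.

Lemma partial_cyl_lift F a y :
  partial (lift ord_max a) (fun z => F (base_part z) (time_part z)) y =
  partial a (fun x => F x (time_part y)) (base_part y).
Proof.
by apply: eq_line_derive => h; rewrite base_part_line time_part_line.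
Qed.

Lemma derivable_cyl_lift F a y :
  derivable (fun x => F x (time_part y)) (base_part y) (delta_mx 0 a) ->
  derivable (fun z => F (base_part z) (time_part z)) y (delta_mx 0 (lift ord_max a)).
Proof.
by apply: eq_line_derivable => h; rewrite base_part_line time_part_line.
Qed.

Lemma partial_cyl_max F y :
  partial ord_max (fun z => F (base_part z) (time_part z)) y =
  'D_1 (fun t => F (base_part y) t) (time_part y).
Proof.
apply: eq_line_derive => h; rewrite base_part_vertical time_part_vertical.
by rewrite [h *: 1]mulr1.
Qed.

Lemma derivable_cyl_max F y :
  derivable (fun t => F (base_part y) t) (time_part y) 1 ->
  derivable (fun z => F (base_part z) (time_part z)) y (delta_mx 0 ord_max).
Proof.
apply: eq_line_derivable => h; rewrite base_part_vertical time_part_vertical.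
by rewrite [h *: 1]mulr1.
Qed.

Lemma partial_base_lift (h : 'rV[R]_n -> R) a y :
  partial (lift ord_max a) (fun z => h (base_part z)) y = partial a h (base_part y).
Proof. exact: (partial_cyl_lift (fun x _ => h x)). Qed.

Lemma partial_base_max (h : 'rV[R]_n -> R) y :
  partial ord_max (fun z => h (base_part z)) y = 0.
Proof. by rewrite (partial_cyl_max (fun x _ => h x)) derive_cst. Qed.

Lemma partial_time_lift (k : R -> R) a y :
  partial (lift ord_max a) (fun z => k (time_part z)) y = 0.
Proof. by rewrite (partial_cyl_lift (fun _ t => k t)) partial_cst. Qed.

Lemma partial_time_max (k : R -> R) y :
  partial ord_max (fun z => k (time_part z)) y = 'D_1 k (time_part y).
Proof. exact: (partial_cyl_max (fun _ t => k t)). Qed.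

Lemma base_part_continuous : continuous (@base_part R n).
Proof.
move=> y A [P HP sPA].
exists (fun i j => if unlift ord_max j is Some a then P i a else setT) => [i j|z Hz].
  case: (unliftP ord_max j) => [a|] ->; last exact: filterT.
  by have := HP i a; rewrite mxE (ord1 i).
apply: sPA => i a; have := Hz i (lift ord_max a).
by rewrite liftK mxE (ord1 i).
Qed.

Lemma time_part_continuous : continuous (@time_part R n).
Proof. by move=> y; exact: coord_continuous. Qed.

Definition cyl_set (U : set 'rV[R]_n) (I : set R) : set 'rV[R]_n.+1 :=
  [set y | U (base_part y) /\ I (time_part y)].

Lemma open_cyl_set U I : open U -> open I -> open (cyl_set U I).
Proof.
move=> oU oI; apply: openI.
  by apply: open_comp oU => y _; exact: base_part_continuous.
by apply: open_comp oI => y _; exact: time_part_continuous.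
Qed.

Lemma smooth_base U I h : smooth_on U h -> smooth_on (cyl_set U I) (fun y => h (base_part y)).
Proof.
move=> /smooth_onP Ch; apply/smooth_onP => k; elim: k h Ch => [|k IH] h Ch.
all: apply: Ck_intro => [y [Uy Iy]|k' i // [<-]].
1,2: have [ch dh] := Ck0 (Ch 0) Uy; split=> [|i].
1,3: exact: (continuous_comp (@base_part_continuous y) ch).
1,2: case: (unliftP ord_max i) => [a|] ->.
1,3: exact: (@derivable_cyl_lift (fun x _ => h x)).
1,2: by apply: (@derivable_cyl_max (fun x _ => h x)); exact: derivable_cst.
case: (unliftP ord_max i) => [a|] ->.
  rewrite (_ : partial _ _ = (fun y => partial a h (base_part y))).
    by apply: IH => l; have [_] := Ch l.+1; exact.
  by apply/funext => y; exact: partial_base_lift.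
rewrite (_ : partial _ _ = fun=> 0); first exact: Ck_cst.
by apply/funext => y; exact: partial_base_max.
Qed.

Lemma smooth_time U I (f : R -> R) : open U -> open I ->
  (forall k t, I t -> derivable (derive1n k f : R -> R) t 1) ->
  smooth_on (cyl_set U I) (fun y => f (time_part y)).
Proof.
move=> oU oI df; apply/smooth_onP => k; elim: k f df => [|k IH] f df.
all: apply: Ck_intro => [y [Uy Iy]|k' i // [<-]].
1,2: have d0 := df 0 _ Iy; split=> [|i].
1,3: apply: (@continuous_comp _ _ _ (@time_part R n) f y (@time_part_continuous y)).
1,2: by apply: differentiable_continuous; exact/derivable1_diffP.
1,2: case: (unliftP ord_max i) => [a|] ->.
1,3: by apply: (@derivable_cyl_lift (fun _ t => f t)); exact: derivable_cst.
1,2: exact: (@derivable_cyl_max (fun _ t => f t)).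
case: (unliftP ord_max i) => [a|] ->.
  rewrite (_ : partial _ _ = fun=> 0); first exact: Ck_cst.
  by apply/funext => y; exact: partial_time_lift.
rewrite (_ : partial _ _ = (fun y => f^`() (time_part y))).
  by apply: IH => l t It; rewrite -derive1Sn; exact: df.
by apply/funext => y; rewrite partial_time_max derive1E.
Qed.

Lemma cdom_cylinder (I : set R) (M : atlas R n) (a : chart_index M) :
  @cdom R n.+1 (cylinder I M) a = cyl_set (@cdom R n M a) I.
Proof.
apply/seteqP; split=> [y [[s p] /= dp <-]|y [[p dp py] Iy]].
  split; rewrite ?base_part_cyl ?time_part_cyl; first by exists p.
  exact: set_valP.
exists (SigSub (mem_set Iy), p) => //=.
by rewrite py -[RHS]cyl_coordK; congr cyl_coord; rewrite /set_val /=.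
Qed.

End CylinderCalculus.

(** * The exterior derivative of a warped form *)

Section WarpedForm.
Variables (R : realType) (n : nat) (U : set 'rV[R]_n) (I : set R).
Hypotheses (oU : open U) (oI : open I).
Local Notation B := (base_mx R n).
Local Notation V := (cyl_set U I).

Section Coefficients.
Variables (T : ext R n -> ext R n.+1) (k : R -> R) (w : 'rV[R]_n -> ext R n).
Hypothesis TE : forall a, T a = \sum_A a A *: T (ebasis R A).
Hypothesis sw : smooth_ext U w.
Local Notation F := (fun y => k (time_part y) *: T (w (base_part y))).

(** T stands for a linear map from base forms to cylinder forms, later a |-> B^* a and a |-> B^* a
    /\ dt, where B is the projection to the base. *)
Lemma coefficient_scale_lin (S : {set 'I_n.+1}) :
  (fun y => F y S) = (fun y => k (time_part y) * \sum_A w (base_part y) A * T (ebasis R A) S).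
Proof.
apply/funext => y; rewrite ext_scaleE {1}TE sum_ffunE; congr (_ * _).
by apply: eq_bigr => A _; rewrite ext_scaleE.
Qed.

Lemma partial_ext_base a y : U (base_part y) ->
  partial_ext (lift ord_max a) F y = k (time_part y) *: T (partial_ext a w (base_part y)).
Proof.
move=> Uy; apply/ffunP => S; rewrite ffunE coefficient_scale_lin.
rewrite (partial_cyl_lift (fun x t => k t * \sum_A w x A * T (ebasis R A) S)).
have dwA A : derivable (fun x => w x A * T (ebasis R A) S) (base_part y) (delta_mx 0 a).
  exact: (derivableM (smooth_derivable a (sw A) Uy) (derivable_cst _ _ _)).
have [dS pS] := partial_sum (index_enum {set 'I_n}) dwA.
rewrite (partialZ _ dS) pS ext_scaleE {1}TE sum_ffunE; congr (_ * _).
apply: eq_bigr => A _; rewrite ext_scaleE [partial_ext _ _ _ _]ffunE.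
by rewrite (partialZr _ (smooth_derivable a (sw A) Uy)).
Qed.

Lemma partial_ext_time y : derivable k (time_part y) 1 ->
  partial_ext ord_max F y = 'D_1 k (time_part y) *: T (w (base_part y)).
Proof.
move=> dk; apply/ffunP => S; rewrite ffunE coefficient_scale_lin.
rewrite (partial_cyl_max (fun x t => k t * \sum_A w x A * T (ebasis R A) S)).
have -> : (fun t => k t * \sum_A w (base_part y) A * T (ebasis R A) S) =
    T (w (base_part y)) S \o* k.
  apply/funext => t /=; congr (_ * _); rewrite [in RHS]TE sum_ffunE.
  by apply: eq_bigr => A _; rewrite ext_scaleE.
by rewrite deriveMr // ext_scaleE mulrC.
Qed.

End Coefficients.

Lemma lin_pull_base a : pull B a = \sum_A a A *: pull B (ebasis R A).
Proof. by rewrite {1}(ext_basis a) pull_sum; apply: eq_bigr => A _; rewrite pullZ. Qed.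

Lemma lin_pull_base_dt a : wedge (pull B a) (dt R n) =
  \sum_A a A *: wedge (pull B (ebasis R A)) (dt R n).
Proof.
by rewrite {1}lin_pull_base wedge_suml; apply: eq_bigr => A _; rewrite wedgeZl.
Qed.

Lemma pull_base_extd (w : 'rV[R]_n -> ext R n) x :
  \sum_a wedge (covector (delta_mx 0 (lift ord_max a))) (pull B (partial_ext a w x)) =
  pull B (extd w x).
Proof.
rewrite extdE pull_sum; apply: eq_bigr => a _.
by rewrite pull_covector_wedge -rowE row_base_mx.
Qed.

Lemma extd_scale_base (k : R -> R) w y : smooth_ext U w ->
  U (base_part y) -> derivable k (time_part y) 1 ->
  extd (fun z => k (time_part z) *: pull B (w (base_part z))) y =
  k (time_part y) *: pull B (extd w (base_part y))
  + 'D_1 k (time_part y) *: wedge (dt R n) (pull B (w (base_part y))).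
Proof.
move=> sw Uy dk; rewrite extdE sum_lift_max (partial_ext_time _ lin_pull_base) // wedgeZr.
congr (_ + _); rewrite -pull_base_extd scaler_sumr; apply: eq_bigr => a _.
by rewrite (partial_ext_base _ lin_pull_base sw) // wedgeZr.
Qed.

(** The derivative of k contributes nothing, because dt occurs twice in that term. *)
Lemma extd_scale_base_dt (k : R -> R) d w y : smooth_ext U w ->
  homogeneous d (w (base_part y)) ->
  U (base_part y) -> derivable k (time_part y) 1 ->
  extd (fun z => k (time_part z) *: wedge (pull B (w (base_part z))) (dt R n)) y =
  k (time_part y) *: wedge (pull B (extd w (base_part y))) (dt R n).
Proof.
move=> sw hw Uy dk; rewrite extdE sum_lift_max (partial_ext_time _ lin_pull_base_dt) //.
rewrite /dt (wedge_covector_sign _ (homogeneous_pull B hw)) !wedgeZr wedgeA.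
rewrite wedge_covector_sqr wedge0l !scaler0 addr0 -/(dt R n).
rewrite -pull_base_extd wedge_suml scaler_sumr; apply: eq_bigr => a _.
by rewrite (partial_ext_base _ lin_pull_base_dt sw) // wedgeZr wedgeA.
Qed.

Lemma smooth_ext_base (w : 'rV[R]_n -> ext R n) : smooth_ext U w ->
  smooth_ext V (fun y => w (base_part y)).
Proof. by move=> sw S; exact: (smooth_base (sw S)). Qed.

End WarpedForm.

Section WarpedTorsion.
Variables (R : realType) (U : set 'rV[R]_7) (I : set R).
Hypotheses (oU : open U) (oI : open I).
Local Notation B := (base_mx R 7).

Lemma extd_warped (f : R -> R) (phi psi : 'rV[R]_7 -> ext R 7) y :
  smooth_ext U phi -> smooth_ext U psi -> homogeneous 3 (phi (base_part y)) ->
  (forall k t, I t -> derivable (derive1n k f : R -> R) t 1) -> cyl_set U I y ->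
  extd (fun z => f (time_part z) ^+ 3 *: wedge (pull B (phi (base_part z))) (dt R 7)
       + f (time_part z) ^+ 4 *: pull B (psi (base_part z))) y =
  (4%:R * f (time_part y) ^+ 3 * 'D_1 f (time_part y))
     *: wedge (dt R 7) (pull B (psi (base_part y)))
  + f (time_part y) ^+ 3 *: wedge (pull B (extd phi (base_part y))) (dt R 7)
  + f (time_part y) ^+ 4 *: pull B (extd psi (base_part y)).
Proof.
move=> sphi spsi hphi df [Uy Iy]; have oV := open_cyl_set oU oI.
have sf k : smooth_on (cyl_set U I) (fun y => f (time_part y) ^+ k).
  exact/smoothX/smooth_time.
have dfk k : derivable (fun t => f t ^+ k) (time_part y) 1.
  by have : derivable (f ^+ k) (time_part y) 1 := derivableX (df 0 _ Iy); rewrite exprfctE.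
have sB m : smooth_mx (cyl_set U I) (fun=> base_mx R m) by move=> i j; exact: smooth_cst.
have s1 : smooth_ext (cyl_set U I) (fun z => f (time_part z) ^+ 3 *:
    wedge (pull B (phi (base_part z))) (dt R 7)).
  apply: (smooth_extZ oV (sf 3)); apply: smooth_wedge => //; last exact: smooth_ext_cst.
  by apply: smooth_pull => //; exact: smooth_ext_base.
have s2 : smooth_ext (cyl_set U I) (fun z => f (time_part z) ^+ 4 *: pull B (psi (base_part z))).
  apply: (smooth_extZ oV (sf 4)).
  by apply: smooth_pull => //; exact: smooth_ext_base.
have Vy : cyl_set U I y by split.
rewrite (extdD Vy s1 s2).
rewrite (extd_scale_base_dt sphi hphi Uy (dfk 3)) (extd_scale_base spsi Uy (dfk 4)).
have -> : 'D_1 (fun t => f t ^+ 4) (time_part y) =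
    4%:R * f (time_part y) ^+ 3 * 'D_1 f (time_part y).
  by have := deriveX 4 (df 0%N _ Iy); rewrite exprfctE.
by rewrite addrA addrC addrA.
Qed.

End WarpedTorsion.

(** * The Ricci tensor of a warped metric *)

Section LocalCurvature.
Variables (R : realType) (n : nat) (V : set 'rV[R]_n) (g h : 'rV[R]_n -> 'M[R]_n).
Hypotheses (oV : open V) (gh : forall y, V y -> g y = h y).

Lemma eq_christoffel k i j y : V y -> christoffel g k i j y = christoffel h k i j y.
Proof.
move=> Vy; congr (_ * _); apply: eq_bigr => l _; rewrite gh //.
have E a b c : partial a (fun z => g z b c) y = partial a (fun z => h z b c) y.
  by apply: (eq_partial a oV Vy) => z /gh ->.
by rewrite !E.
Qed.

Lemma eq_ricci y : V y -> ricci g y = ricci h y.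
Proof.
move=> Vy; apply/matrixP => i j; rewrite !mxE; apply: eq_bigr => k _.
have E a b c d : partial a (christoffel g b c d) y = partial a (christoffel h b c d) y.
  by apply: (eq_partial a oV Vy) => z; exact: eq_christoffel.
by rewrite !E; congr (_ + _); apply: eq_bigr => l _; rewrite !eq_christoffel.
Qed.

End LocalCurvature.

Section WarpedRicci.
Variables (R : realType) (n : nat) (U : set 'rV[R]_n) (I : set R).
Variables (g : 'rV[R]_n -> 'M[R]_n) (f f1 f2 : R -> R).
Hypotheses (oU : open U) (oI : open I) (sg : smooth_mx U g).
Hypothesis symg : forall x, U x -> (g x)^T = g x.
Hypothesis unitg : forall x, U x -> g x \in unitmx.
Hypothesis df : forall t, I t -> is_derive t 1 f (f1 t).
Hypothesis df1 : forall t, I t -> is_derive t 1 f1 (f2 t).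
Hypothesis f0 : forall t, I t -> f t != 0.

Local Notation V := (cyl_set U I).
Local Notation L := (@lift n.+1 ord_max : 'I_n -> 'I_n.+1).
Local Notation T := ord_max.

Definition warped_metric (y : 'rV[R]_n.+1) : 'M[R]_n.+1 :=
  warp_frame (f (time_part y) ^+ 2) (g (base_part y)).

Local Notation G := warped_metric.

Let entry_LL a b : (fun y => G y (L a) (L b)) =
  (fun y => f (time_part y) ^+ 2 * g (base_part y) a b).
Proof. by apply/funext => y; rewrite mxE !liftK. Qed.

Let entry_LT a : (fun y => G y (L a) T) = fun=> 0.
Proof. by apply/funext => y; rewrite mxE liftK unlift_none. Qed.

Let entry_TL a : (fun y => G y T (L a)) = fun=> 0.
Proof. by apply/funext => y; rewrite mxE liftK unlift_none. Qed.

Let entry_TT : (fun y => G y T T) = fun=> 1.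
Proof. by apply/funext => y; rewrite mxE unlift_none. Qed.

Let partial_LLL a b c y : V y ->
  partial (L c) (fun y => G y (L a) (L b)) y =
  f (time_part y) ^+ 2 * partial c (fun x => g x a b) (base_part y).
Proof.
move=> [Uy Iy]; rewrite entry_LL (partial_cyl_lift (fun x t => f t ^+ 2 * g x a b)).
exact: (partialZ _ (smooth_derivable c (sg a b) Uy)).
Qed.

Let partial_TLL a b y : V y ->
  partial T (fun y => G y (L a) (L b)) y =
  2%:R * f (time_part y) * f1 (time_part y) * g (base_part y) a b.
Proof.
move=> [Uy Iy]; rewrite entry_LL (partial_cyl_max (fun x t => f t ^+ 2 * g x a b)).
have d2 : is_derive (time_part y) 1 (f ^+ 2) ((2%:R * f (time_part y)) *: f1 (time_part y)).
  by have := df Iy => dfy; apply: is_derive_eq; rewrite expr1.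
rewrite (_ : (fun t => _) = g (base_part y) a b \o* (f ^+ 2)).
  by rewrite deriveMr; [rewrite derive_val mulrC | exact: ex_derive].
by apply/funext => t; rewrite /= exprfctE.
Qed.

Let inv_G y : V y -> invmx (G y) = warp_frame (f (time_part y) ^- 2) (invmx (g (base_part y))).
Proof.
by move=> [Uy Iy]; rewrite invmx_warp_frame ?expf_neq0 ?f0// unitg.
Qed.

Let entryE := (entry_LT, entry_TL, entry_TT).

(** Indices split into [L a] on the base and [T] for time. The only nonzero families are the symbols
    of g, then -f f' g_ab for upper index T, and f'/f times delta for one lower index T and an upper
    base index. *)
Lemma christoffel_warp_LLL c a b y : V y ->
  christoffel G (L c) (L a) (L b) y = christoffel g c a b (base_part y).
Proof.
move=> Vy; congr (_ * _); rewrite sum_lift_max inv_G // [X in _ + X](_ : _ = 0).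
  rewrite addr0; apply: eq_bigr => d _; rewrite !partial_LLL // mxE !liftK.
  have f0y : f (time_part y) != 0 by case: Vy => _ /f0.
  by field.
by rewrite mxE liftK unlift_none mul0r.
Qed.

Lemma christoffel_warp_TLL a b y : V y ->
  christoffel G T (L a) (L b) y = - (f (time_part y) * f1 (time_part y)) * g (base_part y) a b.
Proof.
move=> Vy; rewrite /christoffel sum_lift_max inv_G // big1 => [|d _].
  rewrite !entryE !partial_cst partial_TLL // mxE !unlift_none.
  by field.
by rewrite mxE liftK unlift_none mul0r.
Qed.

Lemma christoffel_warp_TLT a y : V y -> christoffel G T (L a) T y = 0.
Proof.
move=> Vy; rewrite /christoffel sum_lift_max inv_G // big1 => [|d _].
  by rewrite !entryE !partial_cst !(addr0, subr0, mulr0).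
by rewrite mxE liftK unlift_none mul0r.
Qed.

Lemma christoffel_warp_TTL a y : V y -> christoffel G T T (L a) y = 0.
Proof.
move=> Vy; rewrite /christoffel sum_lift_max inv_G // big1 => [|d _].
  by rewrite !entryE !partial_cst !(addr0, subr0, mulr0).
by rewrite mxE liftK unlift_none mul0r.
Qed.

Lemma christoffel_warp_TTT y : V y -> christoffel G T T T y = 0.
Proof.
move=> Vy; rewrite /christoffel sum_lift_max inv_G // big1 => [|d _].
  by rewrite !entryE !partial_cst !(addr0, subr0, mulr0).
by rewrite mxE liftK unlift_none mul0r.
Qed.

Let inv_delta c a x : U x -> \sum_d invmx (g x) c d * g x a d = (c == a)%:R.
Proof.
move=> Ux; transitivity ((invmx (g x) *m (g x)^T) c a).
  by rewrite mxE; apply: eq_bigr => d _; rewrite mxE.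
by rewrite symg // mulVmx ?unitg// mxE.
Qed.

Lemma christoffel_warp_LLT c a y : V y ->
  christoffel G (L c) (L a) T y = f1 (time_part y) / f (time_part y) * (c == a)%:R.
Proof.
move=> Vy; have f0y : f (time_part y) != 0 by case: Vy => _ /f0.
rewrite /christoffel sum_lift_max inv_G // [X in _ + X](_ : _ = 0); last first.
  by rewrite mxE liftK unlift_none mul0r.
rewrite addr0 -(inv_delta c a Vy.1) !mulr_sumr; apply: eq_bigr => d _.
rewrite !entryE !partial_cst partial_TLL // mxE !liftK.
by field.
Qed.

Lemma christoffel_warp_LTL c a y : V y ->
  christoffel G (L c) T (L a) y = f1 (time_part y) / f (time_part y) * (c == a)%:R.
Proof.
move=> Vy; have f0y : f (time_part y) != 0 by case: Vy => _ /f0.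
rewrite /christoffel sum_lift_max inv_G // [X in _ + X](_ : _ = 0); last first.
  by rewrite mxE liftK unlift_none mul0r.
rewrite addr0 -(inv_delta c a Vy.1) !mulr_sumr; apply: eq_bigr => d _.
rewrite !entryE !partial_cst partial_TLL // mxE !liftK.
by field.
Qed.

Lemma christoffel_warp_LTT c y : V y -> christoffel G (L c) T T y = 0.
Proof.
move=> Vy; rewrite /christoffel sum_lift_max inv_G // [X in _ + X](_ : _ = 0); last first.
  by rewrite mxE liftK unlift_none mul0r.
rewrite addr0 big1 ?mulr0 // => d _.
by rewrite !entryE !partial_cst !(addr0, subr0, mulr0).
Qed.

Lemma christoffel_sym c a b x : U x -> christoffel g c a b x = christoffel g c b a x.
Proof.
move=> Ux; congr (_ * _); apply: eq_bigr => d _; congr (_ * _).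
have -> : partial d (fun y => g y a b) x = partial d (fun y => g y b a) x.
  by apply: (eq_partial d oU Ux) => y /symg E; rewrite -{1}E mxE.
by rewrite [X in X - _]addrC.
Qed.

Let chrE := (christoffel_warp_LLL, christoffel_warp_TLL, christoffel_warp_TLT,
  christoffel_warp_TTL, christoffel_warp_TTT, christoffel_warp_LLT,
  christoffel_warp_LTL, christoffel_warp_LTT).

Let oV : open V := open_cyl_set oU oI.

Let partial_chr0 i k a b y : V y -> (forall z, V z -> christoffel G k a b z = 0) ->
  partial i (christoffel G k a b) y = 0.
Proof.
move=> Vy E; rewrite (eq_partial i oV Vy (g := fun=> 0)) ?partial_cst//.
Qed.

Let partial_ratio y : V y ->
  'D_1 (fun t => f1 t / f t) (time_part y) =
  f2 (time_part y) / f (time_part y) - (f1 (time_part y) / f (time_part y)) ^+ 2.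
Proof.
move=> [_ Iy]; have f0y := f0 Iy; have [d0 e0] := df Iy; have [d1 e1] := df1 Iy.
have E := deriveM d1 (derivableV f0y d0).
rewrite (deriveV f0y d0) e0 e1 in E.
transitivity ('D_1 (f1 * (fun t => (f t)^-1)) (time_part y)); first by [].
by rewrite E /GRing.scale /=; field.
Qed.

Let derivable_ratio y : V y -> derivable (fun t => f1 t / f t) (time_part y) 1.
Proof.
move=> [_ Iy]; have f0y := f0 Iy; have [d0 _] := df Iy; have [d1 _] := df1 Iy.
exact: (derivableM d1 (derivableV f0y d0)).
Qed.

Let partial_T_ratio (chr : 'rV[R]_n.+1 -> R) (c a : 'I_n) y : V y ->
  (forall z, V z -> chr z = f1 (time_part z) / f (time_part z) * (c == a)%:R) ->
  partial T chr y =
  (f2 (time_part y) / f (time_part y) - (f1 (time_part y) / f (time_part y)) ^+ 2) * (c == a)%:R.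
Proof.
move=> Vy chrV; rewrite -partial_ratio // (eq_partial _ oV Vy chrV).
rewrite (partial_cyl_max (fun _ t => f1 t / f t * (c == a)%:R)).
rewrite -[LHS]/('D_1 ((c == a)%:R \o* (fun t => f1 t / f t)) (time_part y)).
by rewrite (deriveMr _ (derivable_ratio Vy)) mulrC.
Qed.

Let partial_L_ratio (chr : 'rV[R]_n.+1 -> R) (c a b : 'I_n) y : V y ->
  (forall z, V z -> chr z = f1 (time_part z) / f (time_part z) * (c == a)%:R) ->
  partial (L b) chr y = 0.
Proof.
move=> Vy chrV; rewrite (eq_partial _ oV Vy chrV).
exact: (partial_time_lift (fun t => f1 t / f t * (c == a)%:R)).
Qed.

Let partial_L_base (chr : 'rV[R]_n.+1 -> R) (h : 'rV[R]_n -> R) b y : V y ->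
  (forall z, V z -> chr z = h (base_part z)) ->
  partial (L b) chr y = partial b h (base_part y).
Proof. by move=> Vy chrV; rewrite (eq_partial _ oV Vy chrV) partial_base_lift. Qed.

Let partial_T_base (chr : 'rV[R]_n.+1 -> R) (h : 'rV[R]_n -> R) y : V y ->
  (forall z, V z -> chr z = h (base_part z)) -> partial T chr y = 0.
Proof. by move=> Vy chrV; rewrite (eq_partial _ oV Vy chrV) partial_base_max. Qed.

Let partial_TTLL a b y : V y ->
  partial T (christoffel G T (L a) (L b)) y =
  - (f1 (time_part y) ^+ 2 + f (time_part y) * f2 (time_part y)) * g (base_part y) a b.
Proof.
move=> Vy; have [_ Iy] := Vy; have [d0 e0] := df Iy; have [d1 e1] := df1 Iy.
rewrite (eq_partial _ oV Vy (fun z Vz => christoffel_warp_TLL a b Vz)).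
rewrite (partial_cyl_max (fun x t => - (f t * f1 t) * g x a b)).
have dp := derivableM d0 d1; have E := deriveM d0 d1; rewrite e0 e1 in E.
have EN := deriveN dp; rewrite E in EN.
have EM := deriveMr (g (base_part y) a b) (derivableN dp); rewrite EN in EM.
transitivity ('D_1 (g (base_part y) a b \o* (- (f * f1))) (time_part y)); first by [].
by rewrite EM /GRing.scale /=; ring.
Qed.

Lemma ricci_warp_TT y : V y ->
  ricci G y T T = - (n%:R * (f2 (time_part y) / f (time_part y))).
Proof.
move=> Vy; rewrite mxE sum_lift_max [X in _ + X](_ : _ = 0).
  rewrite addr0 (eq_bigr (fun=> - (f2 (time_part y) / f (time_part y)))).
    by rewrite sumr_const card_ord mulNrn mulr_natl.
  move=> c _; rewrite (partial_chr0 _ Vy (fun z Vz => christoffel_warp_LTT c Vz)).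
  rewrite (partial_T_ratio Vy (fun z Vz => christoffel_warp_LTL c c Vz)) eqxx sum_lift_max.
  rewrite !chrE // (bigD1 c) //= !chrE // eqxx big1 => [|d dc].
    by rewrite !mulr1; ring.
  by rewrite !chrE // (negbTE dc) eq_sym (negbTE dc) !(mulr0, mul0r); ring.
rewrite !(partial_chr0 _ Vy christoffel_warp_TTT) sum_lift_max big1 => [|d _].
  by rewrite !chrE //; ring.
by rewrite !chrE //; ring.
Qed.

(** All derivative terms vanish, and the quadratic ones leave f'/f times Gamma^c_ca - Gamma^c_ac,
    summed over c, which is 0 by symmetry. *)
Lemma ricci_warp_LT a y : V y -> ricci G y (L a) T = 0.
Proof.
move=> Vy; rewrite mxE sum_lift_max [X in _ + X](_ : _ = 0); last first.
  rewrite !(partial_chr0 _ Vy (fun z Vz => christoffel_warp_TLT a Vz)) sum_lift_max.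
  by rewrite big1 => [|d _]; rewrite !chrE //; ring.
rewrite addr0; pose q := f1 (time_part y) / f (time_part y).
rewrite (eq_bigr (fun c => q * christoffel g c c a (base_part y)
   - q * christoffel g c a c (base_part y))).
  rewrite big1 // => c _; rewrite (christoffel_sym c a c Vy.1); ring.
move=> c _; rewrite (partial_L_ratio c Vy (fun z Vz => christoffel_warp_LLT c a Vz)).
rewrite (partial_T_base Vy (fun z Vz => christoffel_warp_LLL c a c Vz)).
rewrite sum_lift_max !chrE // !(mulr0, mul0r) !subr0 addr0 add0r (eq_bigr (fun d =>
   (d == a)%:R * (q * christoffel g c c d (base_part y)) -
   (c == d)%:R * (q * christoffel g d a c (base_part y)))) => [|d _]; last first.
  by rewrite !chrE // /q; ring.
rewrite sumrB (bigD1 a) //= eqxx big1 => [|d /negbTE ->]; last by rewrite mul0r.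
rewrite (bigD1 c) //= eqxx big1 => [|d dc]; last first.
  by rewrite eq_sym (negbTE dc) mul0r.
by rewrite !mul1r !addr0.
Qed.

Lemma ricci_warp_TL a y : V y -> ricci G y T (L a) = 0.
Proof.
move=> Vy; rewrite mxE sum_lift_max [X in _ + X](_ : _ = 0); last first.
  rewrite (partial_chr0 _ Vy (fun z Vz => christoffel_warp_TTL a Vz)).
  rewrite (partial_chr0 _ Vy christoffel_warp_TTT) sum_lift_max.
  by rewrite big1 => [|d _]; rewrite !chrE //; ring.
rewrite addr0; pose q := f1 (time_part y) / f (time_part y).
rewrite (eq_bigr (fun c => q * christoffel g c c a (base_part y)
   - q * christoffel g c a c (base_part y))).
  rewrite big1 // => c _; rewrite (christoffel_sym c a c Vy.1); ring.
move=> c _; rewrite (partial_L_ratio c Vy (fun z Vz => christoffel_warp_LTL c a Vz)).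
rewrite (partial_L_ratio a Vy (fun z Vz => christoffel_warp_LTL c c Vz)).
rewrite sum_lift_max !chrE // !(mulr0, mul0r) !subr0 addr0 add0r (eq_bigr (fun d =>
   (d == a)%:R * (q * christoffel g c c d (base_part y)) -
   (c == d)%:R * (q * christoffel g c a d (base_part y)))) => [|d _]; last first.
  by rewrite !chrE // [c == d]eq_sym /q; ring.
rewrite sumrB (bigD1 a) //= eqxx big1 => [|d /negbTE ->]; last by rewrite mul0r.
rewrite (bigD1 c) //= eqxx big1 => [|d dc]; last first.
  by rewrite eq_sym (negbTE dc) mul0r.
by rewrite !mul1r !addr0.
Qed.

Lemma ricci_warp_LL a b y : V y ->
  ricci G y (L a) (L b) = ricci g (base_part y) a b
   - ((n%:R - 1) * f1 (time_part y) ^+ 2 + f (time_part y) * f2 (time_part y))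
     * g (base_part y) a b.
Proof.
move=> Vy; have f0y : f (time_part y) != 0 by case: Vy => _ /f0.
rewrite mxE sum_lift_max [X in _ + X](_ : _ =
   - (f (time_part y) * f2 (time_part y)) * g (base_part y) a b); last first.
  rewrite partial_TTLL // (partial_chr0 _ Vy (fun z Vz => christoffel_warp_TLT a Vz)).
  rewrite sum_lift_max !chrE // (bigD1 a) //= !chrE // eqxx big1 => [|d /negbTE da]; last first.
    by rewrite !chrE // da !(mulr0, mul0r); ring.
  have -> : g (base_part y) b a = g (base_part y) a b by rewrite -{1}(symg Vy.1) mxE.
  by rewrite !mulr1; field.
pose x := base_part y; pose k2 := f1 (time_part y) ^+ 2.
rewrite (eq_bigr (fun c : 'I_n => (partial c (christoffel g c a b) x
    - partial b (christoffel g c a c) x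
    + \sum_d (christoffel g c c d x * christoffel g d a b x
              - christoffel g c b d x * christoffel g d a c x))
    + (- k2 * g x a b + (c == b)%:R * (k2 * g x a c)))) => [|c _]; last first.
  rewrite (partial_L_base c Vy (fun z Vz => christoffel_warp_LLL c a b Vz)).
  rewrite (partial_L_base b Vy (fun z Vz => christoffel_warp_LLL c a c Vz)).
  rewrite sum_lift_max !chrE // addrA; congr (_ + _ + _).
    by apply: eq_bigr => d _; rewrite !chrE.
  by rewrite eqxx mulr1 /k2 /x; field.
rewrite big_split /= [\sum_(c < n) (partial _ _ _ - _ + _)](_ : _ = ricci g x a b); last by rewrite mxE.
rewrite -addrA; congr (_ + _); rewrite big_split /= sumr_const card_ord.
rewrite (bigD1 b) //= eqxx big1 => [|d /negbTE ->]; last by rewrite mul0r.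
by rewrite mul1r -mulr_natl /k2 /x; ring.
Qed.

(** On the base block, f'^2 = 1 - c f^2 and f'' = -c f turn (n - 1) (1 - f'^2) - f f'' into n c f^2,
    the factor f^2 being that of the metric. *)
Lemma ricci_warp c y : V y ->
  (forall x, U x -> ricci g x = (n%:R - 1) *: g x) ->
  f2 (time_part y) = - c * f (time_part y) ->
  f1 (time_part y) ^+ 2 + c * f (time_part y) ^+ 2 = 1 ->
  ricci G y = (n%:R * c) *: G y.
Proof.
move=> Vy ricg f2E f1E; have f0y : f (time_part y) != 0 by case: Vy => _ /f0.
apply/matrixP => i j; rewrite [RHS]mxE.
case: (unliftP T i) => [a|] ->; case: (unliftP T j) => [b|] ->.
- rewrite ricci_warp_LL // ricg ?mxE ?liftK; last by case: Vy.
  have -> : f1 (time_part y) ^+ 2 = 1 - c * f (time_part y) ^+ 2 by rewrite -f1E addrK.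
  by rewrite f2E; ring.
- by rewrite ricci_warp_LT // mxE liftK unlift_none mulr0.
- by rewrite ricci_warp_TL // mxE liftK unlift_none mulr0.
- by rewrite ricci_warp_TT // mxE unlift_none f2E; field.
Qed.

End WarpedRicci.

(** * The Ricci tensor in a moving frame *)

Section MovingFrames.
Local Opaque partial.
Variables (R : realType) (n : nat) (U : set 'rV[R]_n).
Variables (E : 'rV[R]_n -> 'M[R]_n) (om : 'I_n -> 'rV[R]_n -> 'M[R]_n).
Hypotheses (oU : open U) (sE : smooth_mx U E) (som : forall i, smooth_mx U (om i)).
Hypothesis uE : forall x, U x -> E x \in unitmx.
Hypothesis anti_om : forall i x, U x -> (om i x)^T = - om i x.

Definition partial_mx p q (k : 'I_n) (A : 'rV[R]_n -> 'M[R]_(p, q)) (x : 'rV[R]_n) : 'M[R]_(p, q) :=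
  \matrix_(i, j) partial k (fun y => A y i j) x.

(** The covariant derivative of the coframe. Its symmetry in the two coordinate indices,
    [torsion_free] below, is the first structure equation de + om /\ e = 0. *)
Definition covariant_mx (i : 'I_n) (x : 'rV[R]_n) : 'M[R]_n :=
  partial_mx i E x + om i x *m E x.

Lemma covariant_mxE i x a j : covariant_mx i x a j =
  partial i (fun y => E y a j) x + (om i x *m E x) a j.
Proof. by rewrite /covariant_mx mxE [partial_mx _ _ _ _ _]mxE. Qed.

Hypothesis torsion_free : forall i j a x, U x -> covariant_mx i x a j = covariant_mx j x a i.
Hypothesis schwarz : forall i j a b x, U x ->
  partial i (partial j (fun y => E y a b)) x = partial j (partial i (fun y => E y a b)) x.

Lemma smooth_partial_mx p q k (A : 'rV[R]_n -> 'M[R]_(p, q)) :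
  smooth_mx U A -> smooth_mx U (partial_mx k A).
Proof.
move=> sA i j; rewrite (_ : (fun x => _) = partial k (fun y => A y i j)).
  exact/smooth_partial/sA.
by apply/funext => x; rewrite mxE.
Qed.

Lemma partial_mx2E p q k j (A : 'rV[R]_n -> 'M[R]_(p, q)) x a b :
  partial_mx k (partial_mx j A) x a b = partial k (partial j (fun y => A y a b)) x.
Proof.
have -> : partial j (fun y => A y a b) = (fun y => partial_mx j A y a b).
  by apply/funext => y; rewrite mxE.
by rewrite mxE.
Qed.

Lemma partial_mxD p q k (A B : 'rV[R]_n -> 'M[R]_(p, q)) x :
  smooth_mx U A -> smooth_mx U B -> U x ->
  partial_mx k (fun y => A y + B y) x = partial_mx k A x + partial_mx k B x.
Proof.
move=> sA sB Ux; apply/matrixP => i j; rewrite !mxE.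
rewrite -(partialD (smooth_derivable k (sA i j) Ux) (smooth_derivable k (sB i j) Ux)).
have -> : (fun y => (A y + B y) i j) = (fun y => A y i j + B y i j).
  by apply/funext => y; rewrite mxE.
by [].
Qed.

Lemma partial_mxM p q r k (A : 'rV[R]_n -> 'M[R]_(p, q)) (B : 'rV[R]_n -> 'M[R]_(q, r)) x :
  smooth_mx U A -> smooth_mx U B -> U x ->
  partial_mx k (fun y => A y *m B y) x = partial_mx k A x *m B x + A x *m partial_mx k B x.
Proof.
move=> sA sB Ux; apply/matrixP => i j; rewrite !mxE -big_split /=.
have dAB c := derivableM (smooth_derivable k (sA i c) Ux) (smooth_derivable k (sB c j) Ux).
rewrite (_ : (fun y => _) = (fun y => \sum_c A y i c * B y c j)); last first.
  by apply/funext => y; rewrite mxE.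
rewrite (partial_sum _ dAB).2; apply: eq_bigr => c _; rewrite !mxE.
rewrite (partialM (smooth_derivable k (sA i c) Ux) (smooth_derivable k (sB c j) Ux)).
by ring.
Qed.

Local Notation g := (fun x => (E x)^T *m E x).
Local Notation F := (fun x => invmx (E x)).
Local Notation D := covariant_mx.

(** The connection om transported from the frame to the coordinates, E^-1 (d_j E + om_j E). *)
Definition frame_connection (j : 'I_n) (x : 'rV[R]_n) : 'M[R]_n := invmx (E x) *m D j x.

Local Notation Gam := frame_connection.

Let smooth_D j : smooth_mx U (D j).
Proof.
move=> a b; rewrite (_ : (fun x => _) = (fun x => partial_mx j E x a b + (om j x *m E x) a b)).
  exact: (smoothD oU (smooth_partial_mx j sE a b) (smooth_mxM oU (som j) sE a b)).
by apply/funext => x; rewrite mxE.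
Qed.

(** Since om is antisymmetric, E^T om E and its transpose cancel, and derivatives of E may be
    replaced by covariant ones. *)
Lemma partial_metric l i j x : U x ->
  partial l (fun y => g y i j) x = \sum_a (D l x a i * E x a j + E x a i * D l x a j).
Proof.
move=> Ux; have sET : smooth_mx U (fun y => (E y)^T) := smooth_mx_tr sE.
have := partial_mxM l sET sE Ux => /matrixP/(_ i j); rewrite mxE => ->.
have -> : partial_mx l (fun y => (E y)^T) x = (partial_mx l E x)^T.
  by apply/matrixP => a b; rewrite !mxE; congr (partial _ _ _); apply/funext => y; rewrite mxE.
have -> : partial_mx l E x = D l x - om l x *m E x by rewrite addrK.
have anti : ((om l x *m E x)^T *m E x) + (E x)^T *m (om l x *m E x) = 0.
  by rewrite trmx_mul anti_om // mulmxN mulNmx -mulmxA addNr.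
rewrite linearB /= mulmxBl mulmxBr addrACA -opprD anti subr0 mxE big_split /=.
by congr (_ + _); rewrite mxE; apply: eq_bigr => a _; rewrite mxE.
Qed.

(** The Levi-Civita connection is the only metric torsion-free one: of the six terms that
    [partial_metric] gives, [torsion_free] cancels four and makes the other two equal. *)
Lemma christoffel_frame k i j x : U x -> christoffel g k i j x = Gam j x k i.
Proof.
move=> Ux; have -> : Gam j x k i = Gam i x k j.
  by rewrite /frame_connection !mxE; apply: eq_bigr => a _; rewrite torsion_free.
have kos l : partial i (fun y => g y j l) x + partial j (fun y => g y i l) x
    - partial l (fun y => g y i j) x = 2%:R * \sum_a D i x a j * E x a l.
  rewrite !partial_metric // mulr_sumr -big_split -sumrB; apply: eq_bigr => a _ /=.
  rewrite (torsion_free i l) // (torsion_free j l) // (torsion_free j i) //.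
  by ring.
rewrite /christoffel; under eq_bigr do rewrite kos mulrCA.
rewrite -mulr_sumr mulrA mulVf ?pnatr_eq0// mul1r.
transitivity ((invmx (g x) *m ((E x)^T *m D i x)) k j).
  rewrite mxE; apply: eq_bigr => l _; congr (_ * _); rewrite mxE.
  by apply: eq_bigr => a _; rewrite [(E x)^T l a]mxE mulrC.
congr (fun_of_matrix _ k j); rewrite /frame_connection mulmxA; congr (_ *m _).
rewrite -[LHS]mulmx1 -(mulmxV (uE Ux)) mulmxA -(mulmxA (invmx _)) mulVmx ?mul1mx //.
by rewrite unitmx_mul unitmx_tr uE.
Qed.

(** The components of d om + om /\ om. *)
Definition curvature_form (k j : 'I_n) (x : 'rV[R]_n) : 'M[R]_n :=
  partial_mx k (om j) x - partial_mx j (om k) x + om k x *m om j x - om j x *m om k x.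

Let smooth_Gam j : smooth_mx U (Gam j).
Proof. exact: (smooth_mxM oU (smooth_invmx oU uE sE) (smooth_D j)). Qed.

Let partial_D k j x : U x -> partial_mx k (D j) x =
  partial_mx k (partial_mx j E) x + (partial_mx k (om j) x *m E x + om j x *m partial_mx k E x).
Proof.
move=> Ux; rewrite (partial_mxD k (smooth_partial_mx j sE) (smooth_mxM oU (som j) sE)) //.
by rewrite (partial_mxM k (som j) sE).
Qed.

(** Here s is the common mixed second derivative of E; the terms in gj and gk, which come from
    differentiating the factor E^-1, cancel against the quadratic ones. *)
Let riemann_algebra (e s pkj pjk ok oj ek ej gk gj : 'M[R]_n) :
  (s + (pkj *m e + oj *m ek) - ek *m gj) - (s + (pjk *m e + ok *m ej) - ej *m gk)
  + (ek *m gj + ok *m (ej + oj *m e)) - (ej *m gk + oj *m (ek + ok *m e)) =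
  (pkj - pjk + ok *m oj - oj *m ok) *m e.
Proof.
rewrite !(mulmxBl, mulmxDl, mulmxDr) !mulmxA.
by apply/matrixP => p q; rewrite !mxE; ring.
Qed.

(** Curvature is covariant under a change of frame, and the coordinate connection is the transform
    of om by E. The second derivatives of E drop out by [schwarz]. *)
Lemma riemann_frame k j x : U x ->
  partial_mx k (Gam j) x - partial_mx j (Gam k) x + Gam k x *m Gam j x - Gam j x *m Gam k x =
  invmx (E x) *m curvature_form k j x *m E x.
Proof.
move=> Ux; apply: (can_inj (mulKmx (uE Ux))).
have EG i y : U y -> E y *m Gam i y = D i y by move=> Uy; rewrite /frame_connection mulKVmx ?uE.
have EdG l i : E x *m partial_mx l (Gam i) x =
    partial_mx l (D i) x - partial_mx l E x *m Gam i x.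
  rewrite -(_ : partial_mx l (fun y => E y *m Gam i y) x = partial_mx l (D i) x).
    by rewrite (partial_mxM l sE (smooth_Gam i) Ux) addrAC subrr add0r.
  apply/matrixP => a b; rewrite !mxE; apply: (eq_partial _ oU Ux) => y Uy.
  by rewrite EG.
have GG l i : E x *m (Gam l x *m Gam i x) =
    partial_mx l E x *m Gam i x + om l x *m D i x.
  by rewrite mulmxA EG // mulmxDl -mulmxA EG.
have dd : partial_mx k (partial_mx j E) x = partial_mx j (partial_mx k E) x.
  apply/matrixP => a b.
  exact: (etrans (partial_mx2E k j E x a b)
    (etrans (schwarz k j a b Ux) (esym (partial_mx2E j k E x a b)))).
transitivity (E x *m partial_mx k (Gam j) x - E x *m partial_mx j (Gam k) x
    + E x *m (Gam k x *m Gam j x) - E x *m (Gam j x *m Gam k x)).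
  by rewrite mulmxBr mulmxDr mulmxBr.
transitivity (curvature_form k j x *m E x); last first.
  rewrite -mulmxA.
  by rewrite (mulKVmx (uE Ux)).
apply: etrans (riemann_algebra _ (partial_mx j (partial_mx k E) x) _ _ _ _ _ _ (Gam k x) (Gam j x)).
congr (_ - _ + _ - _).
- apply: (etrans (EdG k j)); apply: (congr1 (fun z => z - _)).
  exact: (etrans (partial_D k j Ux) (congr1 (fun z => z + _) dd)).
- apply: (etrans (EdG j k)); exact: (congr1 (fun z => z - _) (partial_D j k Ux)).
- exact: GG.
- exact: GG.
Qed.

Let entry4 (A B C D' : 'M[R]_n) k i :
  (A - B + C - D') k i = A k i - B k i + (C k i - D' k i).
Proof. by rewrite !mxE addrA. Qed.

Lemma ricci_frame i j x : U x ->
  ricci g x i j = \sum_k (invmx (E x) *m curvature_form k j x *m E x) k i.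
Proof.
move=> Ux; rewrite mxE; apply: eq_bigr => k _; rewrite -riemann_frame // entry4.
have P l a b c : partial l (christoffel g a b c) x = partial_mx l (Gam c) x a b.
  rewrite [RHS]mxE; apply: (eq_partial _ oU Ux) => y Uy; exact: christoffel_frame.
have sym a b c : Gam b x a c = Gam c x a b.
  by rewrite /frame_connection !mxE; apply: eq_bigr => d _; rewrite torsion_free.
rewrite (P k k i j) (P j k i k); congr (_ + _).
rewrite [(Gam k x *m Gam j x) k i]mxE [(Gam j x *m Gam k x) k i]mxE -sumrB.
apply: eq_bigr => l _; rewrite !christoffel_frame //.
by rewrite (sym k l k) (sym k l j).
Qed.

Lemma einstein_frame (K : 'I_n -> 'I_n -> 'I_n -> 'I_n -> R) c x : U x ->
  (forall k j a b, curvature_form k j x a b =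
     \sum_d \sum_e K a b d e * (E x d k * E x e j)) ->
  (forall b e, \sum_a K a b a e = c * (b == e)%:R) ->
  ricci g x = c *: g x.
Proof.
move=> Ux cK trK; apply/matrixP => i j; rewrite ricci_frame // [RHS]mxE [(_ *m _) i j]mxE mulr_sumr.
have FE a d : \sum_k invmx (E x) k a * E x d k = (d == a)%:R.
  have := mulmxV (uE Ux) => /matrixP/(_ d a); rewrite !mxE => <-.
  by apply: eq_bigr => k _; rewrite mulrC.
transitivity (\sum_b \sum_e (\sum_a K a b a e) * (E x e j * E x b i)); last first.
  apply: eq_bigr => b _; rewrite (bigD1 b) //= trK eqxx mulr1 big1 ?addr0.
    by rewrite mxE; ring.
  by move=> e eb; rewrite trK eq_sym (negbTE eb) mulr0 mul0r.
transitivity (\sum_b \sum_e \sum_a \sum_d K a b d e * (E x e j * E x b i) *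
    (\sum_k invmx (E x) k a * E x d k)); last first.
  apply: eq_bigr => b _; apply: eq_bigr => e _; rewrite mulr_suml; apply: eq_bigr => a _.
  rewrite (bigD1 a) //= FE eqxx mulr1 big1 ?addr0// => d /negbTE da.
  by rewrite FE da mulr0.
under eq_bigr do rewrite mxE.
rewrite exchange_big /=; apply: eq_bigr => b _.
under eq_bigr do rewrite mxE mulr_suml.
under [RHS]eq_bigr do under eq_bigr do under eq_bigr do rewrite mulr_sumr.
under eq_bigr do under eq_bigr do rewrite cK mulr_sumr mulr_suml.
under eq_bigr do under eq_bigr do under eq_bigr do rewrite mulr_sumr mulr_suml.
transitivity (\sum_a \sum_d \sum_e \sum_k K a b d e * (E x e j * E x b i) *
    (invmx (E x) k a * E x d k)).
  rewrite exchange_big; apply: eq_bigr => a _.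
  rewrite exchange_big; apply: eq_bigr => d _.
  rewrite exchange_big; apply: eq_bigr => e _.
  by apply: eq_bigr => k _; ring.
rewrite (eq_bigr (fun a => \sum_e \sum_d \sum_k K a b d e * (E x e j * E x b i) *
    (invmx (E x) k a * E x d k))); first by rewrite exchange_big.
by move=> a _; rewrite exchange_big.
Qed.

End MovingFrames.

(** * A nearly parallel G2-structure *)

Definition q_val (R : realType) (x : 'rV[R]_7) (v : nat) : R :=
  if (v < 7)%N then x 0 (inord v)
  else (1 + 2%:R * (x 0 (inord (v - 7).*2) ^+ 2 + x 0 (inord (v - 7).*2.+1) ^+ 2))^-1.

(* Polynomials in the coordinates x_0, ..., x_6 (variables 0 to 6) and in
   u_k = 1 / (1 + 2 (x_2k^2 + x_2k+1^2)) (variable 7 + k), as lists of terms. *)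
Definition peval (R : realType) (p : lform) (x : 'rV[R]_7) : R :=
  \sum_(t <- p) t.1%:~R * \prod_(v <- t.2) q_val x v.

(** From u = 1 / (1 + 2 (x^2 + y^2)) one gets du/dx = -4 x u^2. The test on [i./2] selects the two
    coordinates on which u_k depends. *)
Definition pvar_diff (i v : nat) : lform :=
  if (v < 7)%N then [:: ((v == i)%:R, [::])]
  else if i./2 == (v - 7)%N then [:: (-4, [:: i; v; v])] else [::].

Fixpoint pmono_diff (i : nat) (m : seq nat) : lform :=
  if m isn't v :: m' then [::]
  else lmul (pvar_diff i v) [:: (1, m')] ++ lmul [:: (1, [:: v])] (pmono_diff i m').

Definition pdiff (i : nat) (p : lform) : lform :=
  flatten [seq lscale t.1 (pmono_diff i t.2) | t <- p].

Definition pnorm (p : lform) : lform :=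
  foldr (fun t q => add_term t.1 (sort leq t.2) q) [::] p.

(* Eliminates u_k x_{2k+1}^2 by 2 u y^2 = 1 - u - 2 u x^2. *)
Definition preduce_term (k : nat) (t : int * seq nat) : lform :=
  let: (c, m) := t in let u := (7 + k)%N in let y := k.*2.+1 in
  let h := (c %/ 2)%Z in
  let m' := rem y (rem y (rem u m)) in
  if [&& u \in m, y \in rem u m, y \in rem y (rem u m) & c == 2 * h]
  then [:: (h, m'); (- h, u :: m'); (- c, [:: u, k.*2, k.*2 & m'])] else [:: t].

Definition preduce (p : lform) : lform :=
  foldr (fun k q => flatten [seq preduce_term k t | t <- q]) p [:: 0; 1; 2]%N.

(** Every round preserves the value, so a positive answer is sound for any number of rounds; three
    are enough to bring the identities below to zero. *)
Definition pzero (p : lform) : bool :=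
  all (fun t => t.1 == 0) (iter 3 (fun q => pnorm (preduce q)) (pnorm p)).

Lemma half_eqE (m k : nat) : (m./2 == k) = (m == k.*2) || (m == k.*2.+1).
Proof. by lia. Qed.

Section Polynomials.
Variable R : realType.
Implicit Types (p q : lform) (x : 'rV[R]_7).

Let mono (m : seq nat) x : R := \prod_(v <- m) q_val x v.

Lemma peval_nil x : peval [::] x = 0. Proof. exact: big_nil. Qed.

Lemma peval_cons c m p x : peval ((c, m) :: p) x = c%:~R * mono m x + peval p x.
Proof. exact: big_cons. Qed.

Lemma peval1 c m x : peval [:: (c, m)] x = c%:~R * mono m x.
Proof. by rewrite peval_cons peval_nil addr0. Qed.

Lemma peval_cat p q x : peval (p ++ q) x = peval p x + peval q x.
Proof. exact: big_cat. Qed.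

Lemma peval_scale c p x : peval (lscale c p) x = c%:~R * peval p x.
Proof.
rewrite /peval big_map mulr_sumr; apply: eq_bigr => t _ /=.
by rewrite intrM mulrA.
Qed.

Lemma peval_mul p q x : peval (lmul p q) x = peval p x * peval q x.
Proof.
rewrite /peval big_allpairs_dep mulr_suml; apply: eq_bigr => t _.
rewrite mulr_sumr; apply: eq_bigr => u _ /=.
by rewrite intrM big_cat /=; ring.
Qed.

Lemma q_den_neq0 (a b : R) : 1 + 2%:R * (a ^+ 2 + b ^+ 2) != 0.
Proof.
have h : 0 <= a ^+ 2 + b ^+ 2 by rewrite addr_ge0 ?sqr_ge0.
by rewrite gt_eqF // ltr_wpDr // mulr_ge0 // ler0n.
Qed.

Lemma smooth_q_val v : smooth_on setT (fun x : 'rV[R]_7 => q_val x v).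
Proof.
rewrite /q_val; case: (v < 7)%N; first exact: smooth_coord.
have sx a : smooth_on setT (fun x : 'rV[R]_7 => x 0 a ^+ 2).
  by apply: smoothX; [exact: openT | exact: smooth_coord].
apply: smoothV; [exact: openT | by move=> x _; exact: q_den_neq0 |].
apply: smoothD; [exact: openT | exact: smooth_cst |].
apply: smoothM; [exact: openT | exact: smooth_cst |].
exact: (smoothD openT (sx _) (sx _)).
Qed.

Lemma partial_q_val (i : 'I_7) v x : (v < 10)%N ->
  partial i (fun y => q_val y v) x = peval (pvar_diff i v) x.
Proof.
move=> v10; rewrite /pvar_diff.
have [v7|v7] := ltnP v 7.
  have -> : (fun y : 'rV[R]_7 => q_val y v) = (fun y => y 0 (inord v)).
    by apply/funext => y; rewrite /q_val v7.
  rewrite partial_coord peval1 /mono big_nil mulr1 -val_eqE /= inordK // eq_sym.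
  by case: eqP.
pose k := (v - 7)%N.
have k3 : (k < 3)%N by rewrite /k ltn_subLR.
pose a : 'I_7 := inord k.*2; pose b : 'I_7 := inord k.*2.+1.
have aE : val a = k.*2 by rewrite /= inordK //; move: (k) k3 => [|[|[|]]].
have bE : val b = k.*2.+1 by rewrite /= inordK //; move: (k) k3 => [|[|[|]]].
have vE y : q_val y v = (1 + 2%:R * (y 0 a * y 0 a + y 0 b * y 0 b))^-1.
  by rewrite /q_val ltnNge v7 /= -!expr2.
have dx c : derivable (fun y : 'rV[R]_7 => y 0 c) x (delta_mx 0 i) by exact: derivable_coord.
have d1 := derivableD (derivableM (dx a) (dx a)) (derivableM (dx b) (dx b)).
have d2 := derivableM (derivable_cst (2%:R : R) x (delta_mx 0 i)) d1.
have d3 := derivableD (derivable_cst (1 : R) x (delta_mx 0 i)) d2.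
have -> : (fun y : 'rV[R]_7 => q_val y v) =
    (fun y => (1 + 2%:R * (y 0 a * y 0 a + y 0 b * y 0 b))^-1) by exact/funext.
have n0 : 1 + 2%:R * (x 0 a * x 0 a + x 0 b * x 0 b) != 0.
  by rewrite -!expr2 q_den_neq0.
rewrite (partialV n0 d3) (partialD (derivable_cst (1 : R) x (delta_mx 0 i)) d2).
rewrite partial_cst (partialZ _ d1).
rewrite (partialD (derivableM (dx a) (dx a)) (derivableM (dx b) (dx b))).
rewrite (partialM (dx a) (dx a)) (partialM (dx b) (dx b)) !partial_coord -vE.
rewrite -!val_eqE aE bE /=.
have iE := half_eqE i k.
rewrite iE; case: eqP => [ia|_] /=.
  have -> : (nat_of_ord i == k.*2.+1) = false by rewrite ia; lia.
  rewrite peval1 /mono !big_cons big_nil /q_val ltn_ord inord_val.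
  have -> : i = a by apply: val_inj; rewrite aE.
  by rewrite -/(q_val x v) -[false%:R]/(0 : R) -[(-4)%:~R]/(- 4%:R : R); ring.
case: eqP => [ib|_] /=.
  rewrite peval1 /mono !big_cons big_nil /q_val ltn_ord inord_val.
  have -> : i = b by apply: val_inj; rewrite bE.
  by rewrite -/(q_val x v) -[(-4)%:~R]/(- 4%:R : R); ring.
by rewrite peval_nil !(mulr0, addr0, oppr0).
Qed.

Let smooth_mono m : smooth_on setT (mono m).
Proof. by apply: smooth_prod => [|v _]; [exact: openT | exact: smooth_q_val]. Qed.

Lemma smooth_peval p : smooth_on setT (peval (R := R) p).
Proof.
apply: smooth_sum => [|t _]; first exact: openT.
exact: (smoothM openT (smooth_cst _) (smooth_mono t.2)).
Qed.

Let partial_mono (i : 'I_7) m x : all (fun v => v < 10)%N m ->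
  partial i (mono m) x = peval (pmono_diff i m) x.
Proof.
elim: m => [_|v m IH /= /andP[v10 m10]].
  rewrite peval_nil (_ : mono [::] = fun=> 1) ?partial_cst//.
  by apply/funext => y; exact: big_nil.
have -> : mono (v :: m) = (fun y => q_val y v * mono m y).
  by apply/funext => y; exact: big_cons.
have dv := smooth_derivable i (smooth_q_val v) (I : setT x).
have dm := smooth_derivable i (smooth_mono m) (I : setT x).
rewrite (partialM dv dm) partial_q_val // IH // peval_cat !peval_mul !peval1 !mul1r.
by rewrite /mono big_cons big_nil mulr1 addrC mulrC.
Qed.

Definition pbounded p := all (fun t : int * seq nat => all (fun v => v < 10)%N t.2) p.

Lemma partial_peval (i : 'I_7) p x : pbounded p ->
  partial i (peval (R := R) p) x = peval (pdiff i p) x.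
Proof.
elim: p => [_|[c m] p IH /= /andP[m10 p10]].
  rewrite peval_nil (_ : peval _ = fun=> 0) ?partial_cst//.
  by apply/funext => y; exact: peval_nil.
have -> : peval ((c, m) :: p) = (fun y : 'rV[R]_7 => c%:~R * mono m y + peval p y).
  by apply/funext => y; exact: peval_cons.
have dm := smooth_derivable i (smooth_mono m) (I : setT x).
have dp := smooth_derivable i (smooth_peval p) (I : setT x).
have dc := derivableM (derivable_cst (c%:~R : R) x (delta_mx 0 i)) dm.
rewrite (partialD dc dp) (partialZ _ dm) partial_mono // IH //.
by rewrite /pdiff /= peval_cat peval_scale.
Qed.

Lemma peval_add_term c m p x : peval (add_term c m p) x = c%:~R * mono m x + peval p x.
Proof.
elim: p => [|[c' m'] p IH] /=; first exact: peval_cons.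
case: eqP => [->|_]; rewrite !peval_cons ?intrD ?mulrDl ?addrA //.
by rewrite IH addrCA addrA.
Qed.

Lemma peval_norm p x : peval (pnorm p) x = peval p x.
Proof.
elim: p => [//|[c m] p IH] /=; rewrite peval_add_term IH [RHS]peval_cons.
by congr (_ * _ + _); apply: perm_big; rewrite perm_sort.
Qed.

(** The defining equation u (1 + 2 x^2 + 2 y^2) = 1, solved for the term that [preduce_term]
    eliminates. *)
Lemma q_val_relation k x : (k < 3)%N ->
  2%:R * q_val x (7 + k) * q_val x k.*2.+1 ^+ 2 =
  1 - q_val x (7 + k) - 2%:R * q_val x (7 + k) * q_val x k.*2 ^+ 2 :> R.
Proof.
move=> k3; rewrite /q_val ltnNge leq_addr /= addKn.
have [-> ->] : (k.*2 < 7)%N /\ (k.*2.+1 < 7)%N by lia.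
have := q_den_neq0 (x 0 (inord k.*2)) (x 0 (inord k.*2.+1)).
by move: (x 0 _) (x 0 _) => a b H; field.
Qed.

Lemma peval_reduce_term k t x : (k < 3)%N -> peval (preduce_term k t) x = peval [:: t] x.
Proof.
case: t => c m k3; rewrite /preduce_term; case: ifP => // /and4P[um ym ym' /eqP cE].
set u := (7 + k)%N in um ym ym' *; set y := k.*2.+1 in ym ym' *.
set m' := rem y _; set h := (c %/ 2)%Z in cE *.
have -> : peval [:: (c, m)] x = c%:~R * (q_val x u * (q_val x y * (q_val x y * mono m' x))).
  rewrite peval1; congr (_ * _); rewrite /mono (perm_big _ (perm_to_rem um)) big_cons.
  by rewrite (perm_big _ (perm_to_rem ym)) big_cons (perm_big _ (perm_to_rem ym')) big_cons.
rewrite !peval_cons peval_nil addr0 /mono !big_cons -/(mono m' x) cE.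
have := q_val_relation x k3; rewrite -/u -/y.
rewrite !intrM !intrN !intrM; move: (q_val x u) (q_val x y) (q_val x k.*2) (mono m' x) (h%:~R : R).
move=> a b d e z E.
transitivity (z * e * (2%:R * a * b ^+ 2)); last by rewrite -[2%:~R]/(2%:R : R); ring.
by rewrite E -[2%:~R]/(2%:R : R); ring.
Qed.

Lemma peval_reduce p x : peval (preduce p) x = peval p x.
Proof.
rewrite /preduce; have : all (fun k => k < 3)%N [:: 0; 1; 2]%N by [].
elim: [:: 0; 1; 2]%N => [//|k s IH /= /andP[k3 /IH <-]].
elim: (foldr _ _ _) => [//|t q IHq] /=.
by rewrite peval_cat peval_reduce_term // IHq -peval_cat.
Qed.

Lemma peval_zero p x : pzero p -> peval p x = 0.
Proof.
have allz q : all (fun t : int * seq nat => t.1 == 0) q -> peval q x = 0.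
  elim: q => [_|[c m] q IH /= /andP[/eqP -> /IH q0]]; first exact: peval_nil.
  by rewrite peval_cons q0 mul0r addr0.
move=> /allz; suff -> : forall n, peval (iter n (fun q => pnorm (preduce q)) (pnorm p)) x = peval p x.
  by [].
by elim=> [|n IH]; rewrite ?iterS peval_norm ?peval_reduce.
Qed.

Lemma peval_eq p q x : pzero (p ++ lscale (-1) q) -> peval p x = peval q x.
Proof.
move=> /(peval_zero x); rewrite peval_cat peval_scale mulN1r => /eqP.
by rewrite subr_eq0 => /eqP.
Qed.

End Polynomials.

(* The SU(3)-frame of the regular Sasaki-Einstein structure on the circle bundle
   over CP^1 x CP^1 x CP^1, whose rows 0 to 6 are e^1, ..., e^7, in coordinates
   x_0, ..., x_5 on the base and x_6 on the fibre:
     e^1 + i e^2 = u_0 (dw - 4 i w dx_6) with w = x_0 + i x_1,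
     e^3 + i e^4 = u_1 (dx_2 + i dx_3), e^5 + i e^6 = u_2 (dx_4 + i dx_5),
     e^7 = dx_6 + a_1 + a_2 + a_3 with d a_k the curvature of the k-th factor;
   rows 7 and 8 are a_2 and a_3. *)
Definition q_frame_entry (c j : nat) : lform :=
  nth [::] (nth [::]
  [:: [:: [:: (1, [:: 7]%N)]; [::]; [::]; [::]; [::]; [::]; [:: (4, [:: 1; 7]%N)]];
      [:: [::]; [:: (1, [:: 7]%N)]; [::]; [::]; [::]; [::]; [:: (-4, [:: 0; 7]%N)]];
      [:: [::]; [::]; [:: (1, [:: 8]%N)]; [::]; [::]; [::]; [::]];
      [:: [::]; [::]; [::]; [:: (1, [:: 8]%N)]; [::]; [::]; [::]];
      [:: [::]; [::]; [::]; [::]; [:: (1, [:: 9]%N)]; [::]; [::]];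
      [:: [::]; [::]; [::]; [::]; [::]; [:: (1, [:: 9]%N)]; [::]];
      [:: [:: (-1, [:: 1; 7]%N)]; [:: (1, [:: 0; 7]%N)];
          [:: (-1, [:: 3; 8]%N)]; [:: (1, [:: 2; 8]%N)];
          [:: (-1, [:: 5; 9]%N)]; [:: (1, [:: 4; 9]%N)];
          [:: (1, [::]); (-4, [:: 0; 0; 7]%N); (-4, [:: 1; 1; 7]%N)]];
      [:: [::]; [::]; [:: (-1, [:: 3; 8]%N)]; [:: (1, [:: 2; 8]%N)]; [::]; [::]; [::]];
      [:: [::]; [::]; [::]; [::]; [:: (-1, [:: 5; 9]%N)]; [:: (1, [:: 4; 9]%N)]; [::]]] c) j.

(** The polynomial 1 / u_k. *)
Definition q_inv_den (k : nat) : lform :=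
  [:: (1, [::]); (2, [:: k.*2; k.*2]%N); (2, [:: k.*2.+1; k.*2.+1]%N)].

(* The dual frame; column b is the vector field dual to row b. *)
Definition q_dual_entry (i b : nat) : lform :=
  nth [::] (nth [::]
  (let v := fun s : nat => [:: (1, [:: s])] in let w := fun s : nat => [:: (-1, [:: s])] in
   let reeb := fun p : lform => (lmul p [:: (-4, [:: 1]%N)], lmul p [:: (4, [:: 0]%N)], p) in
   [:: [:: q_inv_den 0 ++ (reeb (v 1)).1.1; (reeb (w 0)).1.1; (reeb (v 3)).1.1; (reeb (w 2)).1.1;
          (reeb (v 5)).1.1; (reeb (w 4)).1.1; [:: (-4, [:: 1]%N)]];
      [:: (reeb (v 1)).1.2; q_inv_den 0 ++ (reeb (w 0)).1.2; (reeb (v 3)).1.2; (reeb (w 2)).1.2;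
          (reeb (v 5)).1.2; (reeb (w 4)).1.2; [:: (4, [:: 0]%N)]];
      [:: [::]; [::]; q_inv_den 1; [::]; [::]; [::]; [::]];
      [:: [::]; [::]; [::]; q_inv_den 1; [::]; [::]; [::]];
      [:: [::]; [::]; [::]; [::]; q_inv_den 2; [::]; [::]];
      [:: [::]; [::]; [::]; [::]; [::]; q_inv_den 2; [::]];
      [:: v 1; w 0; v 3; w 2; v 5; w 4; [:: (1, [::])]]]) i) b.

(** Entry c describes d of row c. The pairs e^1 + i e^2, e^3 + i e^4 and e^5 + i e^6 rotate with
    rates 4 (e^7 - a_2 - a_3), 4 a_2 and 4 a_3. The rates add up to 4 e^7, as a nearly parallel form
    requires; the twist by x_6 in the first pair achieves this, and it is why a_1 needs no row of
    its own. *)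
Definition q_structure (c : nat) : seq (int * (nat * nat)) :=
  nth [::] [:: [:: (-4, (6, 1)%N); (4, (7, 1)%N); (4, (8, 1)%N)];
    [:: (4, (6, 0)%N); (-4, (7, 0)%N); (-4, (8, 0)%N)];
    [:: (-4, (7, 3)%N)]; [:: (4, (7, 2)%N)]; [:: (-4, (8, 5)%N)]; [:: (4, (8, 4)%N)];
    [:: (2, (0, 1)%N); (2, (2, 3)%N); (2, (4, 5)%N)]; [:: (2, (2, 3)%N)]; [:: (2, (4, 5)%N)]] c.

(* Connection form: omega_ab = sum of v G_c over the terms (v, (a, b, c)). *)
Definition q_connection : seq (int * (nat * nat * nat)) :=
  [:: (3, (0, 1, 6)%N); (-4, (0, 1, 7)%N); (-4, (0, 1, 8)%N); (-1, (0, 6, 1)%N); (1, (1, 6, 0)%N);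
      (-1, (2, 3, 6)%N); (4, (2, 3, 7)%N); (-1, (2, 6, 3)%N); (1, (3, 6, 2)%N);
      (-1, (4, 5, 6)%N); (4, (4, 5, 8)%N); (-1, (4, 6, 5)%N); (1, (5, 6, 4)%N)].

Definition q_connZ (a b c : nat) : int :=
  foldr (fun t z => (if t.2 == (a, b, c) then t.1 else
                     if t.2 == (b, a, c) then - t.1 else 0) + z) 0 q_connection.

(** Antisymmetrised coefficients: d G_c is half the sum of these times G_p /\ G_q. *)
Definition q_structZ (c p q : nat) : int :=
  foldr (fun t z => t.1 * ((t.2 == (p, q))%:R - (t.2 == (q, p))%:R) + z) 0 (q_structure c).

(** The coefficients of d om_ab + om_ac /\ om_cb in the nine 1-forms. The first sum runs over the
    1-forms that make up om_ab, the second over the seven frame indices. *)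
Definition q_curvZ (a b p q : nat) : int :=
  sumZ 9 (fun c => q_connZ a b c * q_structZ c p q)
  + sumZ 7 (fun c => q_connZ a c p * q_connZ c b q - q_connZ a c q * q_connZ c b p).

Definition q_structure_residue (c i j : nat) : lform :=
  pdiff i (q_frame_entry c j) ++ lscale (-1) (pdiff j (q_frame_entry c i)) ++
  flatten [seq lscale (- t.1) (lmul (q_frame_entry t.2.1 i) (q_frame_entry t.2.2 j)
     ++ lscale (-1) (lmul (q_frame_entry t.2.1 j) (q_frame_entry t.2.2 i))) | t <- q_structure c].

Lemma q_structure_check :
  alln 9 (fun c => alln 7 (fun i => alln 7 (fun j => pzero (q_structure_residue c i j)))).
Proof. by vm_compute. Qed.

Lemma q_bounded_check : alln 9 (fun c => alln 7 (fun j => pbounded (q_frame_entry c j) &&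
  alln 7 (fun i => pbounded (pdiff i (q_frame_entry c j))))).
Proof. by vm_compute. Qed.

Lemma q_schwarz_check : alln 7 (fun c => alln 7 (fun k => alln 7 (fun i => alln 7 (fun j =>
  pzero (pdiff i (pdiff j (q_frame_entry c k)) ++
         lscale (-1) (pdiff j (pdiff i (q_frame_entry c k)))))))).
Proof. by vm_compute. Qed.

Lemma q_dual_check : alln 7 (fun a => alln 7 (fun b => pzero
  (flatten [seq lmul (q_frame_entry a i) (q_dual_entry i b) | i <- iota 0 7]
   ++ lscale (-1) [:: ((a == b)%:R, [::])]))).
Proof. by vm_compute. Qed.

(** The first structure equation, compared coefficient by coefficient in the nine 1-forms; only the
    first seven of them are coframe elements, hence the two conditionals. *)
Lemma q_torsion_check : alln 7 (fun a => alln 9 (fun p => alln 9 (fun q =>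
  q_structZ a p q + (if (q < 7)%N then q_connZ a q p else 0)
    - (if (p < 7)%N then q_connZ a p q else 0) == 0))).
Proof. by vm_compute. Qed.

(** The connection involves the potentials a_2 and a_3, but they drop out of its curvature, which is
    thus expressed in the coframe alone. *)
Lemma q_curvature_check : alln 7 (fun a => alln 7 (fun b => alln 9 (fun p => alln 9 (fun q =>
  ((7 <= p) || (7 <= q))%N ==> (q_curvZ a b p q == 0))))).
Proof. by vm_compute. Qed.

Lemma q_einstein_check : alln 7 (fun b => alln 7 (fun q =>
  sumZ 7 (fun a => q_curvZ a b a q) == 6 * (b == q)%:R)).
Proof. by vm_compute. Qed.

(** * Structure equations and Einstein condition of the explicit coframe *)

Section QManifold.
Variable R : realType.
Implicit Type x : 'rV[R]_7.

Definition q_frame x : 'M[R]_(9, 7) := \matrix_(c, j) peval (q_frame_entry c j) x.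

Definition q_coframe x : 'M[R]_7 := \matrix_(a, j) peval (q_frame_entry a j) x.

Lemma q_frameE c (j : 'I_7) : (c < 9)%N ->
  (fun x => q_frame x (inord c) j) = peval (R := R) (q_frame_entry c j).
Proof. by move=> c9; apply/funext => x; rewrite mxE inordK. Qed.

Lemma q_coframeE (a j : 'I_7) : (fun x => q_coframe x a j) = peval (R := R) (q_frame_entry a j).
Proof. by apply/funext => x; rewrite mxE. Qed.

Lemma smooth_q_frame : smooth_mx setT q_frame.
Proof.
move=> c j; rewrite -(inord_val c) q_frameE ?ltn_ord//; exact: smooth_peval.
Qed.

Lemma smooth_q_coframe : smooth_mx setT q_coframe.
Proof. by move=> a j; rewrite q_coframeE; exact: smooth_peval. Qed.

Lemma partial_q_frame i c (j : 'I_7) x : (c < 9)%N ->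
  partial i (fun y => q_frame y (inord c) j) x = peval (pdiff i (q_frame_entry c j)) x.
Proof.
move=> c9; rewrite q_frameE // partial_peval //.
by have /andP[] := allnP j (allnP (Ordinal c9) q_bounded_check).
Qed.

Lemma q_structure_lt c t : (c < 9)%N -> t \in q_structure c -> (t.2.1 < 9)%N && (t.2.2 < 9)%N.
Proof.
have : alln 9 (fun c => all (fun t => (t.2.1 < 9)%N && (t.2.2 < 9)%N) (q_structure c)).
  by vm_compute.
by move=> /allP H c9 ts; have /H/allP/(_ t ts) : c \in iota 0 9 by rewrite mem_iota.
Qed.

Lemma peval_flatten (I : eqType) (s : seq I) (F : I -> lform) x :
  peval (flatten [seq F t | t <- s]) x = \sum_(t <- s) peval (F t) x.
Proof.
elim: s => [|t s IH]; first by rewrite big_nil; exact: peval_nil.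
by rewrite big_cons /= peval_cat IH.
Qed.

Lemma q_structure_equation c x : (c < 9)%N -> structure_equation q_frame q_structure c x.
Proof.
move=> c9 i j; rewrite !partial_q_frame //; apply/eqP; rewrite -subr_eq0; apply/eqP.
have E := peval_zero x (allnP j (allnP i (allnP (Ordinal c9) q_structure_check))).
rewrite /q_structure_residue !peval_cat peval_scale mulN1r /= in E.
rewrite -[RHS]E [peval (flatten [seq _ | t <- q_structure c]) x]peval_flatten addrA.
congr (_ + _); rewrite -sumrN; apply: eq_big_seq => t ts.
have /andP[t1 t2] := q_structure_lt c9 ts.
rewrite peval_scale peval_cat peval_scale !peval_mul mulN1r intrN mulNr.
by rewrite !mxE !inordK.
Qed.

Lemma q_coframe_unit x : q_coframe x \in unitmx.
Proof.
pose F : 'M[R]_7 := \matrix_(i, b) peval (q_dual_entry i b) x.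
suff EF : q_coframe x *m F = 1%:M by have [] := mulmx1_unit EF.
apply/matrixP => a b; rewrite [RHS]mxE mxE.
have := peval_eq x (allnP b (allnP a q_dual_check)).
rewrite peval_flatten peval1 big_nil mulr1 -val_eqE => E.
have -> : (val a == val b)%:R = ((val a == val b)%:R)%:~R :> R by case: (_ == _).
rewrite -E -[iota 0 7]/(index_iota 0 7) big_mkord; apply: eq_bigr => i _.
by rewrite peval_mul !mxE.
Qed.

Let G := q_frame.
Let om (i : 'I_7) x : 'M[R]_7 :=
  \matrix_(a, b) \sum_(c < 9) (q_connZ a b c)%:~R * G x c i.

Let smooth_om i : smooth_mx setT (om i).
Proof.
move=> a b; rewrite (_ : (fun x => _) = (fun x => \sum_(c < 9) (q_connZ a b c)%:~R * G x c i)).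
  apply: smooth_sum => [|c _]; first exact: openT.
  exact: (smoothM openT (smooth_cst _) (smooth_q_frame c i)).
by apply/funext => x; rewrite mxE.
Qed.

Let anti_om i x : (om i x)^T = - om i x.
Proof.
have check : alln 7 (fun a => alln 7 (fun b => alln 9 (fun c =>
    q_connZ b a c == - q_connZ a b c))) by vm_compute.
apply/matrixP => a b; rewrite !mxE -sumrN; apply: eq_bigr => c _.
by rewrite (eqP (allnP c (allnP b (allnP a check)))) intrN mulNr.
Qed.

(** Passes from the sparse lists to full sums over index pairs, where coefficients can be compared
    one by one. *)
Let q_structZE c i j x : (c < 9)%N ->
  \sum_(t <- q_structure c) t.1%:~R *
     (G x (inord t.2.1) i * G x (inord t.2.2) j - G x (inord t.2.1) j * G x (inord t.2.2) i) =
  \sum_(p < 9) \sum_(q < 9) (q_structZ c p q)%:~R * (G x p i * G x q j).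
Proof.
move=> c9; have Hlt t : t \in q_structure c -> (t.2.1 < 9)%N && (t.2.2 < 9)%N.
  exact: q_structure_lt.
have pick (s r : 'I_9) k l : \sum_(p < 9) \sum_(q < 9)
    (((nat_of_ord s, nat_of_ord r) == (nat_of_ord p, nat_of_ord q))%:R : int)%:~R *
      (G x p k * G x q l) = G x s k * G x r l.
  rewrite (bigD1 s) //= (bigD1 r) //= eqxx mul1r.
  rewrite big1 ?addr0 => [|q qr]; last first.
    by rewrite xpair_eqE eqxx /= val_eqE eq_sym (negbTE qr) mul0r.
  rewrite big1 ?addr0 // => p ps; rewrite big1 // => q _.
  by rewrite xpair_eqE val_eqE eq_sym (negbTE ps) mul0r.
rewrite /q_structZ; elim: (q_structure c) Hlt => [|[v [s r]] l IH] Hlt.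
  by rewrite big_nil big1 // => p _; rewrite big1 // => q _; rewrite mul0r.
rewrite big_cons IH; last by move=> t tl; apply: Hlt; rewrite inE tl orbT.
have /andP[/= s9 r9] := Hlt (v, (s, r)) (mem_head _ _).
under [RHS]eq_bigr do under eq_bigr do rewrite /= intrD mulrDl.
under [RHS]eq_bigr do rewrite big_split.
rewrite big_split /=; congr (_ + _).
rewrite -[s](inordK s9) -[r](inordK r9) !inord_val.
rewrite -(pick (inord s) (inord r) i j) [G x (inord s) j * _]mulrC.
rewrite -(pick (inord r) (inord s) i j) -sumrB mulr_sumr; apply: eq_bigr => p _.
rewrite -sumrB mulr_sumr; apply: eq_bigr => q _.
rewrite intrM intrB !xpair_eqE [(_ == nat_of_ord q) && _]andbC.
by ring.
Qed.

Let q_curvZE a b p q : (q_curvZ a b p q)%:~R =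
  \sum_(c < 9) (q_connZ a b c)%:~R * (q_structZ c p q)%:~R +
  \sum_(c < 7) ((q_connZ a c p)%:~R * (q_connZ c b q)%:~R
                - (q_connZ a c q)%:~R * (q_connZ c b p)%:~R) :> R.
Proof.
rewrite /q_curvZ intrD -!sumZE; congr (_ + _); apply: eq_bigr => c _.
  by rewrite intrM.
by rewrite intrB !intrM.
Qed.

Let partial_om k j x a b :
  partial k (fun y => om j y a b) x = \sum_(c < 9) (q_connZ a b c)%:~R * partial k (fun y => G y c j) x.
Proof.
have dG c := smooth_derivable k (smooth_q_frame c j) (Logic.I : setT x).
have dcG (c : 'I_9) := derivableM (derivable_cst ((q_connZ a b c)%:~R : R) x (delta_mx 0 k)) (dG c).
have -> : (fun y => om j y a b) = (fun y => \sum_(c < 9) (q_connZ a b c)%:~R * G y c j).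
  by apply/funext => y; rewrite mxE.
by rewrite (partial_sum _ dcG).2; apply: eq_bigr => c _; rewrite (partialZ _ (dG c)).
Qed.

(** The structure equations eliminate the derivatives of the G_c, leaving a quadratic expression in
    the nine 1-forms with integer coefficients. *)
Let curvature9 k j x a b : curvature_form om k j x a b =
  \sum_(p < 9) \sum_(q < 9) (q_curvZ a b p q)%:~R * (G x p k * G x q j).
Proof.
have -> : curvature_form om k j x a b =
    (partial k (fun y => om j y a b) x - partial j (fun y => om k y a b) x)
    + ((om k x *m om j x) a b - (om j x *m om k x) a b).
  by rewrite /curvature_form !mxE addrA.
rewrite !partial_om -sumrB !mxE -sumrB.
rewrite (eq_bigr (fun c : 'I_9 => \sum_(p < 9) \sum_(q < 9)
   ((q_connZ a b c)%:~R * (q_structZ c p q)%:~R) * (G x p k * G x q j))); last first.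
  move=> c _; rewrite -mulrBr; have := q_structure_equation x (ltn_ord c) k j.
  rewrite inord_val => ->; rewrite q_structZE // mulr_sumr; apply: eq_bigr => p _.
  by rewrite mulr_sumr; apply: eq_bigr => q _; rewrite mulrA.
rewrite [X in _ + X](eq_bigr (fun c : 'I_7 => \sum_(p < 9) \sum_(q < 9)
   ((q_connZ a c p)%:~R * (q_connZ c b q)%:~R
     - (q_connZ a c q)%:~R * (q_connZ c b p)%:~R) * (G x p k * G x q j))); last first.
  move=> c _; rewrite !mxE mulr_suml [X in _ - X]mulrC mulr_suml -sumrB.
  apply: eq_bigr => p _; rewrite !mulr_sumr -sumrB; apply: eq_bigr => q _.
  by ring.
rewrite exchange_big [X in _ + X]exchange_big -big_split; apply: eq_bigr => p _ /=.
rewrite exchange_big [X in _ + X]exchange_big -big_split; apply: eq_bigr => q _ /=.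
by rewrite -!mulr_suml -mulrDl q_curvZE.
Qed.

Let q_coframe_frame x (a i : 'I_7) : q_coframe x a i = G x (lshift 2 a) i.
Proof. by rewrite !mxE. Qed.

Let sum9 (F : 'I_9 -> R) : \sum_(p < 9) F p = \sum_(a < 7) F (lshift 2 a) + \sum_(a < 2) F (rshift 7 a).
Proof. exact: (@big_split_ord _ _ _ 7 2). Qed.

Let curvature7 k j x a b : curvature_form om k j x a b =
  \sum_(d < 7) \sum_(e < 7) (q_curvZ a b d e)%:~R * (q_coframe x d k * q_coframe x e j).
Proof.
have K0 (p q : 'I_9) : (7 <= p)%N || (7 <= q)%N -> q_curvZ a b p q = 0.
  have /implyP H := allnP q (allnP p (allnP b (allnP a q_curvature_check))).
  by move=> /H /eqP.
rewrite curvature9 sum9 [X in _ + X]big1 => [|p _]; last first.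
  by rewrite big1 // => q _; rewrite K0 ?mul0r //= leq_addr.
rewrite addr0; apply: eq_bigr => d _; rewrite sum9 [X in _ + X]big1 => [|q _]; last first.
  by rewrite K0 ?mul0r //= leq_addr orbT.
by rewrite addr0; apply: eq_bigr => e _; rewrite !q_coframe_frame.
Qed.

Let torsion_free_om i j a x :
  covariant_mx q_coframe om i x a j = covariant_mx q_coframe om j x a i.
Proof.
have pE k l : partial k (fun y => q_coframe y a l) x = partial k (fun y => G y (inord a) l) x.
  have -> // : (fun y => q_coframe y a l) = (fun y => G y (inord a) l).
  by apply/funext => y; rewrite !mxE inordK // (ltn_trans (ltn_ord a)).
have a9 : (a < 9)%N by exact: ltn_trans (ltn_ord a) _.
rewrite !covariant_mxE !pE.
have E := q_structure_equation x a9 i j; rewrite q_structZE // in E.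
apply/eqP; rewrite -subr_eq0 opprD addrACA E.
have omE k l : (om k x *m q_coframe x) a l = \sum_(p < 9) \sum_(q < 9)
    (if (q < 7)%N then q_connZ a q p else 0)%:~R * (G x p k * G x q l).
  rewrite mxE exchange_big sum9 /= [X in _ = _ + X]big1 ?addr0 => [|q _]; last first.
    by rewrite big1 // => p _; rewrite mul0r.
  apply: eq_bigr => b _; rewrite mxE mulr_suml; apply: eq_bigr => p _.
  by rewrite ltn_ord q_coframe_frame mulrA.
rewrite !omE [X in _ - X]exchange_big -sumrB -big_split big1 // => p _.
rewrite -sumrB -big_split big1 // => q _ /=.
have /eqP := allnP q (allnP p (allnP a q_torsion_check)).
move=> /(congr1 (fun z : int => z%:~R : R)); rewrite intrB intrD => E2.
by rewrite [G x q j * _]mulrC -mulrBl -mulrDl addrA E2 mul0r.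
Qed.

Let schwarz_q i j a b x :
  partial i (partial j (fun y => q_coframe y a b)) x =
  partial j (partial i (fun y => q_coframe y a b)) x.
Proof.
have a9 : (a < 9)%N by exact: ltn_trans (ltn_ord a) _.
have /andP[bd bd'] := allnP b (allnP (Ordinal a9) q_bounded_check).
have pE k : partial k (fun y => q_coframe y a b) = peval (R := R) (pdiff k (q_frame_entry a b)).
  by apply/funext => y; rewrite q_coframeE partial_peval.
rewrite !pE !partial_peval; [|exact: (allnP i bd')|exact: (allnP j bd')].
by apply: peval_eq; exact: (allnP j (allnP i (allnP b (allnP a q_schwarz_check)))).
Qed.

Lemma q_einstein x : ricci (fun y => (q_coframe y)^T *m q_coframe y) x =
  6%:R *: ((q_coframe x)^T *m q_coframe x).
Proof.
apply: (einstein_frame openT smooth_q_coframe smooth_om (fun y _ => q_coframe_unit y)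
  (fun i y _ => anti_om i y) (fun i j a y _ => torsion_free_om i j a y)
  (fun i j a b y _ => schwarz_q i j a b y) (K := fun a b d e => (q_curvZ a b d e)%:~R)) => //.
move=> b e; have /eqP E := allnP e (allnP b q_einstein_check).
rewrite (sumZE R 7 (fun a => q_curvZ a b a e)) E intrM; congr (_ * _).
by rewrite -val_eqE; case: (_ == _).
Qed.

Lemma leval_q_coframe x p : all (fun t => all (fun c => c < 7)%N t.2) p ->
  leval (q_coframe x) p = leval (q_frame x) p.
Proof.
move=> /allP Hp; rewrite /leval big_seq [RHS]big_seq; apply: eq_bigr => t /Hp /allP Ht.
congr (_ *: _); apply: row_wedge_mulmx_eq; rewrite -!map_comp; apply/eq_in_map => c /Ht c7 /=.
by apply/rowP => j; rewrite !mxE !inordK // (ltn_trans c7).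
Qed.

(** The result is expressed in [q_frame], since d of a coframe element may involve a_2 and a_3. *)
Lemma extd_q_coframe p x : all (fun t => all (fun c => c < 7)%N t.2) p ->
  extd (fun y => leval (q_coframe y) p) x = leval (q_frame x) (ldiff (se_terms q_structure) p).
Proof.
move=> Hp; have -> : (fun y => leval (q_coframe y) p) = (fun y => leval (q_frame y) p).
  by apply/funext => y; exact: leval_q_coframe.
apply: (extd_leval openT (Logic.I : setT x) smooth_q_frame) => [|c c9].
  by apply: sub_all Hp => t; apply: sub_all => c /ltn_trans; exact.
exact: q_structure_equation.
Qed.

End QManifold.

(** * The torsion of a warped Spin(7)-structure *)

Section WarpedStructures.
Variable R : realType.

Local Notation phi0 := (leval (1%:M : 'M[R]_7) g2_terms).
Local Notation psi0 := (leval (1%:M : 'M[R]_7) g2_dual_terms).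
Local Notation Phi := (leval (1%:M : 'M[R]_8) spin7_terms).

Lemma smooth_leval m n k (U : set 'rV[R]_n) (E : 'rV[R]_n -> 'M[R]_(m.+1, k)) p :
  open U -> smooth_mx U E -> smooth_ext U (fun x => leval (E x) p).
Proof.
move=> oU sE; apply: smooth_ext_sum => // t _; apply: smooth_extZ => //.
  exact: smooth_cst.
exact: smooth_row_wedge.
Qed.

Lemma homogeneous_extd n k (U : set 'rV[R]_n) (w : 'rV[R]_n -> ext R n) x :
  open U -> U x -> (forall y, U y -> homogeneous k (w y)) -> homogeneous k.+1 (extd w x).
Proof.
move=> oU Ux hw; rewrite extdE; apply: homogeneous_sum => i _.
rewrite -add1n; apply: homogeneous_wedge; first exact: homogeneous_covector.
move=> S Sk; rewrite ffunE (eq_partial i oU Ux (g := fun=> 0)) ?partial_cst // => y Uy.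
exact: hw.
Qed.

Lemma pull_unit_inj n (E : 'M[R]_n) a b : E \in unitmx -> pull E a = pull E b -> a = b.
Proof.
by move=> uE /(congr1 (pull (invmx E))); rewrite !pull_mulmx mulmxV // !pull1.
Qed.

Lemma pull_invmxK n (E : 'M[R]_n) a : E \in unitmx -> pull E (pull (invmx E) a) = a.
Proof. by move=> uE; rewrite pull_mulmx mulVmx // pull1. Qed.

Section FrameField.
Variables (U : set 'rV[R]_7) (I : set R) (E : 'rV[R]_7 -> 'M[R]_7) (f : R -> R).
Hypotheses (oU : open U) (oI : open I) (sE : smooth_mx U E).
Hypothesis df : forall k t, I t -> derivable (derive1n k f : R -> R) t 1.
Hypothesis f0 : forall t, I t -> f t != 0.

Definition warp_frame_field (y : 'rV[R]_8) : 'M[R]_8 :=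
  warp_frame (f (time_part y)) (E (base_part y)).

Lemma smooth_warp_frame_field : smooth_mx (cyl_set U I) warp_frame_field.
Proof.
move=> i j.
rewrite (_ : (fun x => _) = (fun y => match unlift ord_max i, unlift ord_max j with
   | Some a, Some b => f (time_part y) * E (base_part y) a b
   | None, None => 1 | _, _ => 0 end)); last by apply/funext => y; rewrite mxE.
case: (unlift _ i) => [a|]; case: (unlift _ j) => [b|].
2-4: exact: smooth_cst.
exact: (smoothM (open_cyl_set oU oI) (smooth_time oU oI df) (smooth_base (sE a b))).
Qed.

Lemma extd_warp_frame_field x t al be : U x -> I t ->
  homogeneous 4 al -> homogeneous 5 be ->
  extd (fun z => leval (E z) g2_terms) x = pull (E x) al ->
  extd (fun z => leval (E z) g2_dual_terms) x = pull (E x) be ->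
  extd (fun y => spin7_model (warp_frame_field y)) (cyl_coord x t) =
  pull (warp_frame (f t) (E x)) (warp_torsion (f t) ('D_1 f t) al be).
Proof.
move=> Ux It hal hbe Eal Ebe; have ft := f0 It.
rewrite (pull_warp_torsion _ _ ft hal hbe) -Eal -Ebe -leval_pull.
have Vxt : cyl_set U I (cyl_coord x t) by split; rewrite ?base_part_cyl ?time_part_cyl.
have := extd_warped oU oI (smooth_leval g2_terms oU sE) (smooth_leval g2_dual_terms oU sE) _ df Vxt.
rewrite base_part_cyl time_part_cyl => <-; last exact: homogeneous_leval.
apply: (congr1 (fun w => extd w (cyl_coord x t))); apply/funext => y.
exact: (esym (spin7_model_warp _ _)).
Qed.

End FrameField.

Section FromG2.
Variables (M : atlas R 7) (s : structure M) (I : set R) (f : R -> R).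

Lemma warped_form_frame a y (E : 'M[R]_7) : E \in unitmx ->
  Defs.form s a (base_part y) = g2_model E -> metric s a (base_part y) = E^T *m E ->
  volume s a (base_part y) = row_wedge E (enum 'I_7) ->
  warped_form (I := I) s f a y = spin7_model (warp_frame (f (time_part y)) E).
Proof.
move=> uE fE gE vE; rewrite -spin7_model_warp /warped_form /star fE gE vE.
by rewrite hodge_g2_model // g2_model_leval.
Qed.

End FromG2.

Section WarpedSpin7.
Variables (W : warped_spin7 R).
Local Notation I := (warp_interval W).
Local Notation f := (@warp R W).

Let oI : open I := (Defs.interval_open W).1.

(** The coframe supplied with W and the warped coframe F give the same 4-form, so
    [spin7_frame_unique] transfers metric and volume from one to the other. *)
Lemma warped_spin7_metric a y (E : 'M[R]_7) : cdom a (base_part y) -> I (time_part y) ->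
  E \in unitmx ->
  Defs.form (g2 W) a (base_part y) = g2_model E -> metric (g2 W) a (base_part y) = E^T *m E ->
  volume (g2 W) a (base_part y) = row_wedge E (enum 'I_7) ->
  let F := warp_frame (f (time_part y)) E in
  [/\ Defs.form (spin7 W) a y = spin7_model F, metric (spin7 W) a y = F^T *m F &
      volume (spin7 W) a y = row_wedge F (enum 'I_8)].
Proof.
move=> Ux It uE fE gE vE F.
have Vy : @cdom R 8 (cylinder I (Defs.base W)) a y by rewrite cdom_cylinder.
have FE : Defs.form (spin7 W) a y = spin7_model F.
  by rewrite spin7_form // (@warped_form_frame _ _ I f a y E uE fE gE vE).
have [_ _ _ /(_ a y Vy) [U [E8 [oU Uy _ _ /(_ y Uy) [uE8 fE8 gE8 vE8]]]]] := spin7_structure W.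
have uF : F \in unitmx by apply: warp_frame_unit => //; exact: warp_neq0.
have [gF vF] := spin7_frame_unique uF (etrans (esym fE8) FE).
by split=> //; [rewrite gE8 | rewrite vE8].
Qed.

(** The order of quantifiers is the point: E, al and be come from the base at x and are chosen
    before t, so along the whole line over x the torsion varies only through f and f'. *)
Lemma extd_warped_spin7 (a : chart_index (Defs.base W)) (x : 'rV[R]_7) :
  @cdom R 7 (Defs.base W) a x -> exists E al be, [/\
    E \in unitmx,
    forall t, I t -> metric (spin7 W) a (cyl_coord x t) = (warp_frame (f t) E)^T *m warp_frame (f t) E,
    forall t, I t -> volume (spin7 W) a (cyl_coord x t) = row_wedge (warp_frame (f t) E) (enum 'I_8),
    forall t, I t -> Defs.form (spin7 W) a (cyl_coord x t) = spin7_model (warp_frame (f t) E) &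
    forall t, I t -> extd (Defs.form (spin7 W) a) (cyl_coord x t) =
      pull (warp_frame (f t) E) (warp_torsion (f t) ('D_1 f t) al be)].
Proof.
move=> Ux; have [_ _ _ /(_ a x Ux) [U [E [oU Uxx UM sE HE]]]] := g2_structure W.
have unitE y : U y -> E y \in unitmx by move=> /HE[].
have hphi y : U y -> homogeneous 3 (leval (E y) g2_terms) by move=> _; exact: homogeneous_leval.
have hpsi y : U y -> homogeneous 4 (leval (E y) g2_dual_terms) by move=> _; exact: homogeneous_leval.
have hE := homogeneous_extd oU Uxx hphi; have hE' := homogeneous_extd oU Uxx hpsi.
have uEx := unitE x Uxx.
have met t : I t -> [/\ Defs.form (spin7 W) a (cyl_coord x t) = spin7_model (warp_frame (f t) (E x)),
    metric (spin7 W) a (cyl_coord x t) = (warp_frame (f t) (E x))^T *m warp_frame (f t) (E x) &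
    volume (spin7 W) a (cyl_coord x t) = row_wedge (warp_frame (f t) (E x)) (enum 'I_8)].
  move=> It; have [_ fE gE vE] := HE x Uxx.
  have := @warped_spin7_metric a (cyl_coord x t) (E x).
  by rewrite base_part_cyl time_part_cyl; apply.
exists (E x), (pull (invmx (E x)) (extd (fun z => leval (E z) g2_terms) x)).
exists (pull (invmx (E x)) (extd (fun z => leval (E z) g2_dual_terms) x)); split=> //.
- by move=> t /met[].
- by move=> t /met[].
- by move=> t /met[].
move=> t It.
rewrite -(extd_warp_frame_field oU oI sE (@warp_smooth R W) (@warp_neq0 R W) Uxx It
  (homogeneous_pull _ hE) (homogeneous_pull _ hE')) ?pull_invmxK //.
apply: (eq_extd (open_cyl_set oU oI)).
  by split; rewrite ?base_part_cyl ?time_part_cyl.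
move=> y [Uy Iy]; have [uEy fE gE vE] := HE _ Uy.
by have [-> _ _] := warped_spin7_metric (UM _ Uy) Iy uEy fE gE vE.
Qed.

End WarpedSpin7.
End WarpedStructures.

(** * Consequences of the torsion classes at a point *)

Section TorsionPointwise.
Import mathcomp.boot.finset mathcomp.boot.fintype.
Variable R : realType.

Local Notation psi0 := (leval (1%:M : 'M[R]_7) g2_dual_terms).
Local Notation Phi := (leval (1%:M : 'M[R]_8) spin7_terms).

Lemma homogeneous1_covector n (w : ext R n) : homogeneous 1 w ->
  w = covector (\row_i w [set i]%SET).
Proof.
move=> hw; apply/ffunP => S; rewrite ffunE.
have [S1|S1] := boolP (#|S| == 1%N).
  have [i ->] := cards1P S1.
  rewrite (bigD1 i) //= eqxx mul1r mxE big1 ?addr0 // => j /negbTE ji.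
  by rewrite (inj_eq set1_inj) eq_sym ji mul0r.
rewrite (hw S S1) big1 // => i _; have [Si|_] := eqVneq S [set i]%SET; last by rewrite mul0r.
by rewrite Si cards1 in S1.
Qed.

Section AtPoint.
Variables (N : atlas R 8) (s : structure N) (a : chart_index N) (y : 'rV[R]_8).
Variables (F : 'M[R]_8) (w : ext R 8).
Hypotheses (Vy : cdom a y) (uF : F \in unitmx).
Hypothesis formF : Defs.form s a y = spin7_model F.
Hypothesis metricF : metric s a y = F^T *m F.
Hypothesis volumeF : volume s a y = row_wedge F (enum 'I_8).
Hypothesis extdF : extd (Defs.form s a) y = pull F w.

Lemma star_coframe l5 v : l5 a y = pull F v -> star s l5 a y = pull F (flat_star v).
Proof. by move=> lE; rewrite /star metricF volumeF lE hodge_pull. Qed.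

Lemma class_Y2_coframe : in_class s ClassY2 -> wedge Phi (flat_star w) = 0.
Proof.
move=> [l1 [l5 [[_ _ /(_ a y Vy) ort /(_ a y Vy)]]]].
rewrite extdF => tor /(_ a y Vy) l10; rewrite l10 wedge0l add0r in tor.
apply: (pull_unit_inj uF); rewrite pull_wedge pull0 -(star_coframe (esym tor)) -ort.
by rewrite formF spin7_model_leval -leval_pull.
Qed.

Lemma class_Y1_coframe : in_class s ClassY1 -> exists u, w = wedge (covector u) Phi.
Proof.
move=> [l1 [l5 [[[hl1 _ _] _ _ /(_ a y Vy)]]]].
rewrite extdF => tor /(_ a y Vy) l50; rewrite l50 addr0 in tor.
have h1 := homogeneous_pull (invmx F) (hl1 _ _ Vy).
exists (\row_i pull (invmx F) (l1 a y) [set i]%SET).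
apply: (pull_unit_inj uF).
rewrite -homogeneous1_covector // pull_wedge pull_invmxK // tor.
by rewrite formF spin7_model_leval -leval_pull.
Qed.

End AtPoint.

Lemma class_P_sub (N : atlas R 8) (s : structure N) : in_class s ClassP ->
  in_class s ClassY1 /\ in_class s ClassY2.
Proof. by move=> [l1 [l5 [tor [h1 h5]]]]; split; exists l1, l5. Qed.

End TorsionPointwise.

(** * Einstein structures of type Y2 *)

Section Nonexistence.
Variables (R : realType) (W : warped_spin7 R).
Local Notation I := (warp_interval W).
Local Notation f := (@warp R W).
Local Notation M := (Defs.base W).

Let oI : open I := (Defs.interval_open W).1.

Lemma metric_warped (a : chart_index M) y : cyl_set (@cdom R 7 M a) I y ->
  metric (spin7 W) a y = warped_metric (metric (g2 W) a) f y.
Proof.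
move=> [Ux It]; have [_ _ _ /(_ a _ Ux)] := g2_structure W.
move=> [V [E [_ Vx _ _ /(_ _ Vx)[uE fE gE vE]]]].
have [_ -> _] := warped_spin7_metric Ux It uE fE gE vE.
by rewrite warp_frame_metric /warped_metric gE.
Qed.

Lemma balanced_warp_derive : in_class W ClassY2 ->
  exists c : R, forall t, I t -> 'D_1 f t = c.
Proof.
move=> Y2; have [_ [p _] /(_ p)[a pa] _ _] := base_manifold W.
have Ux : @cdom R 7 M a (Defs.coord a p) by exists p.
have [E [al [be [uE gE vE fE dE]]]] := extd_warped_spin7 Ux.
(* The number is <psi0, al> at a fixed base point p, hence independent of t. *)
exists (- (pairing (leval (1%:M : 'M[R]_7) g2_dual_terms) al / 28%:R)) => t It.
have Vy : @cdom R 8 (cylinder I M) a (cyl_coord (Defs.coord a p) t).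
  by rewrite cdom_cylinder; split; rewrite ?base_part_cyl ?time_part_cyl.
have ft := @warp_neq0 R W t It.
have uF := warp_frame_unit ft uE.
have := class_Y2_coframe Vy uF (fE _ It) (gE _ It) (vE _ It) (dE _ It) Y2.
move=> /(balanced_warp_torsion ft) e.
by apply: (@mulfI _ 28%:R) => //; rewrite mulrN mulrCA mulfV // mulr1; apply/eqP; rewrite -addr_eq0 e.
Qed.

Lemma balanced_einstein_scal0 : in_class W ClassY2 -> einstein (metric W) ->
  exists a y, @cdom R 8 (cylinder I M) a y /\ scal (metric W a) y = 0.
Proof.
move=> /balanced_warp_derive[c fc] [k Ek].
have [_ [p _] /(_ p)[a pa] /(_ a)[odom _ _ och] _] := base_manifold W.
have [t [_ [It _ _]]] := @warp_nonconstant R W.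
pose y := cyl_coord (Defs.coord a p) t.
have Ux : @cdom R 7 M a (Defs.coord a p) by exists p.
have Vy' : cyl_set (@cdom R 7 M a) I y by split; rewrite ?base_part_cyl ?time_part_cyl.
have Vy : @cdom R 8 (cylinder I M) a y by rewrite cdom_cylinder.
have oU : open (@cdom R 7 M a) by apply: och.
have [_ [gsym gsm _] _ gloc] := g2_structure W.
have df u : I u -> is_derive u 1 f ('D_1 f u).
  by move=> Iu; apply/derivableP; exact: (@warp_smooth R W 0).
have df1 u : I u -> is_derive u 1 ('D_1 f) 0.
  move=> Iu; apply: (@near_eq_is_derive _ _ _ (fun=> c)).
    by apply: filterS (open_nbhs_nbhs (conj oI Iu)) => z /fc.
have gm := metric_warped.
have sm : smooth_mx (@cdom R 7 M a) (metric (g2 W) a) by move=> i j; exact: gsm.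
have sy x : @cdom R 7 M a x -> (metric (g2 W) a x)^T = metric (g2 W) a x by move=> /gsym[].
have un x : @cdom R 7 M a x -> metric (g2 W) a x \in unitmx.
  move=> /gloc[V [E [_ Vx _ _ /(_ _ Vx)[uE _ -> _]]]].
  by rewrite unitmx_mul unitmx_tr uE.
have ric : ricci (metric W a) y = ricci (warped_metric (metric (g2 W) a) f) y.
  by apply: (eq_ricci (open_cyl_set oU oI) (fun z Vz => metric_warped Vz) Vy').
(* Since f'' = 0, the dt-dt entry of the Ricci tensor vanishes; that of the metric is 1, so the
   Einstein constant k is 0. *)
have := ricci_warp_TT oU oI sm sy un df df1 (@warp_neq0 R W) Vy'.
rewrite mul0r mulr0 oppr0 -ric Ek // mxE (metric_warped Vy') mxE unlift_none mulr1 => k0.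
exists a, y; split=> //; rewrite /scal big1 // => i _; rewrite big1 // => j _.
by rewrite Ek // k0 scale0r mxE mulr0.
Qed.

End Nonexistence.

(** * Structures given by a global coframe *)

Section EuclideanSpace.
Variables (R : realType) (n : nat).

Lemma second_countable_row : @second_countable 'rV[R]_n.
Proof.
pose b (p : 'rV[rat]_n * nat) : set 'rV[R]_n := ball (\row_j ratr (p.1 0 j) : 'rV[R]_n) p.2.+1%:R^-1.
exists (range b); last split.
- exact: (sub_countable (card_image_le _ _) (countableP _)).
- by move=> _ [p _ <-]; apply: ball_open; rewrite invr_gt0.
move=> x V /nbhs_ballP[_/posnumP[e] eV].
have [//|k] := @ltr_add_invr R 0%R (e%:num / 2) _; rewrite add0r => ke.
have k0 : 0 < k.+1%:R^-1 :> R by rewrite invr_gt0.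
have [q xq] : exists q : 'rV[rat]_n, forall j, ball (x 0 j) k.+1%:R^-1 (ratr (q 0 j) : R).
  have /choice[q xq] : forall j, exists r : rat, ball (x 0 j) k.+1%:R^-1 (ratr r : R).
    move=> j; have oB : open (ball (x 0 j) k.+1%:R^-1 : set R) by exact: ball_open.
    have [|z [xz [r _ rz]]] := @dense_rat R _ _ oB; first by exists (x 0 j); exact: ballxx.
    by exists r; rewrite rz.
  by exists (\row_j q j) => j; rewrite mxE.
have bq : ball (\row_j ratr (q 0 j) : 'rV[R]_n) k.+1%:R^-1 x.
  by split=> // i j; rewrite ord1 mxE; exact/ball_sym.
exists (b (q, k)); first by split; [exists (q, k) | ].
move=> z bz; apply: eV; rewrite [e%:num]splitr.
apply: (@ball_triangle _ _ (\row_j ratr (q 0 j) : 'rV[R]_n)); first exact/(le_ball (ltW ke))/ball_sym.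
exact: (le_ball (ltW ke)).
Qed.

Definition euclidean : atlas R n :=
  @Atlas R n 'rV[R]_n unit (fun _ => setT) (fun _ x => x).

Lemma cdom_euclidean a : @cdom R n euclidean a = setT.
Proof. exact: image_id. Qed.

Lemma is_manifold_euclidean : is_manifold euclidean.
Proof.
split.
- split; [exact: norm_hausdorff | exact: second_countable_row].
- by exists (0 : 'rV[R]_n).
- by move=> p; exists tt.
- move=> a; split=> //; first exact: openT.
    by apply: continuous_subspaceT => x; exact: cvg_id.
  by move=> O oO _; rewrite image_id.
- move=> a b; exists id => // i s x _; exact: (smooth_coord i).
Qed.

End EuclideanSpace.

Lemma gram_posdef (R : realType) n (E : 'M[R]_n) (u : 'rV[R]_n) : E \in unitmx -> u != 0 ->
  0 < (u *m (E^T *m E) *m u^T) 0 0.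
Proof.
move=> uE u0; have v0 : u *m E^T != 0.
  have uE' : E^T \in unitmx by rewrite unitmx_tr.
  by apply: contra u0 => /eqP v0; rewrite -(mulmxK uE' u) v0 mul0mx.
have -> : u *m (E^T *m E) *m u^T = (u *m E^T) *m (u *m E^T)^T.
  by rewrite trmx_mul trmxK !mulmxA.
move: (u *m E^T) v0 => v v0; rewrite mxE lt_neqAle eq_sym; apply/andP; split; last first.
  by apply: sumr_ge0 => i _; rewrite mxE -expr2 sqr_ge0.
apply: contra v0; rewrite psumr_eq0 => [/allP z0|i _]; last by rewrite mxE -expr2 sqr_ge0.
apply/eqP/rowP => i; rewrite [RHS]mxE; apply/eqP.
by have := z0 i (mem_index_enum i); rewrite [X in _ * X]mxE mulf_eq0 orbb.
Qed.

Section SingleChart.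
Variables (R : realType) (n : nat) (M : atlas R n).
Hypothesis oneM : forall a b : chart_index M, a = b.
Hypothesis openM : forall a : chart_index M, open (cdom a).

(** A transition is prescribed only on the image of the chart; as this is open, its derivatives
    there are those of the identity. *)
Lemma transition_jacobian1 (a b : chart_index M) F p : transition a b F ->
  chart_dom a p -> Defs.jacobian F (Defs.coord a p) = 1%:M.
Proof.
rewrite -(oneM a b) => tF ap; apply/matrixP => i j; rewrite mxE.
have Ux : cdom a (Defs.coord a p) by exists p.
transitivity (partial j (fun y : 'rV[R]_n => y 0 i) (Defs.coord a p)); last first.
  by rewrite partial_coord mxE eq_sym.
by apply: (eq_partial j (@openM a) Ux) => _ [q aq <-]; rewrite tF.

Qed.

Lemma is_form_single_chart k (w : chart_field M (ext R n)) :
  (forall a x, cdom a x -> homogeneous k (w a x)) ->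
  (forall a, smooth_ext (cdom a) (w a)) -> is_form k w.
Proof.
move=> hw sw; split=> // a b F tF p ap bp.
by rewrite (transition_jacobian1 tF ap) pull1 (oneM b a).
Qed.

Lemma is_metric_single_chart (g : chart_field M 'M[R]_n) :
  (forall a x, cdom a x -> (g a x)^T = g a x /\
     forall u : 'rV[R]_n, u != 0 -> 0 < (u *m g a x *m u^T) 0 0) ->
  (forall a, smooth_mx (cdom a) (g a)) -> is_metric g.
Proof.
move=> pg sg; split=> // a b F tF p ap bp.
by rewrite /= (transition_jacobian1 tF ap) trmx1 mul1mx mulmx1 (oneM b a).
Qed.

Section Coframe.
Variables (k : nat) (model : 'M[R]_n -> ext R n) (E : 'rV[R]_n -> 'M[R]_n).

Definition coframe_structure : structure M :=
  Structure (fun _ x => model (E x)) (fun _ x => (E x)^T *m E x)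
    (fun _ x => row_wedge (E x) (enum 'I_n)).

Hypothesis hom_model : forall A, homogeneous k (model A).
Hypothesis smooth_model : forall U (A : 'rV[R]_n -> 'M[R]_n), open U -> smooth_mx U A ->
  smooth_ext U (fun x => model (A x)).
Hypothesis smoothE : forall a, smooth_mx (@cdom R n M a) E.
Hypothesis unitE : forall a x, @cdom R n M a x -> E x \in unitmx.

Lemma coframe_structureP : locally_modelled k model coframe_structure.
Proof.
split.
- apply: is_form_single_chart => [a x _|a]; first exact: hom_model.
  exact: (smooth_model (@openM a) (@smoothE a)).
- apply: is_metric_single_chart => [a x Ux|a]; last first.
    by apply: smooth_mxM => //; exact: smooth_mx_tr.
  split=> [|u u0]; first by rewrite trmx_mul trmxK.
  exact: gram_posdef (unitE Ux) u0.
- apply: is_form_single_chart => [a x Ux|a]; last exact: smooth_row_wedge.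
  by have := @homogeneous_row_wedge R n n (E x) (enum 'I_n); rewrite size_enum_ord.
- move=> a x Ux; exists (cdom a), E; split=> //; first exact: smoothE.
  by move=> y Uy; split=> //; exact: (unitE Uy).
Qed.

End Coframe.
End SingleChart.

Section SmoothModels.
Variables (R : realType) (n : nat) (U : set 'rV[R]_n).
Hypothesis oU : open U.

Lemma smooth_pairing m (a : ext R m) (w : 'rV[R]_n -> ext R m) : smooth_ext U w ->
  smooth_on U (fun x => pairing a (w x)).
Proof.
move=> sw; apply: smooth_sum => // S _; apply: smoothM => //; exact: smooth_cst.
Qed.

Lemma smooth_g2_model (A : 'rV[R]_n -> 'M[R]_7) : smooth_mx U A ->
  smooth_ext U (fun x => g2_model (A x)).
Proof.
move=> sA; rewrite (_ : (fun x => _) = fun x => leval (A x) g2_terms).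
  exact: smooth_leval.
by apply/funext => x; rewrite g2_model_leval.
Qed.

Lemma smooth_spin7_model (A : 'rV[R]_n -> 'M[R]_8) : smooth_mx U A ->
  smooth_ext U (fun x => spin7_model (A x)).
Proof.
move=> sA; rewrite (_ : (fun x => _) = fun x => leval (A x) spin7_terms).
  exact: smooth_leval.
by apply/funext => x; rewrite spin7_model_leval.
Qed.

End SmoothModels.

(** * Torsion forms of a structure given by a global coframe *)

Section CoframeTorsion.
Variables (R : realType) (N : atlas R 8) (E : 'rV[R]_8 -> 'M[R]_8).
Hypothesis oneN : forall a b : chart_index N, a = b.
Hypothesis openN : forall a : chart_index N, open (cdom a).
Hypothesis smoothE : forall a, smooth_mx (@cdom R 8 N a) E.
Hypothesis unitE : forall a x, @cdom R 8 N a x -> E x \in unitmx.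

Local Notation Phi := (leval (1%:M : 'M[R]_8) spin7_terms).

Lemma lee_form_wedge (u : 'rV[R]_8) : lee_form (wedge (covector u) Phi) = u.
Proof.
apply/rowP => i; rewrite mxE pairing_covector_spin7 -rowE !mxE mulrA.
by rewrite mulVf ?mul1r// pnatr_eq0.
Qed.

Lemma homogeneous_spin7_model (A : 'M[R]_8) : homogeneous 4 (spin7_model A).
Proof. by rewrite spin7_model_leval; exact: homogeneous_leval. Qed.

Lemma pull_lee_wedge (A : 'M[R]_8) u :
  pull A (wedge (covector u) Phi) = wedge (covector (u *m A)) (spin7_model A).
Proof. by rewrite pull_covector_wedge spin7_model_leval -leval_pull. Qed.

Let s := coframe_structure N (@spin7_model R) E.
Let dPhi := extd (fun y => spin7_model (E y)).

Definition frame_torsion y := pull (invmx (E y)) (extd (fun y => spin7_model (E y)) y).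

Let l1 : chart_field N (ext R 8) :=
  fun _ y => covector (lee_form (frame_torsion y) *m E y).
Let l5 : chart_field N (ext R 8) :=
  fun a y => dPhi y - wedge (l1 a y) (spin7_model (E y)).

Lemma homogeneous_frame_torsion a y : @cdom R 8 N a y -> homogeneous 5 (frame_torsion y).
Proof.
move=> Uy; apply/homogeneous_pull/(homogeneous_extd (@openN a) Uy) => z _.
exact: homogeneous_spin7_model.
Qed.

Lemma smooth_dPhi a : smooth_ext (@cdom R 8 N a) dPhi.
Proof. by apply: smooth_extd => //; exact: smooth_spin7_model. Qed.

Lemma smooth_frame_torsion a : smooth_ext (@cdom R 8 N a) frame_torsion.
Proof.
apply: smooth_pull => //; last exact: smooth_dPhi.
by apply: smooth_invmx => // x; exact: unitE.
Qed.

Lemma smooth_lee a : smooth_mx (@cdom R 8 N a) (fun y => lee_form (frame_torsion y)).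
Proof.
move=> i j.
rewrite (_ : (fun x => _) = fun y => 7%:R^-1 *
  pairing (wedge (covector (delta_mx 0 j)) Phi) (frame_torsion y)); last first.
  by apply/funext => y; rewrite mxE.
apply: smoothM => //; first exact: smooth_cst.
by apply: smooth_pairing => //; exact: smooth_frame_torsion.
Qed.

(** Here l1 is the projection [lee_form] taken in the coframe and carried back by it, and l5 is the
    remainder; orthogonality is checked in the standard frame and pulled back. *)
Lemma coframe_torsion_forms : torsion_forms s l1 l5.
Proof.
have sl1 a : smooth_ext (@cdom R 8 N a) (l1 a).
  by apply: smooth_covector => //; apply: smooth_mxM => //; exact: smooth_lee.
have l5E a y : @cdom R 8 N a y -> l5 a y =
    pull (E y) (frame_torsion y - wedge (covector (lee_form (frame_torsion y))) Phi).
  move=> Uy; rewrite -[in RHS]scaleN1r pullD pullZ scaleN1r pull_lee_wedge.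
  by rewrite pull_invmxK // (unitE Uy).
split.
- apply: is_form_single_chart => // a y _; exact: homogeneous_covector.
- apply: is_form_single_chart => // a.
    move=> y Uy; rewrite (l5E a) //; apply/homogeneous_pull/homogeneousB.
      exact: homogeneous_frame_torsion Uy.
    by apply: (@homogeneous_wedge _ _ 1 4); [exact: homogeneous_covector | exact: homogeneous_spin7].
  rewrite (_ : l5 a = fun y => dPhi y + (-1) *: wedge (l1 a y) (spin7_model (E y))).
    apply: smooth_extD => //; first exact: smooth_dPhi.
    apply: smooth_extZ => //; first exact: smooth_cst.
    by apply: smooth_wedge => //; exact: smooth_spin7_model.
  by apply/funext => y; rewrite scaleN1r.
- move=> a y Uy; rewrite (star_coframe (unitE Uy) _ _ (l5E a y Uy)) //.
  rewrite [Defs.form _ _ _]spin7_model_leval leval_pull -pull_wedge lee_form_orthogonal ?pull0 //.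
  exact: homogeneous_frame_torsion Uy.
- by move=> a y _; rewrite /l5 addrC subrK.
Qed.

Lemma coframe_class_Y : in_class s ClassY.
Proof. by exists l1, l5; split=> //; exact: coframe_torsion_forms. Qed.

Lemma coframe_class_Y1 :
  (forall a y, @cdom R 8 N a y -> exists u, frame_torsion y = wedge (covector u) Phi) ->
  in_class s ClassY1.
Proof.
move=> H; exists l1, l5; split; first exact: coframe_torsion_forms.
move=> a y Uy; have [u Hu] := H a y Uy.
rewrite /l5 /l1 Hu lee_form_wedge -pull_lee_wedge -Hu pull_invmxK ?subrr //.
exact: unitE Uy.
Qed.

Lemma coframe_class_P :
  (forall a y, @cdom R 8 N a y -> frame_torsion y = 0) -> in_class s ClassP.
Proof.
move=> H; exists l1, l5; split; first exact: coframe_torsion_forms.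
have c0 : covector (0 : 'rV[R]_8) = 0 by rewrite -(scale0r 0) covectorZ scale0r.
have l0 a y : @cdom R 8 N a y -> lee_form (frame_torsion y) = 0.
  by move=> Uy; rewrite (H a) // -(wedge0l Phi) -c0 lee_form_wedge.
split=> a y Uy; first by rewrite /l1 (l0 a) // mul0mx.
rewrite /l5 /l1 (l0 a) // mul0mx c0 wedge0l subr0.
by rewrite -[LHS](pull_invmxK _ (unitE Uy)) -/(frame_torsion y) (H a) // pull0.
Qed.

End CoframeTorsion.

(** * Warped products over an Einstein base *)

(* If Ric(g) = 6 g on a 7-manifold, these f make f^2 g + dt^2 Einstein with
   constant 7 lam. *)
Record warping (R : realType) (lam : R) := Warping {
  w_dom : set R;
  w_fun : R -> R;
  w_der : R -> R;
  w_open : open w_dom;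
  w_interval : is_interval w_dom;
  w_nonempty : w_dom !=set0;
  w_derive : forall t, w_dom t -> is_derive t 1 w_fun (w_der t);
  w_derive2 : forall t, w_dom t -> is_derive t 1 w_der (- lam * w_fun t);
  w_neq0 : forall t, w_dom t -> w_fun t != 0;
  w_der_neq0 : forall t, w_dom t -> w_der t != 0;
  w_conserved : forall t, w_dom t -> w_der t ^+ 2 + lam * w_fun t ^+ 2 = 1 }.

Section WarpedExample.
Variables (R : realType) (lam : R) (w : warping lam) (E : 'rV[R]_7 -> 'M[R]_7).
Hypothesis smoothE : smooth_mx setT E.
Hypothesis unitE : forall x, E x \in unitmx.
Hypothesis einsteinE : forall x,
  ricci (fun y => (E y)^T *m E y) x = 6%:R *: ((E x)^T *m E x).

Local Notation I := (w_dom w).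
Local Notation f := (w_fun w).
Local Notation f1 := (w_der w).

Let oI : open I := @w_open R lam w.
Let df t : I t -> is_derive t 1 f (f1 t) := @w_derive _ _ w t.
Let df1 t : I t -> is_derive t 1 f1 (- lam * f t) := @w_derive2 _ _ w t.
Let f_neq0 t : I t -> f t != 0 := @w_neq0 _ _ w t.

Local Notation M := (euclidean R 7).
Local Notation N := (cylinder I M).
Local Notation F := (warp_frame_field E f).
Local Notation psi0 := (leval (1%:M : 'M[R]_7) g2_dual_terms).
Local Notation phi0 := (leval (1%:M : 'M[R]_7) g2_terms).
Local Notation Phi := (leval (1%:M : 'M[R]_8) spin7_terms).

(** The equation f'' = -lam f keeps every derivative in the span of f and f', whence smoothness. *)
Lemma derive1n_warp k : exists a b, forall t, I t -> derive1n k f t = a * f t + b * f1 t.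
Proof.
elim: k => [|k [a [b IH]]]; first by exists 1, 0 => t _; rewrite mul1r mul0r addr0.
exists (- b * lam), a => t It; rewrite derive1nS derive1E.
have D : is_derive t 1 (a *: f + b *: f1) (a *: f1 t + b *: (- lam * f t)).
  have := df It; have := df1 It => h1 h; exact: is_deriveD.
transitivity ('D_1 (a *: f + b *: f1) t).
  apply: (@near_eq_derive R R R).
  by apply: filterS (open_nbhs_nbhs (conj oI It)) => z /IH.
by rewrite derive_val /GRing.scale /=; ring.
Qed.

Lemma derivable_derive1n_warp k t : I t -> derivable (derive1n k f : R -> R) t 1.
Proof.
move=> It; have [a [b E']] := derive1n_warp k.
apply: (@near_eq_derivable _ _ _ (a *: f + b *: f1)).
  by apply: filterS (open_nbhs_nbhs (conj oI It)) => z /E' ->.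
have := df It; have := df1 It => h1 h.
by apply: derivableD; apply: derivableZ; apply: ex_derive.
Qed.

Lemma warp_nonconstant_example : exists t u, [/\ I t, I u & f t != f u].
Proof.
have [t It] := w_nonempty w; apply: contrapT => H.
have fcst u : I u -> f u = f t.
  by move=> Iu; apply/eqP; apply: contrapT => /negP ne; apply: H; exists u, t.
have := w_der_neq0 It; have [_ <-] := df It.
have -> : 'D_1 f t = 'D_1 (cst (f t) : R -> R) t.
  apply: (@near_eq_derive R R R).
  by apply: filterS (open_nbhs_nbhs (conj oI It)) => z /fcst.
by rewrite derive_cst eqxx.
Qed.

Let oneM (a b : chart_index M) : a = b. Proof. by case: a; case: b. Qed.
Let oneN (a b : chart_index N) : a = b. Proof. by case: a; case: b. Qed.
Let openM (a : chart_index M) : open (@cdom R 7 M a).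
Proof. by rewrite cdom_euclidean; exact: openT. Qed.

Let cdomN (a : chart_index N) : @cdom R 8 N a = cyl_set setT I.
Proof. by rewrite cdom_cylinder cdom_euclidean. Qed.

Let openN (a : chart_index N) : open (@cdom R 8 N a).
Proof. by rewrite cdomN; exact: open_cyl_set openT oI. Qed.

Let smoothF (a : chart_index N) : smooth_mx (@cdom R 8 N a) F.
Proof.
by rewrite cdomN; exact: (smooth_warp_frame_field openT oI smoothE derivable_derive1n_warp).
Qed.

Let unitF (a : chart_index N) y : @cdom R 8 N a y -> F y \in unitmx.
Proof.
by rewrite cdomN => -[_ It]; apply: warp_frame_unit; [exact: f_neq0 | exact: unitE].
Qed.

Definition example_g2 : structure M := coframe_structure M (@g2_model R) E.
Definition example_spin7 : structure N := coframe_structure N (@spin7_model R) F.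

Lemma example_g2P : is_g2_structure example_g2.
Proof.
apply: coframe_structureP => //.
- by move=> A; rewrite g2_model_leval; exact: homogeneous_leval.
- by move=> U A oU; exact: smooth_g2_model.
- by move=> a; rewrite cdom_euclidean.
Qed.

Lemma example_spin7P : is_spin7_structure example_spin7.
Proof.
apply: coframe_structureP => //.
- exact: homogeneous_spin7_model.
- by move=> U A oU; exact: smooth_spin7_model.
Qed.

Lemma example_form a y : @cdom R 8 N a y ->
  Defs.form example_spin7 a y = warped_form example_g2 f a y.
Proof. by move=> _; rewrite (@warped_form_frame _ _ _ I f a y (E (base_part y))). Qed.

Definition example : warped_spin7 R :=
  @WarpedSpin7 R M (@is_manifold_euclidean R 7) example_g2 example_g2P I (conj oI (@w_interval _ _ w)) f
    derivable_derive1n_warp f_neq0 warp_nonconstant_example example_spin7 example_spin7P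
    example_form.

Let symg x : [set: 'rV[R]_7] x -> ((E x)^T *m E x)^T = (E x)^T *m E x.
Proof. by move=> _; rewrite trmx_mul trmxK. Qed.

Let unitg x : [set: 'rV[R]_7] x -> (E x)^T *m E x \in unitmx.
Proof. by move=> _; rewrite unitmx_mul unitmx_tr unitE. Qed.

Let smoothg : smooth_mx setT (fun x => (E x)^T *m E x).
Proof. by apply: smooth_mxM => //; [exact: openT | exact: smooth_mx_tr]. Qed.

Lemma ricci_example a y : @cdom R 8 N a y ->
  ricci (metric example a) y = (7%:R * lam) *: metric example a y.
Proof.
rewrite cdomN => Vy.
have E8 : metric example a = warped_metric (fun x => (E x)^T *m E x) f.
  by apply/funext => z; exact: warp_frame_metric.
rewrite E8; apply: (ricci_warp openT oI smoothg symg unitg df df1 f_neq0 Vy) => //.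
- by move=> x _; rewrite einsteinE; congr (_ *: _); ring.
- by case: Vy => _ /w_conserved.
Qed.

(** The trace of 7 lam times the identity in dimension 8. *)
Lemma scal_example a y : @cdom R 8 N a y -> scal (metric example a) y = 56%:R * lam.
Proof.
move=> Vy; have uF := unitF Vy.
have ug : metric example a y \in unitmx by rewrite /= unitmx_mul unitmx_tr uF.
rewrite /scal ricci_example //.
transitivity (\tr (invmx (metric example a y) *m ((7%:R * lam) *: (metric example a y)^T))).
  by apply: eq_bigr => i _; rewrite mxE; apply: eq_bigr => j _; rewrite !mxE.
rewrite [X in _ *: X](_ : _ = metric example a y); last by rewrite /= trmx_mul trmxK.
by rewrite -scalemxAr mulVmx // mxtraceZ mxtrace1; ring.
Qed.

Lemma einstein_example : einstein (metric example).
Proof. by exists (7%:R * lam) => a y; exact: ricci_example. Qed.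

Lemma ricci_flat_example : lam = 0 -> ricci_flat (metric example).
Proof. by move=> l0 a y /ricci_example ->; rewrite l0 mulr0 scale0r. Qed.

Lemma positive_scal_example : 0 < lam -> positive_scal (metric example).
Proof. by move=> l0 a y /scal_example ->; rewrite mulr_gt0. Qed.

Lemma negative_scal_example : lam < 0 -> negative_scal (metric example).
Proof. by move=> l0 a y /scal_example ->; rewrite pmulr_rlt0. Qed.

(** The components of d phi in the coframe E; [ddual] gives those of d *phi. *)
Definition dform x := pull (invmx (E x)) (extd (fun z => leval (E z) g2_terms) x).
Definition ddual x := pull (invmx (E x)) (extd (fun z => leval (E z) g2_dual_terms) x).

Lemma homogeneous_dform x : homogeneous 4 (dform x).
Proof.
apply/homogeneous_pull/(@homogeneous_extd _ _ 3 setT) => //; first exact: openT.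
by move=> y _; exact: homogeneous_leval.
Qed.

Lemma homogeneous_ddual x : homogeneous 5 (ddual x).
Proof.
apply/homogeneous_pull/(@homogeneous_extd _ _ 4 setT) => //; first exact: openT.
by move=> y _; exact: homogeneous_leval.
Qed.

Lemma extd_example a x t : I t -> extd (Defs.form example a) (cyl_coord x t) =
  pull (F (cyl_coord x t)) (warp_torsion (f t) (f1 t) (dform x) (ddual x)).
Proof.
move=> It; have [_ <-] := df It.
have := extd_warp_frame_field openT oI smoothE derivable_derive1n_warp f_neq0 (Logic.I : [set: 'rV[R]_7] x) It
  (homogeneous_dform x) (homogeneous_ddual x).
by rewrite /dform /ddual !pull_invmxK // /warp_frame_field base_part_cyl time_part_cyl; apply.
Qed.

Lemma frame_torsion_example x t : I t -> frame_torsion F (cyl_coord x t) =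
  warp_torsion (f t) (f1 t) (dform x) (ddual x).
Proof.
move=> It; have Vy : @cdom R 8 N tt (cyl_coord x t).
  by rewrite cdomN; split; rewrite ?time_part_cyl.
apply: (pull_unit_inj (unitF Vy)); rewrite -(extd_example tt) // pull_invmxK //.
exact: unitF Vy.
Qed.

Let cdom_coord x t : I t -> @cdom R 8 N tt (cyl_coord x t).
Proof. by move=> It; rewrite cdomN; split; rewrite ?time_part_cyl. Qed.

Lemma example_class_Y : in_class example ClassY.
Proof. exact: coframe_class_Y oneN openN smoothF unitF. Qed.

Lemma example_class_Y2 x t : I t -> in_class example ClassY2 ->
  28%:R * f1 t + pairing psi0 (dform x) = 0.
Proof.
move=> It Y2; apply: (balanced_warp_torsion (f_neq0 It)).
exact: (class_Y2_coframe (cdom_coord x It) (unitF (cdom_coord x It)) _ _ _ (extd_example tt x It) Y2).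
Qed.

(** In type Y1 the torsion is u /\ Phi. Paired with dt /\ xi, for xi orthogonal to every e^i /\
    phi0, it shows only the dt-component of u; on such xi, d phi therefore acts as a multiple of
    psi0. *)
Lemma example_class_Y1 x t : I t -> in_class example ClassY1 ->
  exists c, forall xi : ext R 7, (forall i, pairing xi (wedge (covector (row i 1%:M)) phi0) = 0) ->
  pairing xi (dform x) = c * pairing xi psi0.
Proof.
move=> It Y1; have ft := f_neq0 It.
have [|u Hu] := class_Y1_coframe (cdom_coord x It) (unitF (cdom_coord x It)) _ (extd_example tt x It) Y1.
  by [].
(* Solves (4 f' <xi, psi0> + <xi, d phi>) / f = u_8 <xi, psi0> for <xi, d phi>, where u_8 is the
   dt-component of u. *)
exists (f t * u 0 ord_max - 4%:R * f1 t) => xi Hxi.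
have := pairing_dt_wedge_spin7 u Hxi; rewrite -Hu pairing_dt_warp_torsion => e.
by rewrite mulrBl -mulrA -e mulrA mulfV // mul1r addrC addKr.
Qed.

Section NearlyParallel.
Hypothesis dform4 : forall x, dform x = 4%:R *: psi0.
Hypothesis ddual0 : forall x, ddual x = 0.

Lemma frame_torsion_nearly_parallel y : cyl_set setT I y ->
  frame_torsion F y = wedge (covector (((f (time_part y))^-1 *
     (4%:R * f1 (time_part y) + 4%:R)) *: delta_mx 0 ord_max)) Phi.
Proof.
move=> [_ It]; rewrite -{1}[y]cyl_coordK frame_torsion_example // dform4 ddual0.
rewrite /warp_torsion pull0 addr0 -scalerDl pullZ covectorZ wedgeZl wedgeZr scalerA.
by rewrite -/(dt R 7) dt_wedge_spin7.
Qed.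

Lemma nearly_parallel_class_P : (forall t, I t -> f1 t = -1) -> in_class example ClassP.
Proof.
move=> f1E; apply: (coframe_class_P oneN openN smoothF unitF) => a y; rewrite cdomN => Vy.
rewrite frame_torsion_nearly_parallel // f1E; last by case: Vy.
by rewrite mulrN1 addNr mulr0 covectorZ wedgeZl scale0r.
Qed.

Lemma nearly_parallel_class_Y1 : in_class example ClassY1.
Proof.
apply: (coframe_class_Y1 oneN openN smoothF unitF) => a y; rewrite cdomN => Vy.
by eexists; exact: frame_torsion_nearly_parallel.
Qed.

(** The only proper subclass of Y1 is P, which lies in Y2, and membership there would force 28 f' +
    28 = 0. *)
Lemma nearly_parallel_strict_Y1 : (forall t, I t -> 0 < f1 t) -> strict_type example ClassY1.
Proof.
move=> f1_gt0; split=> [|[] // _ /class_P_sub[_]]; first exact: nearly_parallel_class_Y1.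
have [t It] := w_nonempty w => /(example_class_Y2 0 It); apply/eqP.
rewrite dform4 pairingZr pairing_psi0; apply: lt0r_neq0.
by rewrite ltr_wpDr ?mulr_gt0 ?f1_gt0 // mulr_ge0.
Qed.

End NearlyParallel.
End WarpedExample.

(** * The examples *)

Section QForms.
Import mathcomp.fingroup.fingroup mathcomp.fingroup.perm.
Variable R : realType.

Local Notation psi0 := (leval (1%:M : 'M[R]_7) g2_dual_terms).
Local Notation phi0 := (leval (1%:M : 'M[R]_7) g2_terms).

Lemma q_dform x : dform (@q_coframe R) x = 4%:R *: psi0.
Proof.
rewrite /dform extd_q_coframe //.
have -> : leval (q_frame x) (ldiff (se_terms q_structure) g2_terms) =
    leval (q_coframe x) (lscale 4 g2_dual_terms).
  by rewrite leval_q_coframe //; apply: leval_eq; vm_compute.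
by rewrite leval_pull pull_mulmx mulmxV ?q_coframe_unit // pull1 leval_scale.
Qed.

Lemma q_ddual x : ddual (@q_coframe R) x = 0.
Proof.
rewrite /ddual extd_q_coframe //.
have -> : leval (q_frame x) (ldiff (se_terms q_structure) g2_dual_terms) = leval (q_frame x) [::].
  by apply: leval_eq; vm_compute.
by rewrite leval_nil pull0.
Qed.

(* Exchanging e^3 and e^4 keeps the metric but not the nearly parallel form. *)
Definition q_swap (i : nat) : nat := if i == 2%N then 3 else if i == 3%N then 2 else i.

Definition lswap (p : lform) : lform := [seq (t.1, map q_swap t.2) | t <- p].

Definition swapped_coframe (x : 'rV[R]_7) : 'M[R]_7 :=
  row_perm (tperm (inord 2) (inord 3)) (q_coframe x).

Lemma row_swapped x i : (i < 7)%N ->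
  row (inord i) (swapped_coframe x) = row (inord (q_swap i)) (q_coframe x).
Proof.
move=> i7; apply/rowP => j; rewrite !mxE; congr (peval (q_frame_entry (val _) _) _).
rewrite /q_swap; have [->|i2] := eqVneq i 2%N; first by rewrite tpermL.
have [->|i3] := eqVneq i 3%N; first by rewrite tpermR.
by rewrite tpermD // -val_eqE /= !inordK // eq_sym.
Qed.

Lemma leval_swapped x p : all (fun t => all (fun i => i < 7)%N t.2) p ->
  leval (swapped_coframe x) p = leval (q_coframe x) (lswap p).
Proof.
move=> /allP Hp; rewrite /leval big_map big_seq [RHS]big_seq; apply: eq_bigr => t /Hp /allP Ht.
congr (_ *: _); apply: row_wedge_mulmx_eq; rewrite -!map_comp; apply/eq_in_map => i /Ht i7 /=.
exact: row_swapped.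
Qed.

Lemma smooth_swapped : smooth_mx setT swapped_coframe.
Proof.
move=> i j; rewrite (_ : (fun x => _) = fun x : 'rV[R]_7 => q_coframe x (tperm (inord 2) (inord 3) i) j).
  exact: smooth_q_coframe.
by apply/funext => x; rewrite mxE.
Qed.

Lemma swapped_unit x : swapped_coframe x \in unitmx.
Proof. by rewrite /swapped_coframe row_permE unitmx_mul unitmx_perm q_coframe_unit. Qed.

Lemma swapped_metric x : (swapped_coframe x)^T *m swapped_coframe x = (q_coframe x)^T *m q_coframe x.
Proof.
rewrite /swapped_coframe row_permE trmx_mul mulmxA -(mulmxA (q_coframe x)^T) tr_perm_mx -perm_mxM.
by rewrite mulVg perm_mx1 mulmx1.
Qed.

Lemma swapped_einstein x : ricci (fun y => (swapped_coframe y)^T *m swapped_coframe y) x =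
  6%:R *: ((swapped_coframe x)^T *m swapped_coframe x).
Proof.
rewrite swapped_metric -q_einstein; apply: (congr1 (fun g => ricci g x)).
by apply/funext => y; exact: swapped_metric.
Qed.

(** The swapped form is differentiated in [q_frame], then the terms in a_2 and a_3 are dropped, as
    these vanish at the origin, and the second [lswap] returns to the swapped coframe. Hence the
    result is valid at the origin, which suffices to refute a torsion class. *)
Definition swapped_dform_terms : lform :=
  lnorm (lswap [seq t <- lnorm (ldiff (se_terms q_structure) (lswap g2_terms)) |
                all (fun i => i < 7)%N t.2]).

Lemma row_wedge0 m n (E : 'M[R]_(m, n)) i s : i \in s -> row i E = 0 -> row_wedge E s = 0.
Proof.
move=> + Ei; elim: s => [//|j s IH]; rewrite inE row_wedge_cons => /orP[/eqP <-|/IH ->].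
  by rewrite Ei -(scale0r 0) covectorZ scale0r wedge0l.
exact: wedge0r.
Qed.

Lemma row_q_frame0 i : (7 <= i < 9)%N -> row (inord i) (q_frame (0 : 'rV[R]_7)) = 0.
Proof.
have q0 k : (k < 7)%N -> q_val (0 : 'rV[R]_7) k = 0 by rewrite /q_val => ->; rewrite mxE.
move=> /andP[i7 i9]; apply/rowP => j; rewrite !mxE inordK //.
have /predU1P[->|/eqP ->] : (i == 7) || (i == 8) by lia.
  by case: j => [[|[|[|[|[|[|[]]]]]]]] //= _; rewrite /q_frame_entry /= ?peval_nil //
    peval1 !big_cons q0 // mul0r mulr0.
by case: j => [[|[|[|[|[|[|[]]]]]]]] //= _; rewrite /q_frame_entry /= ?peval_nil //
    peval1 !big_cons q0 // mul0r mulr0.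
Qed.

Lemma leval_q_frame0 p : all (fun t => all (fun i => i < 9)%N t.2) p ->
  leval (q_frame (0 : 'rV[R]_7)) p =
  leval (q_coframe 0) [seq t <- p | all (fun i => i < 7)%N t.2].
Proof.
move=> Hp; rewrite leval_q_coframe; last exact: filter_all.
rewrite /leval big_filter [RHS]big_mkcond big_seq [RHS]big_seq /=; apply: eq_bigr => t /(allP Hp) /allP t9.
case: ifP => // /negbT /allPn[i ti]; rewrite -leqNgt => i7.
rewrite [mono_wedge _ _](row_wedge0 (map_f _ ti)) ?scaler0 // row_q_frame0 //.
by rewrite i7 t9.
Qed.

Lemma swapped_dform0 : dform swapped_coframe 0 = leval (1%:M : 'M[R]_7) swapped_dform_terms.
Proof.
rewrite /dform (_ : (fun z => leval (swapped_coframe z) g2_terms) =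
   fun z : 'rV[R]_7 => leval (q_coframe z) (lswap g2_terms)); last first.
  by apply/funext => z; rewrite leval_swapped.
rewrite extd_q_coframe // -leval_norm leval_q_frame0 //.
rewrite (_ : leval (q_coframe 0) _ = leval (swapped_coframe 0) swapped_dform_terms).
  by rewrite leval_pull pull_mulmx mulmxV ?swapped_unit // pull1.
have lt7 : all (fun t => all (fun i => i < 7)%N t.2) swapped_dform_terms by vm_compute.
by rewrite (leval_swapped _ lt7); apply: leval_eq; vm_compute.
Qed.

Lemma swapped_dform_valid : lvalid 7 swapped_dform_terms.
Proof. by vm_compute. Qed.

Lemma swapped_pairing_dual : pairing psi0 (dform swapped_coframe 0) = 20%:R.
Proof.
rewrite swapped_dform0 (pairing_leval _ _ swapped_dform_valid) //.
Qed.

(** No term of phi is contained in e^1234 or in e^1256, so both are orthogonal to every e^i /\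
    phi. *)
Lemma orthogonal_phi_check : alln 7 (fun i =>
  let q := lnorm (lmul [:: (1, [:: i])] g2_terms) in
  [&& lvalid 7 q, lpair [:: (1, [:: 0; 1; 2; 3]%N)] q == 0 & lpair [:: (1, [:: 0; 1; 4; 5]%N)] q == 0]).
Proof. by vm_compute. Qed.

(** The test forms e^1234 and e^1256 both pair to 1 with psi0, but to 0 and 4 with d phi. *)
Lemma swapped_not_proportional (c : R) :
  ~ (forall xi : ext R 7, (forall i, pairing xi (wedge (covector (row i 1%:M)) phi0) = 0) ->
  pairing xi (dform swapped_coframe 0) = c * pairing xi psi0).
Proof.
move=> H.
have ort s (i : 'I_7) : s = [:: 0; 1; 2; 3]%N \/ s = [:: 0; 1; 4; 5]%N ->
    pairing (leval 1%:M [:: (1, s)]) (wedge (covector (row i (1%:M : 'M[R]_7))) phi0) = 0.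
  have -> : covector (row i (1%:M : 'M[R]_7)) = leval 1%:M [:: (1, [:: val i])].
    by rewrite leval1 scale1r /mono_wedge /= inord_val row_wedge_cons wedge1r.
  have /and3P[vq /eqP q1 /eqP q2] := allnP i orthogonal_phi_check.
  by rewrite -leval_mul -(leval_norm _ (lmul _ _)) => -[->|->]; rewrite pairing_leval // ?q1 ?q2.
have H1 := H _ (fun i => ort _ i (or_introl erefl)).
have H2 := H _ (fun i => ort _ i (or_intror erefl)).
rewrite swapped_dform0 (pairing_leval _ _ swapped_dform_valid) // pairing_leval // in H1.
rewrite swapped_dform0 (pairing_leval _ _ swapped_dform_valid) // pairing_leval // in H2.
have e1 : lpair [:: (1, [:: 0; 1; 2; 3]%N)] swapped_dform_terms = 0 by vm_compute.
have e2 : lpair [:: (1, [:: 0; 1; 4; 5]%N)] swapped_dform_terms = 4 by vm_compute.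
have e3 : lpair [:: (1, [:: 0; 1; 2; 3]%N)] g2_dual_terms = 1 by vm_compute.
have e4 : lpair [:: (1, [:: 0; 1; 4; 5]%N)] g2_dual_terms = 1 by vm_compute.
rewrite e1 e3 mulr1 in H1; rewrite e2 e4 mulr1 -H1 in H2.
by move/eqP: H2; rewrite -[4%:~R]/(4%:R : R) pnatr_eq0.
Qed.

End QForms.

Section QExamples.
Variables (R : realType) (lam : R) (w : warping lam).

Definition q_example : warped_spin7 R := example w (@smooth_q_coframe R) (@q_coframe_unit R).

Definition swapped_example : warped_spin7 R :=
  example w (@smooth_swapped R) (@swapped_unit R).

Hypothesis increasing_w : forall t, w_dom w t -> 0 < w_der w t.

Lemma q_example_strict_Y1 : strict_type q_example ClassY1.
Proof. exact: (nearly_parallel_strict_Y1 _ _ (@q_dform R) (@q_ddual R)). Qed.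

(** The class P lies in Y1 and in Y2, so it is enough to exclude these two; both are excluded over
    the origin of the base. *)
Lemma swapped_example_strict_Y : strict_type swapped_example ClassY.
Proof.
have [t It] := w_nonempty w.
have nY1 : ~ in_class swapped_example ClassY1.
  by move=> /(example_class_Y1 0 It)[c]; exact: swapped_not_proportional.
have nY2 : ~ in_class swapped_example ClassY2.
  move=> /(example_class_Y2 0 It); apply/eqP.
  rewrite swapped_pairing_dual; apply: lt0r_neq0.
  by rewrite ltr_wpDr // mulr_gt0 // increasing_w.
by split=> [|[] // _ /class_P_sub[]//]; exact: example_class_Y.
Qed.

Lemma increasing_example c : c = ClassY1 \/ c = ClassY ->
  exists W : warped_spin7 R, [/\ strict_type W c, einstein (metric W),
    (lam = 0 -> ricci_flat (metric W)), (0 < lam -> positive_scal (metric W)) &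
    (lam < 0 -> negative_scal (metric W))].
Proof.
have qe := @q_einstein R; have se := @swapped_einstein R.
case=> ->; [exists q_example | exists swapped_example]; split.
- exact: q_example_strict_Y1.
- exact: einstein_example.
- exact: ricci_flat_example.
- exact: positive_scal_example.
- exact: negative_scal_example.
- exact: swapped_example_strict_Y.
- exact: einstein_example.
- exact: ricci_flat_example.
- exact: positive_scal_example.
- exact: negative_scal_example.
Qed.

End QExamples.

(** * Solutions of f'^2 + lam f^2 = 1 for lam = 0, 1, -1 *)

Section WarpingFunctions.
Variable R : realType.

Let is_interval_oo (a b : itv_bound R) : is_interval [set` Interval a b].
Proof. exact: interval_is_interval. Qed.

Definition cone_warping : warping (0 : R).
Proof.
apply: (@Warping R 0 `]0, +oo[ id (fun=> 1)).
- exact: interval_open.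
- exact: is_interval_oo.
- by exists 1; rewrite /= in_itv /= ltr01.
- by move=> t _; rewrite oppr0 mul0r; exact: is_derive_cst.
- by move=> t; rewrite /= in_itv /= andbT => /lt0r_neq0.
- by move=> t _; exact: oner_neq0.
- by move=> t _; rewrite expr1n mul0r addr0.
Defined.

Definition reversed_cone_warping : warping (0 : R).
Proof.
apply: (@Warping R 0 `]0, +oo[ -%R (fun=> -1)).
- exact: interval_open.
- exact: is_interval_oo.
- by exists 1; rewrite /= in_itv /= ltr01.
- by move=> t _; rewrite oppr0 mul0r; exact: is_derive_cst.
- by move=> t; rewrite /= in_itv /= andbT oppr_eq0 => /lt0r_neq0.
- by move=> t _; rewrite oppr_eq0 oner_neq0.
- by move=> t _; rewrite sqrrN expr1n mul0r addr0.
Defined.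

(** The sine is positive up to pi; stopping at pi / 2 keeps its derivative positive as well, which
    the exclusion of type Y2 uses. *)
Definition sine_warping : warping (1 : R).
Proof.
apply: (@Warping R 1 `]0, (pi / 2)[ (@sin R) (@cos R)).
- exact: interval_open.
- exact: is_interval_oo.
- by exists (pi / 4%:R); rewrite /= in_itv /=; apply/andP; split; have := @pi_gt0 R; lra.
- by move=> t _; rewrite mulN1r; exact: is_derive_cos.
- move=> t; rewrite /= in_itv /= => /andP[t0 tp]; apply/lt0r_neq0/sin_gt0_pi.
  by apply/andP; split=> //; have := @pi_gt0 R; lra.
- move=> t; rewrite /= in_itv /= => /andP[t0 tp]; apply/lt0r_neq0/cos_gt0_pihalf.
  by apply/andP; split=> //; have := @pi_gt0 R; lra.
- by move=> t _; rewrite mul1r cos2Dsin2.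
Defined.

Let expRN_derive (t : R) : is_derive t 1 (fun t : R => expR (- t)) (- expR (- t)).
Proof.
have := @is_derive1_comp R expR -%R t _ _ (is_derive_expR (- t)) (is_deriveNid t 1).
by rewrite mulrN1.
Qed.

Definition sinh_warping : warping (-1 : R).
Proof.
apply: (@Warping R (-1) `]0, +oo[ (fun t => 2^-1 * (expR t - expR (- t)))
   (fun t => 2^-1 * (expR t + expR (- t)))).
- exact: interval_open.
- exact: is_interval_oo.
- by exists 1; rewrite /= in_itv /= ltr01.
- move=> t _; have := is_deriveZ (2^-1) (is_deriveB (is_derive_expR t) (expRN_derive t)).
  by rewrite opprK; apply.
- move=> t _; have := is_deriveZ (2^-1) (is_deriveD (is_derive_expR t) (expRN_derive t)).
  by rewrite opprK mul1r; apply.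
- move=> t; rewrite /= in_itv /= andbT => t0; apply: lt0r_neq0.
  by rewrite mulr_gt0 ?invr_gt0 // subr_gt0 ltr_expR; lra.
- move=> t _; apply: lt0r_neq0.
  by rewrite mulr_gt0 ?invr_gt0 // addr_gt0 ?expR_gt0.
- move=> t _; have := expRN t; have := expR_gt0 t; move: (expR t) => e e0 ->.
  by field; rewrite gt_eqF.
Defined.

End WarpingFunctions.

Theorem theorem7p7 (R : realType) :
  (forall c : torsion_class, admissible ScalZero c ->
     exists W : warped_spin7 R,
       strict_type W c /\ ricci_flat (metric W))
  /\
  (forall c : torsion_class, admissible ScalPositive c ->
     exists W : warped_spin7 R,
       [/\ strict_type W c, einstein (metric W) & positive_scal (metric W)])
  /\
  ((forall c : torsion_class, admissible ScalNegative c -> c <> ClassY2 ->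
     exists W : warped_spin7 R,
       [/\ strict_type W c, einstein (metric W) & negative_scal (metric W)])
   /\
   ~ (exists W : warped_spin7 R,
       [/\ strict_type W ClassY2, einstein (metric W)
         & negative_scal (metric W)])).
Proof.
have cone_gt0 t : w_dom (cone_warping R) t -> 0 < w_der (cone_warping R) t.
  by move=> _; exact: ltr01.
have sine_gt0 t : w_dom (sine_warping R) t -> 0 < w_der (sine_warping R) t.
  rewrite /= in_itv /= => /andP[t0 tp]; apply: cos_gt0_pihalf.
  by apply/andP; split=> //; have := @pi_gt0 R; lra.
have sinh_gt0 t : w_dom (sinh_warping R) t -> 0 < w_der (sinh_warping R) t.
  by move=> _; rewrite mulr_gt0 ?invr_gt0 // addr_gt0 ?expR_gt0.
split=> [[] // _|].
- exists (q_example (reversed_cone_warping R)); split.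
    (* P has no proper subclass, so strictness reduces to membership. *)
    split=> [|[] //].
    by apply: nearly_parallel_class_P => //; [exact: q_dform | exact: q_ddual].
  by apply: ricci_flat_example => //; exact: q_einstein.
- by have [W [WT _ /(_ erefl) Wf _ _]] := increasing_example cone_gt0 (or_introl erefl); exists W.
- by have [W [WT _ /(_ erefl) Wf _ _]] := increasing_example cone_gt0 (or_intror erefl); exists W.
split=> [[] // _|].
- by have [W [WT We _ /(_ ltr01) Wp _]] := increasing_example sine_gt0 (or_introl erefl); exists W.
- by have [W [WT We _ /(_ ltr01) Wp _]] := increasing_example sine_gt0 (or_intror erefl); exists W.
split=> [[] // _ nY2|[W [[Y2 _] We Wn]]].
- by have [W [WT We _ _ /(_ (ltrN10 _)) Wn]] := increasing_example sinh_gt0 (or_introl erefl); exists W.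
- by have [W [WT We _ _ /(_ (ltrN10 _)) Wn]] := increasing_example sinh_gt0 (or_intror erefl); exists W.
(* The scalar curvature of such a structure vanishes at some point, against its negativity there. *)
have [a [y [Vy s0]]] := balanced_einstein_scal0 Y2 We.
by have := Wn a y Vy; rewrite s0 ltxx.
Qed.
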